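(* Consider $-y''+q(x)y=\lambda y$ on $(0,\infty)$ with $q(x)=\frac{q_0}{x^2}+\frac{q_1}{x}+\sum_{n=0}^\infty q_{n+2}x^n$, where the $q_n$ are real, the series converges on $(0,\infty)$, $q_0\ge-\tfrac14$, and $q_0,q_1$ are not both zero; assume $\lim_{x\to\infty}q(x)=0$ and that for some $x_0>0$ either (a) $q\in L_1(x_0,\infty)$, or (b) $q'\in L_1(x_0,\infty)$ and $q\in AC_{loc}[x_0,\infty)$. Let $\phi,\theta$ be the normalized Frobenius solutions, $m$ the Titchmarsh–Weyl function, $\rho$ the spectral function, $U_1=(P_1,Q_1,R_1)^T$ the solution of the Appell system with $\lim_{x\to\infty}U_1=(\sqrt\lambda,0,1/\sqrt\lambda)^T$, and $a^*,b^*,c^*$ the coefficients, all as in the context; put $\xi(\lambda)=-\frac{b^*}{2a^*}+i\frac1{a^*}$ and $\xi_2(\lambda)=\frac1{a^*(\lambda)}$. Then (whether $0$ is limit point or limit circle) $\rho$ is absolutely continuous on $(0,\infty)$ and for all $\lambda\in(0,\infty)$ its density $f=\rho'$ satisfies \[f(\lambda)=\lim_{\epsilon\downarrow0}\frac1\pi\mathrm{Im}[m(\lambda+i\epsilon)]=\frac{\xi_2(\lambda)}{\pi}=\frac1{\pi a^*(\lambda)}=\frac{1}{\pi[P_1(x,\lambda)\phi(x,\lambda)^2+Q_1(x,\lambda)\phi(x,\lambda)\phi'(x,\lambda)+R_1(x,\lambda)\phi'(x,\lambda)^2]}\] for every $x\in(0,\infty)$.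
   Context: Write $q_0=\nu^2-\tfrac14$, $\nu\ge0$. Frobenius solutions at the regular singular point $0$: if $2\nu\notin\mathbb Z$, $y_1=x^{1/2+\nu}(1+\sum_{n\ge1}a_n(\lambda)x^n)$, $y_2=x^{1/2-\nu}(1+\sum_{n\ge1}b_n(\lambda)x^n)$, with $W(y_1,y_2)=-2\nu$; if $q_0=\ell(\ell+1)$, $\ell=0,1,\dots$: $y_1=x^{\ell+1}(1+\sum a_nx^n)$, $y_2=K_\ell(\lambda)y_1\ln x+x^{-\ell}(1+\sum d_nx^n)$, $W=-(2\ell+1)$; if $q_0=N^2-\tfrac14$, $N=0,1,\dots$: $y_1=x^{1/2+N}(1+\sum a_nx^n)$, and $y_2=y_1\ln x+\sum_{n\ge1}d_nx^{1/2+n}$ ($N=0$, $W=1$) or $y_2=K_N(\lambda)y_1\ln x+x^{1/2-N}(1+\sum d_nx^n)$ ($N\ge1$, $W=-2N$). Here $a_n,b_n,d_n,K$ are real polynomials in $\lambda$ determined by the Frobenius method, so $y_1,y_2$ are entire in $\lambda$, real for real $\lambda$, and $W(y_1,y_2)=y_1y_2'-y_1'y_2=C$ is a nonzero real constant independent of $\lambda$. Set $\phi=y_1$, $\theta=y_2/C$, so $W(\phi,\theta)=1$. If $0$ is limit circle, the self-adjoint realization uses the boundary condition $\lim_{x\to0}W_x(y,\phi(\cdot,0))=0$; if limit point no condition is needed. The Titchmarsh–Weyl function $m(\lambda)$, $\mathrm{Im}\lambda\ne0$, is defined by $\theta(\cdot,\lambda)-m(\lambda)\phi(\cdot,\lambda)\in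 L_2(x_0,\infty)$ for $x_0>0$; the spectral function $\rho$ of this realization satisfies $\rho(\lambda)-\rho(\lambda_0)=\lim_{\epsilon\downarrow0}\frac1\pi\int_{\lambda_0}^\lambda\mathrm{Im}[m(\mu+i\epsilon)]d\mu$ for $\lambda_0,\lambda$ not eigenvalues. Appell system: $(P,Q,R)'=M(P,Q,R)^T$, $M=\begin{pmatrix}0&\lambda-q&0\\-2&0&2(\lambda-q)\\0&-1&0\end{pmatrix}$; under the hypotheses, for each $\lambda>0$ it has a unique solution $U_1$ with the stated limit at $\infty$. The real numbers $a^*,b^*,c^*$ are the unique coefficients with $U_1=a^*((\theta')^2,-2\theta\theta',\theta^2)^T+b^*(\theta'\phi',-(\theta\phi'+\theta'\phi),\theta\phi)^T+c^*((\phi')^2,-2\phi\phi',\phi^2)^T$. *)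

(* Defs.v *)
From Stdlib Require Import Reals List.
From Coquelicot Require Import Coquelicot.
Open Scope R_scope.

Definition qfun (qs : nat -> R) (x : R) : R :=
  qs 0%nat / x ^ 2 + qs 1%nat / x + Series (fun n => qs (n + 2)%nat * x ^ n).

Definition nu (qs : nat -> R) : R := sqrt (qs 0%nat + / 4).

Fixpoint peval (p : list R) (z : C) : C :=
  match p with
  | nil => RtoC 0
  | c :: t => (RtoC c + z * peval t z)%C
  end.

Definition cpt (a b : R) : C := (a, b).

Definition solves (q : R -> R) (lam : C) (y dy : R -> C) : Prop :=
  forall x, 0 < x ->
    is_derive y x (dy x) /\ is_derive dy x ((RtoC (q x) - lam) * y x)%C.

Definition L2_near0 (y : R -> C) : Prop :=
  ex_RInt_gen (fun x => Cmod (y x) ^ 2) (at_right 0) (at_point 1).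

Definition L2_at_infty (y : R -> C) (x0 : R) : Prop :=
  ex_RInt_gen (fun x => Cmod (y x) ^ 2) (at_point x0) (Rbar_locally p_infty).

Definition L2_0_infty (y : R -> C) : Prop :=
  ex_RInt_gen (fun x => Cmod (y x) ^ 2) (at_right 0) (Rbar_locally p_infty).

Definition L1_at_infty (f : R -> R) (x0 : R) : Prop :=
  ex_RInt_gen (fun x => Rabs (f x)) (at_point x0) (Rbar_locally p_infty).

Definition limit_circle_0 (q : R -> R) : Prop :=
  forall y dy, solves q (RtoC 0) y dy -> L2_near0 y.

Fixpoint intervals_in (a b : R) (l : list (R * R)) : Prop :=
  match l with
  | nil => True
  | (c, d) :: t => a <= c /\ c <= d /\ d <= b /\ intervals_in d b t
  end.

Definition total_length (l : list (R * R)) : R :=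
  fold_right (fun p acc => (snd p - fst p) + acc) 0 l.

Definition total_variation (f : R -> R) (l : list (R * R)) : R :=
  fold_right (fun p acc => Rabs (f (snd p) - f (fst p)) + acc) 0 l.

Definition abs_continuous_on (f : R -> R) (a b : R) : Prop :=
  forall eps, 0 < eps -> exists delta, 0 < delta /\
    forall l, intervals_in a b l -> total_length l < delta ->
      total_variation f l < eps.

Definition AC_loc_from (f : R -> R) (x0 : R) : Prop :=
  forall b, x0 <= b -> abs_continuous_on f x0 b.

Definition AC_on_pos (f : R -> R) : Prop :=
  forall a b, 0 < a -> a <= b -> abs_continuous_on f a b.

Definition frobenius_phi (qs : nat -> R) (phi dphi : R -> C -> C) : Prop :=
  exists a : nat -> list R,
    forall lam : C,
      solves (qfun qs) lam (fun x => phi x lam) (fun x => dphi x lam) /\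
      forall x, 0 < x -> exists s : C,
        is_series (fun n => (peval (a n) lam * RtoC (x ^ (n + 1)))%C) s /\
        phi x lam = (RtoC (Rpower x (/ 2 + nu qs)) * (1 + s))%C.

(* W(y1,y2) = C *)
Definition wronski_const (qs : nat -> R) : R :=
  if Req_EM_T (nu qs) 0 then 1 else - (2 * nu qs).

Definition frobenius_theta (qs : nat -> R) (phi theta dtheta : R -> C -> C)
  : Prop :=
  (forall lam : C,
      solves (qfun qs) lam (fun x => theta x lam) (fun x => dtheta x lam)) /\
  exists (K : list R) (d : nat -> list R),
    forall (lam : C) (x : R), 0 < x -> exists s : C,
      is_series (fun n => (peval (d n) lam * RtoC (x ^ (n + 1)))%C) s /\
      (nu qs = 0 ->
         theta x lam
         = ((phi x lam * RtoC (ln x) + RtoC (Rpower x (/ 2)) * s) / RtoC (wronski_const qs))%C) /\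
      (* 2 nu an integer >= 1 (q0 = l(l+1) or q0 = N^2-1/4, N >= 1):
         y2 = K(lam) y1 ln x + x^(1/2-nu) (1 + sum_{n>=1} d_n x^n) *)
      (nu qs <> 0 -> (exists k : nat, 2 * nu qs = INR k) ->
         theta x lam
         = ((peval K lam * phi x lam * RtoC (ln x)
             + RtoC (Rpower x (/ 2 - nu qs)) * (1 + s)) / RtoC (wronski_const qs))%C) /\
      (~ (exists k : nat, 2 * nu qs = INR k) ->
         theta x lam = ((RtoC (Rpower x (/ 2 - nu qs)) * (1 + s)) / RtoC (wronski_const qs))%C).

(* lam (real) is an eigenvalue of the self-adjoint realization: a nonzero
   L2(0,oo) solution, satisfying the boundary condition at 0 when 0 is
   limit circle. *)
Definition eigenvalue (qs : nat -> R) (phi dphi : R -> C -> C) (lam : R)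
  : Prop :=
  exists y dy,
    solves (qfun qs) (RtoC lam) y dy /\
    (exists x, 0 < x /\ y x <> RtoC 0) /\
    L2_0_infty y /\
    (limit_circle_0 (qfun qs) ->
      filterlim (fun x => (y x * dphi x (RtoC 0) - dy x * phi x (RtoC 0))%C)
        (at_right 0) (locally (RtoC 0))).

Definition appell_solution (q : R -> R) (lam : R) (P Q R : R -> R) : Prop :=
  forall x, 0 < x ->
    is_derive P x ((lam - q x) * Q x) /\
    is_derive Q x (-2 * P x + 2 * (lam - q x) * R x) /\
    is_derive R x (- Q x).

Definition xi2 (astar : R -> R) (lam : R) : R := / astar lam.

(* Main.v *)
(* For real lambda, the coefficients P, Q, R of U1 make [E = P |y|^2 + Q Re (conj y y') + R |y'|^2]
   constant along solutions of the equation, and [4 P R - Q^2 = 4].  Let [psi = theta - m phi] be the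
   Weyl solution at [lambda + i e].  With the flux [W = Im (conj psi psi')] one has
   [E' = - 2 e R W], [W' = - e |psi|^2], [E >= 2 W], and [E / (2 W)] is the hyperbolic cosine of the
   distance between [psi' / psi] and [M = (- Q + 2 i) / (2 R)] in the upper half-plane.  Since all
   these quantities vanish at infinity and [R] is close to [1 / sqrt lambda] there, [E - 2 W] is
   [o (W)] as [e -> 0], locally uniformly in lambda; hence [psi' / psi -> M].  The integrability
   hypothesis on [q] or [q'] is only used for this uniformity: it controls the trace
   [P / s + s R] with [s = sqrt lambda] or [s = sqrt (lambda - q)].
   Then [m = (theta' - M theta) / (phi' - M phi)] converges because phi and theta are continuous in
   lambda (from the Frobenius recursion), and the limit has imaginary part
   [1 / (P phi^2 + Q phi phi' + R phi'^2) = 1 / a]. *)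
Require Import Defs.
From Stdlib Require Import Reals Classical List Lra Lia Psatz.
From Coquelicot Require Import Coquelicot.
Open Scope R_scope.

Set Bullet Behavior "Strict Subproofs".

(** The obstacle is that [m] is known only pointwise, through square integrability of [psi]: neither
    analyticity nor continuity of [m] is given, whereas the formula for [rho] integrates [Im m] over
    mu. Continuity in mu at a fixed height e is therefore proved directly, by bounding the Wronskian
    of the Weyl solutions at two energies by their fluxes. Together with the uniformity of the limit
    e -> 0 it yields a limit of [Im m] jointly in (mu, e). The joint limit gives the derivative of
    [rho] (the integrand is nearly constant on a small rectangle) and the continuity of [1 / astar],
    hence a local Lipschitz bound for [rho]. No positive number is an eigenvalue, so the formula for
    [rho] holds between any two positive points. All values are taken at x = 1, where the logarithm
    vanishes and every power of x is 1, so that Frobenius expansions reduce to sums of coefficients.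
    Complex solutions are split into real and imaginary parts: estimates on half-lines become the
    monotonicity of explicit real functions, compared with their decay at infinity. *)

Ltac der :=
  auto_derive;
  [ repeat split; auto; try (eexists; eassumption)
  | repeat match goal with
    | H : is_derive ?f ?x ?l |- context [Derive ?g ?x] =>
        replace (Derive g x) with l by (symmetry; apply is_derive_unique; exact H)
    end ].

(** * Solutions at complex energy *)

Lemma nondecreasing_of_derive (f df : R -> R) (u v : R) :
  u <= v -> (forall x, u <= x <= v -> is_derive f x (df x)) ->
  (forall x, u <= x <= v -> 0 <= df x) -> f u <= f v.
Proof.
  intros Huv Hd Hp.
  destruct (MVT_gen f u v df) as [c [Hc He]].
  - rewrite Rmin_left, Rmax_right by lra. intros x Hx. apply Hd. lra.
  - rewrite Rmin_left, Rmax_right by lra. intros x Hx.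
    apply derivable_continuous_pt. exists (df x). apply is_derive_Reals. apply Hd. lra.
  - rewrite Rmin_left, Rmax_right in Hc by lra.
    assert (0 <= df c) by (apply Hp; lra). nra.
Qed.

Lemma constant_of_derive (f : R -> R) :
  (forall x, 0 < x -> is_derive f x 0) -> forall x y, 0 < x -> 0 < y -> f x = f y.
Proof.
  intros Hd.
  assert (H : forall x y, 0 < x -> x <= y -> f x = f y).
  { intros x y Hx Hxy. apply Rle_antisym.
    - apply (nondecreasing_of_derive f (fun _ => 0)); [lra | | intros; lra].
      intros z Hz. apply Hd. lra.
    - assert (- f x <= - f y).
      { apply (nondecreasing_of_derive (fun z => - f z) (fun _ => 0)); [lra | | intros; lra].
        intros z Hz. specialize (Hd z ltac:(lra)). der. ring. }
      lra. }
  intros x y Hx Hy. destruct (Rle_dec x y); [apply H; lra | symmetry; apply H; lra].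
Qed.

(* The solution is [a + i b], its derivative [c + i d], the spectral parameter [l + i e]. *)
Definition rsol (q : R -> R) (l e : R) (a b c d : R -> R) : Prop :=
  forall x, 0 < x ->
    is_derive a x (c x) /\ is_derive b x (d x) /\
    is_derive c x ((q x - l) * a x + e * b x) /\
    is_derive d x ((q x - l) * b x - e * a x).

Lemma is_derive_Re (f : R -> C) (x : R) (l : C) :
  is_derive (V := C_R_NormedModule) f x l -> is_derive (fun t => Re (f t)) x (Re l).
Proof.
  intros H.
  pose proof (filterdiff_comp' (V := C_R_NormedModule) f (fun t : C => fst t) x
    (fun y : R => scal (V := C_R_NormedModule) y l) (fun t : C => fst t) H) as Hc.
  eapply filterdiff_ext_lin; [apply Hc|].
  - apply filterdiff_linear, is_linear_fst.
  - reflexivity.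
Qed.

Lemma is_derive_Im (f : R -> C) (x : R) (l : C) :
  is_derive (V := C_R_NormedModule) f x l -> is_derive (fun t => Im (f t)) x (Im l).
Proof.
  intros H.
  pose proof (filterdiff_comp' (V := C_R_NormedModule) f (fun t : C => snd t) x
    (fun y : R => scal (V := C_R_NormedModule) y l) (fun t : C => snd t) H) as Hc.
  eapply filterdiff_ext_lin; [apply Hc|].
  - apply filterdiff_linear, is_linear_snd.
  - reflexivity.
Qed.

Lemma solves_rsol (q : R -> R) (z : C) (y dy : R -> C) :
  solves q z y dy ->
  rsol q (Re z) (Im z) (fun x => Re (y x)) (fun x => Im (y x))
    (fun x => Re (dy x)) (fun x => Im (dy x)).
Proof.
  intros H x Hx. destruct (H x Hx) as [H1 H2].
  refine (conj _ (conj _ (conj _ _))).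
  - exact (is_derive_Re _ _ _ H1).
  - exact (is_derive_Im _ _ _ H1).
  - evar_last; [exact (is_derive_Re _ _ _ H2)|]. destruct z, (y x); simpl; ring.
  - evar_last; [exact (is_derive_Im _ _ _ H2)|]. destruct z, (y x); simpl; ring.
Qed.

Section Solution.

Variables (q : R -> R) (l e : R) (a b c d : R -> R).
Hypothesis Hs : rsol q l e a b c d.

Definition normsq (u v : R -> R) (x : R) : R := u x ^ 2 + v x ^ 2.
(** [cross + i flux] is [conj y * y'] for y = a + i b and y' = c + i d; hence the identity
    [cross_flux_sq]. *)
Definition cross (x : R) : R := a x * c x + b x * d x.
Definition flux (x : R) : R := a x * d x - b x * c x.

Lemma is_derive_normsq x : 0 < x -> is_derive (normsq a b) x (2 * cross x).
Proof.
  intros Hx. destruct (Hs x Hx) as (H1 & H2 & H3 & H4). unfold normsq, cross.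
  der. ring.
Qed.

(** The imaginary part e of the spectral parameter drops out, [conj y * (i e y)] being purely
    imaginary; so [L2_solution_small] covers real and complex energies alike. *)
Lemma is_derive_cross x :
  0 < x -> is_derive cross x (normsq c d x + (q x - l) * normsq a b x).
Proof.
  intros Hx. destruct (Hs x Hx) as (H1 & H2 & H3 & H4). unfold normsq, cross.
  der. ring.
Qed.

Lemma is_derive_flux x : 0 < x -> is_derive flux x (- e * normsq a b x).
Proof.
  intros Hx. destruct (Hs x Hx) as (H1 & H2 & H3 & H4). unfold normsq, flux.
  der. ring.
Qed.

Lemma cross_flux_sq x : cross x ^ 2 + flux x ^ 2 = normsq a b x * normsq c d x.
Proof. unfold cross, flux, normsq. ring. Qed.

Lemma normsq_nonneg u v x : 0 <= normsq u v x.
Proof. unfold normsq. nra. Qed.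

(* If [|y|^2 + |y'|^2] stayed away from 0, then [(|y|^2)'] would tend to infinity. *)
Lemma L2_solution_small (H : R -> R) (B eta Y : R) :
  is_lim q p_infty 0 ->
  (forall x, 1 <= x -> is_derive H x (normsq a b x)) ->
  (forall x, 1 <= x -> H x <= B) -> 0 < eta ->
  exists x, 1 <= x /\ Y <= x /\ normsq a b x + normsq c d x < eta.
Proof.
  intros Hq HH HB Heta.
  apply is_lim_spec in Hq. destruct (Hq (mkposreal 1 Rlt_0_1)) as [X1 HX1]. simpl in HX1.
  set (Y0 := Rmax 1 (Rmax Y (X1 + 1))).
  assert (HY0 : 1 <= Y0 /\ Y <= Y0 /\ X1 < Y0).
  { unfold Y0. pose proof (Rmax_l 1 (Rmax Y (X1 + 1))). pose proof (Rmax_r 1 (Rmax Y (X1 + 1))).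
    pose proof (Rmax_l Y (X1 + 1)). pose proof (Rmax_r Y (X1 + 1)). lra. }
  clearbody Y0. destruct HY0 as (HY1 & HY2 & HY3).
  apply NNPP. intros Hno.
  assert (Hbig : forall x, Y0 <= x -> eta <= normsq a b x + normsq c d x).
  { intros x Hx. apply Rnot_lt_le. intros Hlt. apply Hno. exists x. lra. }
  (* Makes [q - l + K >= 1] as soon as [q > -1], so that the derivative of [cross + K H - eta x] is
     at least [normsq a b + normsq c d - eta], which is nonnegative under the contrary
     assumption. *)
  set (K := 2 + Rabs l).
  pose proof (Rle_abs l) as Hl.
  assert (Hqb : forall x, Y0 <= x -> -1 < q x).
  { intros x Hx. specialize (HX1 x ltac:(lra)). apply Rabs_def2 in HX1. lra. }
  assert (Hk : forall x, Y0 <= x ->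
    cross Y0 + K * H Y0 - eta * Y0 <= cross x + K * H x - eta * x).
  { intros x Hx.
    apply (nondecreasing_of_derive (fun x => cross x + K * H x - eta * x)
      (fun x => normsq c d x + (q x - l) * normsq a b x + K * normsq a b x - eta)); [lra| |].
    - intros t Ht. pose proof (is_derive_cross t ltac:(lra)).
      specialize (HH t ltac:(lra)). der. ring.
    - intros t Ht. specialize (Hbig t ltac:(lra)). specialize (Hqb t ltac:(lra)).
      pose proof (normsq_nonneg a b t). unfold K. nra. }
  (* Since [H <= B], the monotone quantity forces [cross] to grow at least linearly with slope eta;
     beyond [X2] it is at least 1. *)
  set (X2 := Y0 + Rmax 0 ((1 - cross Y0 - K * H Y0 + K * B) / eta)).
  assert (HX2 : Y0 <= X2) by (unfold X2; pose proof (Rmax_l 0 ((1 - cross Y0 - K * H Y0 + K * B) / eta)); lra).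
  assert (Hc1 : forall x, X2 <= x -> 1 <= cross x).
  { intros x Hx. specialize (Hk x ltac:(lra)). specialize (HB x ltac:(lra)).
    assert (K * H x <= K * B) by (apply Rmult_le_compat_l; unfold K; pose proof (Rabs_pos l); lra).
    assert ((1 - cross Y0 - K * H Y0 + K * B) / eta <= x - Y0).
    { unfold X2 in Hx. pose proof (Rmax_r 0 ((1 - cross Y0 - K * H Y0 + K * B) / eta)). lra. }
    apply Rle_div_l in H1; [|lra]. nra. }
  assert (Hh : forall x, X2 <= x -> 2 * (x - X2) <= normsq a b x).
  { intros x Hx.
    assert (normsq a b X2 - 2 * X2 <= normsq a b x - 2 * x).
    { apply (nondecreasing_of_derive (fun x => normsq a b x - 2 * x) (fun x => 2 * cross x - 2)); [lra| |].
      - intros t Ht. pose proof (is_derive_normsq t ltac:(lra)). der. ring.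
      - intros t Ht. specialize (Hc1 t ltac:(lra)). lra. }
    pose proof (normsq_nonneg a b X2). lra. }
  (* Beyond [X2 + 1] one has [normsq a b >= 2], so [H] gains at least 2 per unit length and exceeds
     [B] at [X3]. *)
  set (X3 := X2 + 2 + Rmax 0 ((B - H (X2 + 1)) / 2)).
  pose proof (Rmax_l 0 ((B - H (X2 + 1)) / 2)). pose proof (Rmax_r 0 ((B - H (X2 + 1)) / 2)).
  assert (H (X2 + 1) - 2 * (X2 + 1) <= H X3 - 2 * X3).
  { apply (nondecreasing_of_derive (fun x => H x - 2 * x) (fun x => normsq a b x - 2)).
    - unfold X3; lra.
    - intros t Ht. specialize (HH t ltac:(lra)). der. ring.
    - intros t Ht. specialize (Hh t ltac:(lra)). lra. }
  specialize (HB X3 ltac:(unfold X3; lra)). unfold X3 in *. lra.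
Qed.

End Solution.

(** * The conserved quadratic form *)

Lemma is_lim_eventually (f : R -> R) (l eta : R) :
  is_lim f p_infty l -> 0 < eta -> exists Y, forall x, Y <= x -> l - eta < f x < l + eta.
Proof.
  intros Hf He. apply is_lim_spec in Hf. destruct (Hf (mkposreal eta He)) as [M HM].
  simpl in HM. exists (M + 1). intros x Hx. specialize (HM x ltac:(lra)).
  apply Rabs_def2 in HM. lra.
Qed.

Section RealLimits.

Context {T : Type} {F : (T -> Prop) -> Prop} {FF : Filter F}.
Variables (f g : T -> R) (lf lg : R).
Hypothesis Hf : filterlim f F (locally lf).
Hypothesis Hg : filterlim g F (locally lg).

Lemma filterlim_Rplus : filterlim (fun t => f t + g t) F (locally (lf + lg)).
Proof.
  eapply filterlim_comp_2; [exact Hf | exact Hg |]. exact (filterlim_plus (V := R_NormedModule) lf lg).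
Qed.

Lemma filterlim_Rmult : filterlim (fun t => f t * g t) F (locally (lf * lg)).
Proof.
  eapply filterlim_comp_2; [exact Hf | exact Hg |]. exact (filterlim_mult (K := R_AbsRing) lf lg).
Qed.

Lemma filterlim_Ropp : filterlim (fun t => - f t) F (locally (- lf)).
Proof.
  apply (filterlim_comp _ _ _ f Ropp F (locally lf)); [exact Hf|].
  exact (filterlim_opp (V := R_NormedModule) lf).
Qed.

Lemma filterlim_Rinv : lf <> 0 -> filterlim (fun t => / f t) F (locally (/ lf)).
Proof.
  intros Hne. apply (filterlim_comp _ _ _ f Rinv F (locally lf)); [exact Hf|].
  apply (filterlim_Rbar_inv lf). intros E. injection E. exact Hne.
Qed.

End RealLimits.

Lemma filterlim_Rminus {T : Type} {F : (T -> Prop) -> Prop} {FF : Filter F}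
  (f g : T -> R) (lf lg : R) :
  filterlim f F (locally lf) -> filterlim g F (locally lg) ->
  filterlim (fun t => f t - g t) F (locally (lf - lg)).
Proof. intros Hf Hg. apply filterlim_Rplus; [exact Hf | now apply filterlim_Ropp]. Qed.

Lemma filterlim_Rconst {T : Type} {F : (T -> Prop) -> Prop} {FF : Filter F} (c : R) :
  filterlim (fun _ : T => c) F (locally c).
Proof. apply filterlim_const. Qed.

Lemma cross_le_normsq a b c d x :
  Rabs (cross a b c d x) <= normsq a b x + normsq c d x.
Proof.
  unfold cross, normsq.
  pose proof (pow2_ge_0 (a x + c x)). pose proof (pow2_ge_0 (a x - c x)).
  pose proof (pow2_ge_0 (b x + d x)). pose proof (pow2_ge_0 (b x - d x)).
  apply Rabs_le. split; nra.
Qed.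

Section Appell.

Variables (q : R -> R) (lam : R) (P Q R0 : R -> R).
Hypothesis Hlam : 0 < lam.
Hypothesis HA : appell_solution q lam P Q R0.
Hypothesis HP : is_lim P p_infty (sqrt lam).
Hypothesis HQ : is_lim Q p_infty 0.
Hypothesis HR : is_lim R0 p_infty (/ sqrt lam).

(** The Appell flow preserves this discriminant, and its value is read off from the limits at
    infinity. *)
Lemma appell_det x : 0 < x -> 4 * P x * R0 x - Q x ^ 2 = 4.
Proof.
  intros Hx.
  set (f := fun x => 4 * P x * R0 x - Q x * Q x).
  assert (Hc : forall y, 0 < y -> f y = f x).
  { intros y Hy. apply constant_of_derive; auto. clear x Hx y Hy.
    intros x Hx. destruct (HA x Hx) as (H1 & H2 & H3). unfold f. der. ring. }
  assert (Hl : is_lim f p_infty (4 * sqrt lam * / sqrt lam - 0 * 0)).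
  { apply filterlim_Rminus; apply filterlim_Rmult; auto.
    apply filterlim_Rmult; auto. apply filterlim_Rconst. }
  assert (Hl2 : is_lim f p_infty (f x)).
  { apply is_lim_ext_loc with (fun _ => f x).
    - exists 1. intros y Hy. symmetry. apply Hc. lra.
    - apply is_lim_const. }
  apply is_lim_unique in Hl. apply is_lim_unique in Hl2. rewrite Hl in Hl2.
  injection Hl2. unfold f. intros He. pose proof (sqrt_lt_R0 lam Hlam).
  replace (4 * sqrt lam * / sqrt lam - 0 * 0) with 4 in He by (field; lra). lra.
Qed.

(** At a zero of [R0] the discriminant would be [- Q ^ 2], never 4; so [R0] keeps the sign of its
    limit, and [P] follows from [4 P R0 = 4 + Q ^ 2]. *)
Lemma appell_pos x : 0 < x -> 0 < P x /\ 0 < R0 x.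
Proof.
  intros Hx.
  assert (HRpos : 0 < R0 x).
  { apply Rnot_le_lt. intros Hneg.
    pose proof (sqrt_lt_R0 lam Hlam) as Hsq.
    pose proof (Rinv_0_lt_compat _ Hsq) as Hsq'.
    destruct (is_lim_eventually R0 _ (/ sqrt lam) HR Hsq') as [Y HY].
    assert (Hne : forall z, 0 < z -> R0 z <> 0).
    { intros z Hz E. pose proof (appell_det z Hz) as D. rewrite E in D. nra. }
    set (X := Rmax (x + 1) Y). assert (x + 1 <= X) by apply Rmax_l.
    specialize (HY X (Rmax_r _ _)).
    destruct (Ranalysis5.IVT_interv R0 x X) as [z [Hz1 Hz2]]; try lra.
    - intros y Hy. apply derivable_continuous_pt. exists (- Q y).
      apply is_derive_Reals. apply HA. lra.
    - specialize (Hne x Hx). lra.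
    - apply (Hne z); lra. }
  split; [|exact HRpos].
  pose proof (appell_det x Hx). nra.
Qed.

(* For [e = 0] this Hermitian form in [(y, y')] is conserved, and it dominates [2 flux]. *)
Definition energy (a b c d : R -> R) (x : R) : R :=
  P x * normsq a b x + Q x * cross a b c d x + R0 x * normsq c d x.

Variables (e : R) (a b c d : R -> R).
Hypothesis Hs : rsol q lam e a b c d.

Lemma is_derive_energy x :
  0 < x -> is_derive (energy a b c d) x (- (2 * e * (R0 x * flux a b c d x))).
Proof.
  intros Hx. destruct (Hs x Hx) as (H1 & H2 & H3 & H4).
  destruct (HA x Hx) as (H5 & H6 & H7). unfold energy, normsq, cross, flux.
  der. ring.
Qed.

(** The symmetric matrix A with diagonal P, R0 and off-diagonal entry Q / 2 has determinant 1, so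
    Cayley-Hamilton gives [A ^ 2 = (P + R0) A - 1]. Hence the difference of the two sides is the
    squared norm of A applied to (y, y'). *)
Lemma normsq_le_energy x :
  0 < x -> normsq a b x + normsq c d x <= (P x + R0 x) * energy a b c d x.
Proof.
  intros Hx. pose proof (appell_det x Hx) as D. apply Rminus_le_0.
  replace ((P x + R0 x) * energy a b c d x - (normsq a b x + normsq c d x)) with
    ((P x * a x + Q x * c x / 2) ^ 2 + (Q x * a x / 2 + R0 x * c x) ^ 2 +
     ((P x * b x + Q x * d x / 2) ^ 2 + (Q x * b x / 2 + R0 x * d x) ^ 2)).
  - repeat apply Rplus_le_le_0_compat; apply pow2_ge_0.
  - unfold energy, normsq, cross.
    replace (P x) with ((4 + Q x ^ 2) / (4 * R0 x)).
    + destruct (appell_pos x Hx). field. lra.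
    + destruct (appell_pos x Hx). replace (4 + Q x ^ 2) with (4 * P x * R0 x) by lra. field. lra.
Qed.

Lemma energy_nonneg x : 0 < x -> 0 <= energy a b c d x.
Proof.
  intros Hx. pose proof (normsq_le_energy x Hx). destruct (appell_pos x Hx).
  pose proof (normsq_nonneg a b x). pose proof (normsq_nonneg c d x). nra.
Qed.

(* [E - 2 W = R |y' - M y|^2] with [M = (- Q + 2 i) / (2 R)]. *)
Lemma energy_flux x : 0 < x ->
  R0 x * (energy a b c d x - 2 * flux a b c d x) =
  (R0 x * c x + Q x * a x / 2 + b x) ^ 2 + (R0 x * d x + Q x * b x / 2 - a x) ^ 2.
Proof.
  intros Hx. pose proof (appell_det x Hx) as D.
  unfold energy, normsq, cross, flux.
  replace (P x) with ((4 + Q x ^ 2) / (4 * R0 x)).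
  - destruct (appell_pos x Hx). field. lra.
  - destruct (appell_pos x Hx). replace (4 + Q x ^ 2) with (4 * P x * R0 x) by lra. field. lra.
Qed.

Lemma flux_le_energy x : 0 < x -> 2 * flux a b c d x <= energy a b c d x.
Proof.
  intros Hx. pose proof (energy_flux x Hx). destruct (appell_pos x Hx).
  pose proof (pow2_ge_0 (R0 x * c x + Q x * a x / 2 + b x)).
  pose proof (pow2_ge_0 (R0 x * d x + Q x * b x / 2 - a x)).
  apply Rminus_le_0. apply (Rmult_le_reg_l (R0 x)); lra.
Qed.

Lemma energy_le_normsq x :
  0 < x -> energy a b c d x <= 2 * (P x + R0 x) * (normsq a b x + normsq c d x).
Proof.
  intros Hx. pose proof (appell_det x Hx) as D. destruct (appell_pos x Hx) as [Hp Hr].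
  unfold energy.
  assert (HQ2 : Rabs (Q x) <= P x + R0 x).
  { rewrite <- (Rabs_pos_eq (P x + R0 x)) by lra.
    apply Rsqr_le_abs_0. unfold Rsqr. pose proof (pow2_ge_0 (P x - R0 x)). lra. }
  pose proof (cross_le_normsq a b c d x) as Hk.
  assert (Q x * cross a b c d x <= (P x + R0 x) * (normsq a b x + normsq c d x)).
  { apply (Rle_trans _ (Rabs (Q x * cross a b c d x))); [apply Rle_abs|].
    rewrite Rabs_mult. apply Rmult_le_compat; auto; apply Rabs_pos. }
  pose proof (normsq_nonneg a b x). pose proof (normsq_nonneg c d x). nra.
Qed.

Variables (H : R -> R) (B : R).
Hypothesis Hq : is_lim q p_infty 0.
Hypothesis HH : forall x, 1 <= x -> is_derive H x (normsq a b x).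
Hypothesis HB : forall x, 1 <= x -> H x <= B.
Hypothesis He : 0 <= e.

(** For e >= 0 the flux is nonincreasing, so a negative value would persist up to infinity, whereas
    its absolute value is at most [normsq a b + normsq c d], which takes arbitrarily small values
    far out. *)
Lemma flux_nonneg x : 0 < x -> 0 <= flux a b c d x.
Proof.
  intros Hx. apply Rnot_lt_le. intros Hneg.
  destruct (L2_solution_small q lam e a b c d Hs H B (- flux a b c d x) x Hq HH HB
    ltac:(lra)) as (y & Hy1 & Hy2 & Hy3).
  assert (Hm : - flux a b c d x <= - flux a b c d y).
  { apply (nondecreasing_of_derive (fun x => - flux a b c d x)
      (fun x => e * normsq a b x)); [lra| |].
    - intros t Ht. pose proof (is_derive_flux q lam e a b c d Hs t ltac:(lra)). der. ring.
    - intros t Ht. pose proof (normsq_nonneg a b t). nra. }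
  assert (- flux a b c d y <= normsq a b y + normsq c d y) 
    by (unfold flux, normsq; pose proof (pow2_ge_0 (a y + d y));
        pose proof (pow2_ge_0 (b y - c y)); nra).
  lra.
Qed.

Lemma energy_nonincreasing x y : 0 < x -> x <= y -> energy a b c d y <= energy a b c d x.
Proof.
  intros Hx Hxy.
  assert (Hm : - energy a b c d x <= - energy a b c d y).
  { apply (nondecreasing_of_derive (fun x => - energy a b c d x)
      (fun x => 2 * e * (R0 x * flux a b c d x))); [lra| |].
    - intros t Ht. pose proof (is_derive_energy t ltac:(lra)). der. ring.
    - intros t Ht. pose proof (flux_nonneg t ltac:(lra)).
      destruct (appell_pos t ltac:(lra)).
      repeat apply Rmult_le_pos; lra. }
  lra.
Qed.

Lemma appell_trace_bounded :
  exists C Y, 0 < C /\ 1 <= Y /\ forall x, Y <= x -> P x + R0 x <= C.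
Proof.
  destruct (is_lim_eventually _ _ 1 HP Rlt_0_1) as [Y1 HY1].
  destruct (is_lim_eventually _ _ 1 HR Rlt_0_1) as [Y2 HY2].
  pose proof (sqrt_lt_R0 lam Hlam). pose proof (Rinv_0_lt_compat (sqrt lam) ltac:(lra)).
  exists (sqrt lam + 1 + (/ sqrt lam + 1)), (Rmax 1 (Rmax Y1 Y2)).
  split; [lra|]. split; [apply Rmax_l|]. intros x Hx.
  specialize (HY1 x (Rle_trans _ _ _ (Rle_trans _ _ _ (Rmax_l Y1 Y2) (Rmax_r 1 _)) Hx)).
  specialize (HY2 x (Rle_trans _ _ _ (Rle_trans _ _ _ (Rmax_r Y1 Y2) (Rmax_r 1 _)) Hx)).
  lra.
Qed.

(** [L2_solution_small] only gives smallness at some far point; monotonicity of the energy extends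
    it to everything beyond. Through [normsq_le_energy] this becomes decay of y and y'
    themselves. *)
Lemma energy_vanishes eta : 0 < eta ->
  exists Y, 1 <= Y /\ forall x, Y <= x -> energy a b c d x < eta.
Proof.
  intros Heta. destruct appell_trace_bounded as (C & Y & HC & HY1 & HY).
  destruct (L2_solution_small q lam e a b c d Hs H B (eta / (2 * C)) Y Hq HH HB
    ltac:(apply Rdiv_lt_0_compat; lra)) as (y & Hy1 & Hy2 & Hy3).
  exists y. split; [lra|]. intros x Hx.
  apply (Rle_lt_trans _ (energy a b c d y)); [apply energy_nonincreasing; lra|].
  apply (Rle_lt_trans _ _ _ (energy_le_normsq y ltac:(lra))).
  specialize (HY y Hy2).
  apply Rlt_div_r in Hy3; [|lra].
  pose proof (normsq_nonneg a b y). pose proof (normsq_nonneg c d y).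
  nra.
Qed.

Lemma normsq_vanishes eta : 0 < eta ->
  exists Y, 1 <= Y /\ forall x, Y <= x -> normsq a b x + normsq c d x < eta.
Proof.
  intros Heta. destruct appell_trace_bounded as (C & Y & HC & HY1 & HY).
  destruct (energy_vanishes (eta / C)) as (Y' & HY1' & HY');
    [apply Rdiv_lt_0_compat; lra|].
  exists (Rmax Y Y'). split; [apply (Rle_trans _ Y); [lra | apply Rmax_l]|].
  intros x Hx. specialize (HY x (Rle_trans _ _ _ (Rmax_l _ _) Hx)).
  pose proof (Rle_trans _ _ _ (Rmax_r _ _) Hx) as Hx'.
  specialize (HY' x Hx'). apply Rlt_div_r in HY'; [|lra].
  pose proof (normsq_le_energy x ltac:(lra)). pose proof (energy_nonneg x ltac:(lra)).
  nra.
Qed.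

(** At real energy the form is constant as well as vanishing at infinity, and it controls [normsq].
    This is what excludes positive eigenvalues. *)
Lemma L2_solution_real_zero : e = 0 -> forall x, 0 < x -> normsq a b x = 0.
Proof.
  intros He0 x Hx.
  assert (HE : energy a b c d x = 0).
  { apply Rle_antisym; [|apply energy_nonneg; lra].
    apply Rnot_lt_le. intros Hpos.
    destruct (energy_vanishes _ Hpos) as (Y & HY1 & HY).
    specialize (HY Y (Rle_refl Y)).
    enough (energy a b c d x = energy a b c d Y) by lra.
    apply constant_of_derive; try lra. intros y Hy. evar_last; [apply is_derive_energy; lra|]. simpl. rewrite He0. ring. }
  pose proof (normsq_le_energy x Hx) as Hn. rewrite HE in Hn.
  pose proof (normsq_nonneg a b x). pose proof (normsq_nonneg c d x). nra.
Qed.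

End Appell.

(** * Locally uniform bounds on the Appell solution *)

Lemma ex_RInt_pos (f : R -> R) (u v : R) :
  (forall x, 0 < x -> continuous f x) -> 0 < u -> 0 < v -> ex_RInt f u v.
Proof.
  intros Hf Hu Hv. apply (ex_RInt_continuous (V := R_CompleteNormedModule)).
  intros z Hz. apply Hf. apply (Rlt_le_trans _ (Rmin u v)); [|apply Hz].
  now apply Rmin_glb_lt.
Qed.

Lemma is_derive_RInt_pos (f : R -> R) (u x : R) :
  (forall x, 0 < x -> continuous f x) -> 0 < u -> 0 < x ->
  is_derive (fun t => RInt f u t) x (f x).
Proof.
  intros Hf Hu Hx. apply (is_derive_RInt f _ u); [|now apply Hf].
  exists (mkposreal x Hx). intros t Ht. apply (RInt_correct (V := R_CompleteNormedModule)).
  apply ex_RInt_pos; auto. apply Rabs_def2 in Ht. simpl in Ht.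
  unfold minus, plus, opp in Ht; simpl in Ht. lra.
Qed.

Lemma RInt_gen_lim (f : R -> R) (x0 : R) :
  ex_RInt_gen f (at_point x0) (Rbar_locally p_infty) ->
  exists L : R, is_lim (fun x => RInt f x0 x) p_infty L.
Proof.
  intros [L HL]. exists L. intros V HV. destruct (HL V HV) as [A B' HA HB HAB].
  destruct HB as [M HM]. exists M. intros x Hx.
  destruct (HAB x0 x HA (HM x Hx)) as (y & Hy1 & Hy2).
  simpl in Hy1. now rewrite (is_RInt_unique _ _ _ _ Hy1).
Qed.

(** [Fa] is left general to serve both the Weyl solution, integrated from the point 1, and an
    eigenfunction, integrated from [at_right 0]; in each case a lower endpoint u in (0, 1] is drawn
    from the filter. *)
Lemma RInt_gen_bounded_antiderivative (f : R -> R) (Fa : (R -> Prop) -> Prop) :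
  ProperFilter Fa -> Fa (fun u => 0 < u <= 1) ->
  ex_RInt_gen f Fa (Rbar_locally p_infty) ->
  (forall x, 0 < x -> continuous f x) -> (forall x, 0 <= f x) ->
  exists (H : R -> R) (B : R),
    (forall x, 1 <= x -> is_derive H x (f x)) /\ (forall x, 1 <= x -> H x <= B).
Proof.
  intros PF Hu [L HL] Hc Hp.
  destruct (HL _ (locally_ball L (mkposreal 1 Rlt_0_1))) as [A B' HA HB HAB].
  destruct (filter_ex _ (filter_and _ _ HA Hu)) as (u & HAu & Hu1).
  destruct HB as [M HM]. exists (fun x => RInt f u x), (L + 1). split.
  - intros x Hx. apply is_derive_RInt_pos; auto; lra.
  - intros x Hx. set (y := Rmax x (M + 1)).
    assert (x <= y /\ M + 1 <= y) by (split; [apply Rmax_l | apply Rmax_r]).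
    destruct (HAB u y HAu (HM y ltac:(lra))) as (v & Hv1 & Hv2). simpl in Hv1.
    apply Rabs_def2 in Hv2. simpl in Hv2. unfold minus, plus, opp in Hv2; simpl in Hv2.
    rewrite <- (is_RInt_unique _ _ _ _ Hv1) in Hv2.
    assert (RInt f u x <= RInt f u y); [|lra].
    apply (nondecreasing_of_derive _ f); [lra| |auto].
    intros t Ht. apply is_derive_RInt_pos; auto; lra.
Qed.

Lemma nondecreasing_le_lim (f : R -> R) (x l : R) :
  (forall y, x <= y -> f x <= f y) -> is_lim f p_infty l -> f x <= l.
Proof.
  intros Hm Hl. apply Rnot_lt_le. intros Hlt.
  destruct (is_lim_eventually f l (f x - l) Hl ltac:(lra)) as [Y HY].
  specialize (HY (Rmax x Y) (Rmax_r _ _)). specialize (Hm (Rmax x Y) (Rmax_l _ _)). lra.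
Qed.

Lemma filterlim_continuous {T : Type} {F : (T -> Prop) -> Prop} (f : R -> R) (g : T -> R) (l : R) :
  continuous f l -> filterlim g F (locally l) -> filterlim (fun t => f (g t)) F (locally (f l)).
Proof. intros Hf Hg. exact (filterlim_comp _ _ _ g f F _ _ Hg Hf). Qed.

(** Gronwall with data at infinity: [T x * exp (K * A x)] is nondecreasing, hence below its limit
    [M * exp (K * L)]. *)
Lemma gronwall_at_infinity (T dT A w : R -> R) (K L M X0 : R) :
  0 <= K ->
  (forall x, X0 <= x -> is_derive T x (dT x)) ->
  (forall x, X0 <= x -> is_derive A x (w x)) ->
  (forall x, X0 <= x -> Rabs (dT x) <= K * w x * T x) ->
  is_lim T p_infty M -> is_lim A p_infty L ->
  forall x, X0 <= x -> T x <= M * exp (K * (L - A x)).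
Proof.
  intros HK HT HA Hd HTl HAl x Hx.
  assert (Hle : T x * exp (K * A x) <= M * exp (K * L)).
  { apply (nondecreasing_le_lim (fun x => T x * exp (K * A x))).
    - intros y Hy. apply (nondecreasing_of_derive
        (fun x => T x * exp (K * A x)) (fun x => (dT x + K * w x * T x) * exp (K * A x))); [exact Hy| |].
      + intros t Ht. specialize (HT t ltac:(lra)). specialize (HA t ltac:(lra)).
        der. ring.
      + intros t Ht. apply Rmult_le_pos; [|apply Rlt_le, exp_pos].
        specialize (Hd t ltac:(lra)). apply Rabs_le_between in Hd. lra.
    - apply filterlim_Rmult; [exact HTl|].
      apply (filterlim_continuous exp).
      + apply continuity_pt_filterlim, derivable_continuous_pt, derivable_pt_exp.
      + apply filterlim_Rmult; [apply filterlim_Rconst | exact HAl]. }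
  replace (K * (L - A x)) with (K * L + - (K * A x)) by ring.
  rewrite exp_plus, exp_Ropp.
  apply (Rmult_le_reg_r (exp (K * A x))); [apply exp_pos|].
  field_simplify; [lra | apply Rgt_not_eq, exp_pos].
Qed.

(** * The Liouville-Green trace of the Appell solution *)

Section Uniform.

Variables (q dq : R -> R) (P1 Q1 R1 : R -> R -> R).
Hypothesis Hqlim : is_lim q p_infty 0.
Hypothesis Hdq : forall x, 0 < x -> is_derive q x (dq x).
Hypothesis HU : forall lam, 0 < lam ->
  appell_solution q lam (fun x => P1 x lam) (fun x => Q1 x lam) (fun x => R1 x lam) /\
  is_lim (fun x => P1 x lam) p_infty (sqrt lam) /\
  is_lim (fun x => Q1 x lam) p_infty 0 /\
  is_lim (fun x => R1 x lam) p_infty (/ sqrt lam).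

Lemma U1_det lam x : 0 < lam -> 0 < x -> 4 * P1 x lam * R1 x lam - Q1 x lam ^ 2 = 4.
Proof.
  intros Hl Hx. destruct (HU lam Hl) as (H1 & H2 & H3 & H4).
  exact (appell_det q lam _ _ _ Hl H1 H2 H3 H4 x Hx).
Qed.

Lemma U1_pos lam x : 0 < lam -> 0 < x -> 0 < P1 x lam /\ 0 < R1 x lam.
Proof.
  intros Hl Hx. destruct (HU lam Hl) as (H1 & H2 & H3 & H4).
  exact (appell_pos q lam _ _ _ Hl H1 H2 H3 H4 x Hx).
Qed.

(* Liouville-Green scale: the two hypotheses on [q] correspond to [kap = 0] and [kap = 1]. *)
Definition lgscale (kap lam x : R) : R := sqrt (lam - kap * q x).

(** Trace of the energy form in variables rescaled by s = [lgscale]. For s > 0 its two terms have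
    product [P R = 1 + Q ^ 2 / 4], so it is at least 2, with equality only at (s, 0, 1 / s): the
    excess over 2 measures the distance of U1 from its Liouville-Green value. *)
Definition lgtrace (kap lam x : R) : R :=
  P1 x lam / lgscale kap lam x + lgscale kap lam x * R1 x lam.

Variables (kap : R) (w : R -> R).
Hypothesis Hkap : (kap = 0 /\ forall x, 0 < x -> w x = q x) \/
                  (kap = 1 /\ forall x, 0 < x -> w x = dq x).

Lemma lgtrace_lim lam : 0 < lam -> is_lim (lgtrace kap lam) p_infty 2.
Proof.
  intros Hl. destruct (HU lam Hl) as (H1 & H2 & H3 & H4).
  pose proof (sqrt_lt_R0 lam Hl) as Hs.
  assert (Hsl : is_lim (lgscale kap lam) p_infty (sqrt lam)).
  { replace (sqrt lam) with (sqrt (lam - kap * 0)) by (f_equal; ring).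
    apply (filterlim_continuous sqrt).
    - apply continuity_pt_filterlim, continuity_pt_sqrt. lra.
    - apply filterlim_Rminus; [apply filterlim_Rconst|].
      apply filterlim_Rmult; [apply filterlim_Rconst | exact Hqlim]. }
  replace (Finite 2) with (Finite (sqrt lam * / sqrt lam + sqrt lam * / sqrt lam))
    by (f_equal; field; lra).
  apply filterlim_Rplus; apply filterlim_Rmult; auto.
  apply filterlim_Rinv; auto; lra.
Qed.

Lemma lgtrace_ge lam x : 0 < lam -> 0 < x -> 0 < lam - kap * q x ->
  Rabs (Q1 x lam) <= lgtrace kap lam x /\
  Rabs (P1 x lam / lgscale kap lam x - lgscale kap lam x * R1 x lam) <= lgtrace kap lam x.
Proof.
  intros Hl Hx Hs. pose proof (U1_det lam x Hl Hx) as D. destruct (U1_pos lam x Hl Hx).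
  unfold lgtrace, lgscale. pose proof (sqrt_lt_R0 _ Hs) as Hs'.
  set (s := sqrt _) in *. clearbody s.
  assert (Hp : 0 < P1 x lam / s) by (apply Rdiv_lt_0_compat; lra).
  assert (Hr : 0 < s * R1 x lam) by (apply Rmult_lt_0_compat; lra).
  assert (E : P1 x lam / s * (s * R1 x lam) = P1 x lam * R1 x lam) by (field; lra).
  set (p := P1 x lam / s) in *. set (r := s * R1 x lam) in *. clearbody p r.
  split.
  - rewrite <- (Rabs_pos_eq (p + r)) by lra.
    apply Rsqr_le_abs_0. unfold Rsqr. pose proof (pow2_ge_0 (p - r)). nra.
  - apply Rabs_le. lra.
Qed.

(** The derivative has a term with factor [lam - q - s ^ 2] and one with factor [kap q']. For
    [kap = 0], [s ^ 2 = lam] leaves only [q]; for [kap = 1], [s ^ 2 = lam - q] leaves only [q'].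
    Each multiplies a quantity dominated by the trace, by [lgtrace_ge]. *)
Lemma is_derive_lgtrace lam x : 0 < lam -> 0 < x -> 0 < lam - kap * q x ->
  exists dT, is_derive (lgtrace kap lam) x dT /\
    Rabs dT <= (/ lgscale kap lam x + / (lam - kap * q x)) * Rabs (w x) * lgtrace kap lam x.
Proof.
  intros Hl Hx Hs. destruct (lgtrace_ge lam x Hl Hx Hs) as [HQ HPR].
  destruct (HU lam Hl) as (HA & _). destruct (HA x Hx) as (H1 & H2 & H3).
  pose proof (sqrt_lt_R0 _ Hs) as Hs'.
  assert (Hds : is_derive (lgscale kap lam) x (- kap * dq x / (2 * lgscale kap lam x))).
  { unfold lgscale. specialize (Hdq x Hx). der. fold (Rminus lam (kap * q x)). field. lra. }
  assert (Hsq : lgscale kap lam x * lgscale kap lam x = lam - kap * q x)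
    by (unfold lgscale; apply sqrt_sqrt; lra).
  fold (lgscale kap lam x) in Hs'.
  set (s := lgscale kap lam x) in *.
  exists (((lam - q x - s * s) * Q1 x lam) / s
          + kap * dq x / (2 * (s * s)) * (P1 x lam / s - s * R1 x lam)).
  split.
  - unfold lgtrace. der; fold s; [lra|]. field. lra.
  - rewrite Hsq.
    assert (Hip : 0 < / s) by (apply Rinv_0_lt_compat; lra).
    assert (Hip2 : 0 < / (lam - kap * q x)) by (apply Rinv_0_lt_compat; lra).
    assert (HT : 0 <= lgtrace kap lam x) by (pose proof (Rabs_pos (Q1 x lam)); lra).
    pose proof (Rabs_pos (w x)) as Hw0.
    destruct Hkap as [[Hk Hw] | [Hk Hw]]; rewrite (Hw x Hx) in *.
    + rewrite Hk in *. replace (_ + _) with (- q x * / s * Q1 x lam) by (field; lra).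
      rewrite !Rabs_mult, Rabs_Ropp, (Rabs_pos_eq (/ s)) by lra.
      apply Rmult_le_compat; auto.
      * apply Rmult_le_pos; lra.
      * apply Rabs_pos.
      * nra.
    + rewrite Hk in *.
      replace (_ + _) with (dq x * / (lam - 1 * q x) * ((P1 x lam / s - s * R1 x lam) / 2))
        by (field; lra).
      rewrite !Rabs_mult, (Rabs_pos_eq (/ (lam - 1 * q x))) by lra.
      apply Rmult_le_compat; auto.
      * apply Rmult_le_pos; [apply Rabs_pos | lra].
      * apply Rabs_pos.
      * nra.
      * unfold Rdiv. rewrite Rabs_mult, (Rabs_pos_eq (/ 2)) by lra.
        pose proof (Rabs_pos (P1 x lam * / s - s * R1 x lam)). unfold Rdiv in HPR. lra.
Qed.

Variables (x0 L : R).
Hypothesis Hx0 : 0 < x0.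
Hypothesis Hwc : forall x, 0 < x -> continuous w x.
Hypothesis HL : is_lim (fun x => RInt (fun t => Rabs (w t)) x0 x) p_infty L.

Lemma lgtrace_uniform l1 l2 del : 0 < l1 -> 0 < del <= 1 ->
  exists X, 1 <= X /\ forall lam, l1 <= lam <= l2 -> forall x, X <= x ->
    Rabs (q x) <= del * l1 / 2 /\ lgtrace kap lam x <= 2 * (1 + del).
Proof.
  intros Hl1 Hdel.
  set (A := fun x => RInt (fun t => Rabs (w t)) x0 x).
  assert (HA : forall x, 0 < x -> is_derive A x (Rabs (w x))).
  { intros x Hx. apply (is_derive_RInt_pos (fun t => Rabs (w t))); auto.
    intros t Ht. apply (continuous_comp w Rabs); [auto | apply continuous_Rabs]. }
  (* Far out [lam - kap q >= l1 / 2], so K bounds the weight of [is_derive_lgtrace] uniformly in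
     lam. *)
  set (K := / sqrt (l1 / 2) + / (l1 / 2)).
  pose proof (sqrt_lt_R0 (l1 / 2) ltac:(lra)) as Hsq.
  assert (HK : 0 < K).
  { unfold K. apply Rplus_lt_0_compat; apply Rinv_0_lt_compat; lra. }
  assert (Hln : 0 < ln (1 + del)) by (rewrite <- ln_1; apply ln_increasing; lra).
  (* Beyond [Y1] the remaining integral of [|w|] is so small that the Gronwall factor
     [exp (K (L - A))] is at most [1 + del]. *)
  destruct (is_lim_eventually A L (ln (1 + del) / K) HL) as [Y1 HY1];
    [apply Rdiv_lt_0_compat; lra|].
  destruct (is_lim_eventually q 0 (del * l1 / 2) Hqlim) as [Y2 HY2];
    [nra|].
  set (X := Rmax 1 (Rmax Y1 Y2)).
  assert (HX : 1 <= X /\ Y1 <= X /\ Y2 <= X).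
  { unfold X. pose proof (Rmax_l 1 (Rmax Y1 Y2)). pose proof (Rmax_r 1 (Rmax Y1 Y2)).
    pose proof (Rmax_l Y1 Y2). pose proof (Rmax_r Y1 Y2). lra. }
  clearbody X. exists X. split; [lra|]. intros lam Hlam.
  assert (Hqx : forall x, X <= x -> Rabs (q x) <= del * l1 / 2).
  { intros x Hx. specialize (HY2 x ltac:(lra)). apply Rabs_le. lra. }
  assert (Hs : forall x, X <= x -> l1 / 2 <= lam - kap * q x).
  { intros x Hx. specialize (Hqx x Hx). apply Rabs_le_between in Hqx.
    destruct Hkap as [[Hk _] | [Hk _]]; rewrite Hk; nra. }
  intros x Hx. split; [now apply Hqx|].
  assert (HT : forall t, X <= t -> is_derive (lgtrace kap lam) t (Derive (lgtrace kap lam) t) /\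
    Rabs (Derive (lgtrace kap lam) t) <= K * Rabs (w t) * lgtrace kap lam t).
  { intros t Ht. specialize (Hs t Ht).
    destruct (is_derive_lgtrace lam t ltac:(lra) ltac:(lra) ltac:(lra)) as (dT & H1 & H2).
    rewrite (is_derive_unique _ _ _ H1). split; [exact H1|].
    apply (Rle_trans _ _ _ H2).
    apply Rmult_le_compat_r.
    { pose proof (proj1 (lgtrace_ge lam t ltac:(lra) ltac:(lra) ltac:(lra))).
      pose proof (Rabs_pos (Q1 t lam)). lra. }
    apply Rmult_le_compat_r; [apply Rabs_pos|].
    unfold K. apply Rplus_le_compat; apply Rinv_le_contravar; try lra.
    unfold lgscale. apply sqrt_le_1; lra. }
  assert (Hg := gronwall_at_infinity (lgtrace kap lam) (Derive (lgtrace kap lam)) A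
    (fun x => Rabs (w x)) K L 2 X (Rlt_le _ _ HK) (fun t Ht => proj1 (HT t Ht))
    (fun t Ht => HA t ltac:(lra)) (fun t Ht => proj2 (HT t Ht))
    (lgtrace_lim lam ltac:(lra)) HL x Hx).
  apply (Rle_trans _ _ _ Hg). apply Rmult_le_compat_l; [lra|].
  rewrite <- (exp_ln (1 + del)) by lra.
  assert (K * (L - A x) <= ln (1 + del)).
  { specialize (HY1 x ltac:(lra)). assert (L - A x < ln (1 + del) / K) by lra.
    apply Rlt_div_r in H; lra. }
  destruct H as [H|H]; [left; now apply exp_increasing | rewrite H; lra].
Qed.

(** Far out, the trace bound is turned into [lam R ^ 2 <= 1 + dl], the form that the compensated
    energy of [energy_flux_far] consumes; on the compact stretch a crude Gronwall estimate from X
    back to 1 suffices. *)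
Lemma U1_uniform l1 l2 dl : 0 < l1 -> 0 < dl <= 1 ->
  exists X C, 1 <= X /\ 0 < C /\ forall lam, l1 <= lam <= l2 ->
    (forall x, X <= x -> lam * R1 x lam ^ 2 <= 1 + dl /\ - (dl * lam) <= q x) /\
    (forall x, 1 <= x <= X -> P1 x lam + R1 x lam <= C).
Proof.
  intros Hl1 Hdl.
  (* From [p + r <= 2 (1 + del)] and [p r >= 1] one only gets [(r - 1 - del) ^ 2 <= 3 del], a
     square-root loss; hence del is quadratic in t, with [3 del = (t / 2) ^ 2]. The 7 comes from
     [(1 + t) ^ 3 <= 1 + 7 t]. *)
  set (t := dl / 7). set (del := t ^ 2 / 12).
  assert (Ht : 0 < t <= 1 / 7) by (unfold t; lra).
  assert (Hdel : 0 < del <= t / 12) by (unfold del; split; [apply Rdiv_lt_0_compat; nra | nra]).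
  destruct (lgtrace_uniform l1 l2 del Hl1 ltac:(lra)) as (X & HX & HT).
  assert (Hqc : forall x, 1 <= x <= X -> continuity_pt (fun x => Rabs (q x)) x).
  { intros x Hx. apply continuity_pt_filterlim.
    apply (continuous_comp q Rabs); [|apply continuous_Rabs].
    apply (ex_derive_continuous (K := R_AbsRing) (V := R_NormedModule)).
    exists (dq x). apply Hdq. lra. }
  destruct (continuity_ab_maj (fun x => Rabs (q x)) 1 X HX Hqc) as [xm [Hxm _]].
  set (qm := Rabs (q xm)) in *.
  (* Bounds [|lam - q - 1|] on [1, X]: the derivative of [P + R] is [(lam - q - 1) Q], and
     [|Q| <= P + R]. *)
  set (K := Rabs l2 + qm + 1).
  assert (HK : 0 < K) by (unfold K, qm; pose proof (Rabs_pos (q xm)); pose proof (Rabs_pos l2); lra).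
  (* Bounds [P + R] at X, from [P <= 4 s], [s R <= 4], [s <= 1 + s ^ 2 <= 1 + 2 l2] and
     [s ^ 2 >= l1 / 2]. *)
  set (C0 := 4 * (1 + 2 * l2) + 4 * (2 * (1 + 2 * l2) / l1)).
  exists X, (Rmax 1 (C0 * exp (K * X))). split; [exact HX|].
  split; [pose proof (Rmax_l 1 (C0 * exp (K * X))); lra|].
  intros lam Hlam.
  assert (Hfar : forall x, X <= x ->
    let s := lgscale kap lam x in
    0 < s /\ l1 / 2 <= s * s <= 2 * lam /\ lam <= s * s * (1 + t) /\
    s * R1 x lam <= 1 + t /\ P1 x lam / s <= 4 /\ - (dl * lam) <= q x).
  { intros x Hx. destruct (HT lam Hlam x Hx) as [Hq1 Ht1].
    apply Rabs_le_between in Hq1. intros s.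
    assert (Hkq : Rabs (kap * q x) <= del * l1 / 2).
    { apply Rabs_le. destruct Hkap as [[Hk _] | [Hk _]]; rewrite Hk; nra. }
    apply Rabs_le_between in Hkq.
    assert (Hs : l1 / 2 <= lam - kap * q x) by nra.
    assert (Hsp : 0 < s) by (unfold s, lgscale; apply sqrt_lt_R0; lra).
    assert (Hss : s * s = lam - kap * q x) by (unfold s, lgscale; apply sqrt_sqrt; lra).
    rewrite Hss. pose proof (U1_det lam x ltac:(lra) ltac:(lra)) as D.
    destruct (U1_pos lam x ltac:(lra) ltac:(lra)) as [Hp Hr].
    unfold lgtrace in Ht1. fold s in Ht1.
    assert (Hp' : 0 < P1 x lam / s) by (apply Rdiv_lt_0_compat; lra).
    assert (Hr' : 0 < s * R1 x lam) by (apply Rmult_lt_0_compat; lra).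
    assert (E : P1 x lam / s * (s * R1 x lam) = P1 x lam * R1 x lam) by (field; lra).
    set (p := P1 x lam / s) in *. set (r := s * R1 x lam) in *.
    assert (Hpr : 1 <= p * r) by (pose proof (pow2_ge_0 (Q1 x lam)); lra).
    refine (conj Hsp (conj (conj Hs _) (conj _ (conj _ (conj _ _))))).
    - nra.
    - nra.
    - (* [(r - (1 + del)) ^ 2 <= 3 del <= (t / 2) ^ 2] *)
      assert ((r - (1 + del)) ^ 2 <= (t / 2) ^ 2).
      { assert (3 * del = (t / 2) ^ 2) by (unfold del; field). nra. }
      assert (r - (1 + del) <= t / 2).
      { apply Rnot_lt_le. intros Hlt. nra. }
      lra.
    - lra.
    - unfold t in *. nra. }
  split.
  - intros x Hx. destruct (Hfar x Hx) as (Hs & Hss & Hlam' & Hr & Hp & Hq1).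
    split; [|exact Hq1].
    set (s := lgscale kap lam x) in *.
    destruct (U1_pos lam x ltac:(lra) ltac:(lra)) as [_ HR].
    assert ((s * R1 x lam) * (s * R1 x lam) <= (1 + t) * (1 + t)).
    { assert (0 < s * R1 x lam) by (apply Rmult_lt_0_compat; lra).
      apply Rmult_le_compat; lra. }
    apply (Rle_trans _ ((1 + t) * ((1 + t) * (1 + t)))).
    + apply (Rle_trans _ ((1 + t) * ((s * R1 x lam) * (s * R1 x lam)))); [|nra].
      pose proof (pow2_ge_0 (R1 x lam)). nra.
    + assert (dl = 7 * t) by (unfold t; field). nra.
  - intros x Hx. destruct (HU lam ltac:(lra)) as (HA & _).
    destruct (Hfar X (Rle_refl X)) as (Hs & Hss & _ & Hr & Hp & _).
    set (s := lgscale kap lam X) in *.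
    assert (HCX : P1 X lam + R1 X lam <= C0).
    { unfold C0. apply Rplus_le_compat.
      - apply (Rle_div_l _ _ s) in Hp; [|lra]. nra.
      - assert (s <= 1 + 2 * l2) by nra.
        replace (R1 X lam) with (s * R1 X lam * (s / (s * s))) by (field; lra).
        assert (s / (s * s) <= 2 * (1 + 2 * l2) / l1).
        { apply Rle_div_l; [nra|].
          apply (Rle_trans _ (2 * (1 + 2 * l2) / l1 * (l1 / 2))).
          - replace (2 * (1 + 2 * l2) / l1 * (l1 / 2)) with (1 + 2 * l2) by (field; lra). lra.
          - apply Rmult_le_compat_l; [|lra].
            apply Rmult_le_pos; [lra | apply Rlt_le, Rinv_0_lt_compat; lra]. }
        assert (0 < s / (s * s)) by (apply Rdiv_lt_0_compat; nra).
        destruct (U1_pos lam X ltac:(lra) ltac:(lra)) as [_ HR].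
        apply Rmult_le_compat; nra. }
    apply (Rle_trans _ (C0 * exp (K * X))); [|apply Rmax_r].
    assert (Hm : (P1 x lam + R1 x lam) * exp (K * x) <= (P1 X lam + R1 X lam) * exp (K * X)).
    { apply (nondecreasing_of_derive (fun x => (P1 x lam + R1 x lam) * exp (K * x))
        (fun x => ((lam - q x - 1) * Q1 x lam + K * (P1 x lam + R1 x lam)) * exp (K * x)));
        [lra| |].
      - intros y Hy. destruct (HA y ltac:(lra)) as (H1 & H2 & H3). der. ring.
      - intros y Hy. apply Rmult_le_pos; [|apply Rlt_le, exp_pos].
        destruct (U1_pos lam y ltac:(lra) ltac:(lra)) as [Hpy Hry].
        pose proof (U1_det lam y ltac:(lra) ltac:(lra)) as D.
        assert (Hc : Rabs (lam - q y - 1) <= K).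
        { specialize (Hxm y ltac:(lra)). apply Rabs_le_between in Hxm.
          fold qm in Hxm. pose proof (Rabs_pos l2). rewrite Rabs_pos_eq in * by lra. unfold K.
          pose proof (Rle_abs l2). apply Rabs_le. lra. }
        assert (HQ : Rabs (Q1 y lam) <= P1 y lam + R1 y lam).
        { rewrite <- (Rabs_pos_eq (P1 y lam + R1 y lam)) by lra.
          apply Rsqr_le_abs_0. unfold Rsqr. pose proof (pow2_ge_0 (P1 y lam - R1 y lam)). lra. }
        assert (Rabs ((lam - q y - 1) * Q1 y lam) <= K * (P1 y lam + R1 y lam)).
        { rewrite Rabs_mult. apply Rmult_le_compat; auto; apply Rabs_pos. }
        apply Rabs_le_between in H. lra. }
    destruct (U1_pos lam x ltac:(lra) ltac:(lra)) as [Hpx Hrx].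
    assert (1 <= exp (K * x)).
    { rewrite <- exp_0. left. apply exp_increasing. nra. }
    apply (Rle_trans _ ((P1 x lam + R1 x lam) * exp (K * x))); [nra|].
    apply (Rle_trans _ _ _ Hm). apply Rmult_le_compat_r; [apply Rlt_le, exp_pos | exact HCX].
Qed.

End Uniform.

(** * Weyl solutions near the real axis *)

Section Uniform_flux.

Variables (q dq : R -> R) (P1 Q1 R1 : R -> R -> R).
Hypothesis Hqlim : is_lim q p_infty 0.
Hypothesis Hdq : forall x, 0 < x -> is_derive q x (dq x).
Hypothesis HU : forall lam, 0 < lam ->
  appell_solution q lam (fun x => P1 x lam) (fun x => Q1 x lam) (fun x => R1 x lam) /\
  is_lim (fun x => P1 x lam) p_infty (sqrt lam) /\
  is_lim (fun x => Q1 x lam) p_infty 0 /\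
  is_lim (fun x => R1 x lam) p_infty (/ sqrt lam).

(** Square integrability at infinity is recorded as an antiderivative of [|y| ^ 2] bounded above:
    exactly what the monotonicity arguments consume, without improper integrals. *)
Definition L2_solution (lam e : R) (a b c d : R -> R) : Prop :=
  rsol q lam e a b c d /\
  exists (H : R -> R) (B : R),
    (forall x, 1 <= x -> is_derive H x (normsq a b x)) /\ (forall x, 1 <= x -> H x <= B).

Definition U1_energy (lam : R) : (R -> R) -> (R -> R) -> (R -> R) -> (R -> R) -> R -> R :=
  energy (fun x => P1 x lam) (fun x => Q1 x lam) (fun x => R1 x lam).

(* [J = E - 2 (1 + dl) W + (e / lam) Re (conj y y')] is nondecreasing and tends to 0: the last term
   compensates the exchange between [|y'|^2 / lam] and [|y|^2]. *)
Lemma energy_flux_far lam e a b c d X dl :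
  0 < lam -> 0 <= e -> 1 <= X -> L2_solution lam e a b c d ->
  (forall x, X <= x -> lam * R1 x lam ^ 2 <= 1 + dl /\ - (dl * lam) <= q x) -> 0 <= dl ->
  U1_energy lam a b c d X
    <= 2 * (1 + dl) * flux a b c d X - e / lam * cross a b c d X.
Proof.
  intros Hl He HX [Hs (H & B & HH & HB)] Hfar Hdl.
  destruct (HU lam Hl) as (HA & HP & HQ & HR).
  set (E := U1_energy lam a b c d).
  set (J := fun x => E x - 2 * (1 + dl) * flux a b c d x + e / lam * cross a b c d x).
  assert (Hel : 0 <= e / lam) by (apply Rdiv_le_0_compat; lra).
  assert (HJ : forall x, X <= x -> J X <= J x).
  { intros x Hx.
    apply (nondecreasing_of_derive J (fun x => - (2 * e * (R1 x lam * flux a b c d x))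
      + 2 * (1 + dl) * (e * normsq a b x)
      + e / lam * (normsq c d x + (q x - lam) * normsq a b x))); [lra| |].
    - intros t Ht. unfold J.
      pose proof (is_derive_energy q lam _ _ _ HA e a b c d Hs t ltac:(lra)) as D1.
      pose proof (is_derive_flux q lam e a b c d Hs t ltac:(lra)) as D2.
      pose proof (is_derive_cross q lam e a b c d Hs t ltac:(lra)) as D3.
      fold (U1_energy lam a b c d) in D1. fold E in D1. der. ring.
    - intros t Ht. destruct (Hfar t ltac:(lra)) as [Hr Hq].
      destruct (appell_pos q lam _ _ _ Hl HA HP HQ HR t ltac:(lra)) as [_ Hrp].
      (* AM-GM with weight [lam R]: [2 R W <= lam R ^ 2 |y| ^ 2 + |y'| ^ 2 / lam] *)
      assert (Hag : 2 * (R1 t lam * flux a b c d t)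
        <= lam * R1 t lam ^ 2 * normsq a b t + normsq c d t / lam).
      { apply Rminus_le_0.
        replace (_ - _) with (((lam * R1 t lam * a t - d t) ^ 2
          + (lam * R1 t lam * b t + c t) ^ 2) / lam)
          by (unfold flux, normsq; field; lra).
        apply Rdiv_le_0_compat; [|lra].
        apply Rplus_le_le_0_compat; apply pow2_ge_0. }
      assert (Hn := normsq_nonneg a b t).
      assert (Hh : lam * R1 t lam ^ 2 * normsq a b t <= (1 + dl) * normsq a b t)
        by (apply Rmult_le_compat_r; lra).
      assert (Hqn : - dl * normsq a b t <= q t / lam * normsq a b t).
      { apply Rmult_le_compat_r; [lra|]. apply Rle_div_r; lra. }
      (* The weight [2 (1 + dl)] leaves [1 + 2 dl] once the compensating term has removed one
         [|y| ^ 2]: [1 + dl] pays for AM-GM and the last [dl] absorbs a negative [q / lam]. *)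
      replace (_ + _) with (e * ((1 + dl) * normsq a b t + normsq c d t / lam
          - 2 * (R1 t lam * flux a b c d t))
        + e * (dl * normsq a b t + q t / lam * normsq a b t)) by (field; lra).
      apply Rplus_le_le_0_compat; apply Rmult_le_pos; lra. }
  assert (HJX : J X <= 0).
  { apply Rnot_lt_le. intros Hpos.
    (* Far out [J <= E + (e / lam) |cross|], the flux being nonnegative; this eta makes the two
       bounds add up to exactly [J X]. *)
    set (eta := J X / (1 + e / lam)).
    assert (Heta : 0 < eta) by (apply Rdiv_lt_0_compat; lra).
    destruct (energy_vanishes q lam _ _ _ Hl HA HP HQ HR e a b c d Hs H B Hqlim HH HB He
      eta Heta) as (Y1 & HY1 & HY1').
    destruct (normsq_vanishes q lam _ _ _ Hl HA HP HQ HR e a b c d Hs H B Hqlim HH HB He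
      eta Heta) as (Y2 & HY2 & HY2').
    set (Y := Rmax X (Rmax Y1 Y2)).
    assert (X <= Y /\ Y1 <= Y /\ Y2 <= Y).
    { unfold Y. pose proof (Rmax_l X (Rmax Y1 Y2)). pose proof (Rmax_r X (Rmax Y1 Y2)).
      pose proof (Rmax_l Y1 Y2). pose proof (Rmax_r Y1 Y2). lra. }
    specialize (HJ Y ltac:(lra)). specialize (HY1' Y ltac:(lra)). specialize (HY2' Y ltac:(lra)).
    pose proof (flux_nonneg q lam e a b c d Hs H B Hqlim HH HB He Y ltac:(lra)).
    pose proof (Rle_trans _ _ _ (Rle_abs _) (cross_le_normsq a b c d Y)).
    fold (U1_energy lam a b c d) in HY1'. fold E in HY1'.
    assert (e / lam * cross a b c d Y <= e / lam * eta) by (apply Rmult_le_compat_l; lra).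
    assert (J Y < eta + e / lam * eta) by (unfold J; nra).
    assert (eta * (1 + e / lam) = J X) by (unfold eta; field; split; lra).
    lra. }
  unfold J in HJX. fold E. lra.
Qed.

(** All losses are measured against the energy at 1, the largest on [1, oo): [dl + e C / l1] at X,
    then [e C (X - 1)] on the way back to 1, where [E - 2 W] has derivative at least [- e C E(1)].
    The estimate is thus homogeneous in the solution, and insensitive to the size of psi as e ->
    0. *)
Lemma energy_flux_uniform l1 l2 eta X C dl :
  0 < l1 -> 0 < eta -> 0 <= dl <= eta / 2 -> 1 <= X -> 0 < C ->
  (forall lam, l1 <= lam <= l2 ->
    (forall x, X <= x -> lam * R1 x lam ^ 2 <= 1 + dl /\ - (dl * lam) <= q x) /\
    (forall x, 1 <= x <= X -> P1 x lam + R1 x lam <= C)) ->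
  exists e0, 0 < e0 /\ forall lam, l1 <= lam <= l2 -> forall e, 0 < e < e0 ->
    forall a b c d, L2_solution lam e a b c d ->
      U1_energy lam a b c d 1 - 2 * flux a b c d 1 <= eta * U1_energy lam a b c d 1.
Proof.
  intros Hl1 Heta Hdl HX HC Hu.
  set (D := C / l1 + C * (X - 1) + 1).
  assert (HCl : 0 < C / l1) by (apply Rdiv_lt_0_compat; lra).
  assert (HD : 0 < D) by (unfold D; nra).
  exists (eta / 2 / D). split; [apply Rdiv_lt_0_compat; lra|].
  intros lam Hlam e [He He'] a b c d HL2. pose proof HL2 as [Hs (H & B & HH & HB)].
  apply Rlt_div_r in He'; [|lra].
  destruct (Hu lam Hlam) as [Hfar Hnear]. assert (Hl : 0 < lam) by lra.
  destruct (HU lam Hl) as (HA & HP & HQ & HR).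
  assert (HJ := energy_flux_far lam e a b c d X dl Hl (Rlt_le _ _ He) HX HL2 Hfar (proj1 Hdl)).
  set (E := U1_energy lam a b c d) in *.
  assert (HE0 : forall x, 0 < x -> 0 <= E x)
    by exact (energy_nonneg q lam _ _ _ Hl HA HP HQ HR a b c d).
  assert (HEm : forall x, 1 <= x -> E x <= E 1).
  { intros x Hx. apply (energy_nonincreasing q lam _ _ _ Hl HA HP HQ HR e a b c d Hs H B
      Hqlim HH HB (Rlt_le _ _ He)); lra. }
  assert (HWE : forall x, 0 < x -> 2 * flux a b c d x <= E x)
    by exact (flux_le_energy q lam _ _ _ Hl HA HP HQ HR a b c d).
  assert (HW0 : forall x, 0 < x -> 0 <= flux a b c d x)
    by exact (flux_nonneg q lam e a b c d Hs H B Hqlim HH HB (Rlt_le _ _ He)).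
  assert (HX1 : E X - 2 * flux a b c d X <= (dl + e * (C / l1)) * E 1).
  { pose proof (cross_le_normsq a b c d X) as Hk.
    pose proof (normsq_le_energy q lam _ _ _ Hl HA HP HQ HR a b c d X ltac:(lra)) as Hn.
    fold (U1_energy lam a b c d) in Hn. fold E in Hn.
    specialize (HE0 X ltac:(lra)). specialize (HEm X HX). specialize (HWE X ltac:(lra)).
    specialize (HW0 X ltac:(lra)). specialize (Hnear X ltac:(lra)).
    assert (Hk2 : Rabs (cross a b c d X) <= C * E 1) by nra.
    assert (- (e / lam * cross a b c d X) <= e * (C / l1) * E 1).
    { apply (Rle_trans _ (e / lam * (C * E 1))).
      - assert (0 < e / lam) by (apply Rdiv_lt_0_compat; lra).
        apply Rabs_le_between in Hk2. nra.
      - replace (e * (C / l1) * E 1) with (e / l1 * (C * E 1)) by (field; lra).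
        apply Rmult_le_compat_r; [apply Rmult_le_pos; lra|].
        apply Rmult_le_compat_l; [lra|]. apply Rinv_le_contravar; lra. }
    nra. }
  assert (Hm : E 1 - 2 * flux a b c d 1 + e * C * E 1 * 1
    <= E X - 2 * flux a b c d X + e * C * E 1 * X).
  { apply (nondecreasing_of_derive
      (fun x => E x - 2 * flux a b c d x + e * C * E 1 * x)
      (fun x => e * (2 * normsq a b x + (C * E 1 - R1 x lam * (2 * flux a b c d x)))));
      [lra| |].
    - intros t Ht.
      pose proof (is_derive_energy q lam _ _ _ HA e a b c d Hs t ltac:(lra)) as D1.
      pose proof (is_derive_flux q lam e a b c d Hs t ltac:(lra)) as D2.
      fold (U1_energy lam a b c d) in D1. fold E in D1. der. ring.
    - intros t Ht. apply Rmult_le_pos; [lra|].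
      destruct (appell_pos q lam _ _ _ Hl HA HP HQ HR t ltac:(lra)) as [Hpp Hrp].
      specialize (Hnear t Ht). specialize (HEm t ltac:(lra)). specialize (HWE t ltac:(lra)).
      specialize (HW0 t ltac:(lra)).
      assert (R1 t lam * (2 * flux a b c d t) <= C * E 1)
        by (apply Rmult_le_compat; lra).
      pose proof (normsq_nonneg a b t). lra. }
  specialize (HE0 1 ltac:(lra)).
  apply (Rle_trans _ ((dl + e * (C / l1) + e * (C * (X - 1))) * E 1)); [lra|].
  apply Rmult_le_compat_r; [lra|]. unfold D in He'. lra.
Qed.

(** A zero of the nonnegative, nonincreasing flux makes it vanish from there on; then so do its
    derivative [- e |y| ^ 2] and with it y and y', against nontriviality. *)
Lemma flux_pos lam e a b c d x :
  0 < e -> L2_solution lam e a b c d ->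
  (forall y, 0 < y -> 0 < normsq a b y + normsq c d y) -> 0 < x -> 0 < flux a b c d x.
Proof.
  intros He [Hs (H & B & HH & HB)] Hnt Hx.
  pose proof (flux_nonneg q lam e a b c d Hs H B Hqlim HH HB (Rlt_le _ _ He)) as HW0.
  destruct (Rle_lt_or_eq_dec _ _ (HW0 x Hx)) as [Hp|Hz]; [exact Hp|exfalso].
  assert (HW : forall y, x < y -> flux a b c d y = 0).
  { intros y Hy. apply Rle_antisym; [|apply HW0; lra].
    assert (- flux a b c d x <= - flux a b c d y); [|lra].
    apply (nondecreasing_of_derive (fun x => - flux a b c d x)
      (fun x => e * normsq a b x)); [lra| |].
    - intros t Ht. pose proof (is_derive_flux q lam e a b c d Hs t ltac:(lra)). der. ring.
    - intros t Ht. pose proof (normsq_nonneg a b t). nra. }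
  assert (Hloc : forall (f : R -> R) y l, (forall t, x < t -> f t = 0) -> x < y ->
    is_derive f y l -> l = 0).
  { intros f y l Hf Hy Hd. rewrite <- (is_derive_unique _ _ _ Hd).
    apply is_derive_unique. apply (is_derive_ext_loc (fun _ => 0)).
    - exists (mkposreal (y - x) ltac:(lra)). intros t Ht. symmetry. apply Hf.
      apply Rabs_def2 in Ht. simpl in Ht. unfold minus, plus, opp in Ht; simpl in Ht. lra.
    - apply @is_derive_const. }
  assert (Hn : forall y, x < y -> normsq a b y = 0).
  { intros y Hy.
    assert (H0 := Hloc _ y _ HW Hy (is_derive_flux q lam e a b c d Hs y ltac:(lra))).
    apply Rmult_integral in H0. destruct H0; lra. }
  assert (Hab : forall y, x < y -> a y = 0 /\ b y = 0).
  { intros y Hy. specialize (Hn y Hy). unfold normsq in Hn.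
    pose proof (pow2_ge_0 (a y)). pose proof (pow2_ge_0 (b y)).
    split; apply Rsqr_0_uniq; unfold Rsqr; lra. }
  destruct (Hs (x + 1) ltac:(lra)) as (D1 & D2 & _).
  apply (Hloc _ (x + 1) _ (fun t Ht => proj1 (Hab t Ht)) ltac:(lra)) in D1.
  apply (Hloc _ (x + 1) _ (fun t Ht => proj2 (Hab t Ht)) ltac:(lra)) in D2.
  specialize (Hnt (x + 1) ltac:(lra)). specialize (Hn (x + 1) ltac:(lra)).
  unfold normsq in *. rewrite D1, D2 in Hnt. lra.
Qed.

(* A Schwarz-Pick estimate: the Wronskian of [y1] and [y2] has derivative
   [(lam1 - lam2) y1 y2], whereas the fluxes have derivative [- e |y|^2]. *)
Lemma wronskian_flux_bound lam1 lam2 e a1 b1 c1 d1 a2 b2 c2 d2 u v tau x :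
  0 < lam1 -> 0 < lam2 -> 0 < e -> 0 < tau -> 0 < x ->
  L2_solution lam1 e a1 b1 c1 d1 -> L2_solution lam2 e a2 b2 c2 d2 ->
  u * (a1 x * c2 x - b1 x * d2 x - (c1 x * a2 x - d1 x * b2 x)) +
  v * (a1 x * d2 x + b1 x * c2 x - (c1 x * b2 x + d1 x * a2 x)) <=
  Rabs (lam1 - lam2) / (2 * e) *
    (tau * flux a1 b1 c1 d1 x + (u ^ 2 + v ^ 2) / tau * flux a2 b2 c2 d2 x).
Proof.
  intros Hl1 Hl2 He Htau Hx [Hs1 (H1 & B1 & HH1 & HB1)] [Hs2 (H2 & B2 & HH2 & HB2)].
  set (K := Rabs (lam1 - lam2) / (2 * e)).
  assert (HK : 0 <= K) by (apply Rdiv_le_0_compat; [apply Rabs_pos | lra]).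
  set (V := fun x => u * (a1 x * c2 x - b1 x * d2 x - (c1 x * a2 x - d1 x * b2 x)) +
    v * (a1 x * d2 x + b1 x * c2 x - (c1 x * b2 x + d1 x * a2 x))).
  set (W := fun x => tau * flux a1 b1 c1 d1 x + (u ^ 2 + v ^ 2) / tau * flux a2 b2 c2 d2 x).
  change (V x <= K * W x).
  assert (Huv : 0 <= (u ^ 2 + v ^ 2) / tau) by (apply Rdiv_le_0_compat; nra).
  assert (Hm : forall y, x <= y -> V x - K * W x <= V y - K * W y).
  { intros y Hy. apply (nondecreasing_of_derive (fun x => V x - K * W x)
      (fun x => (lam1 - lam2) * (u * (a1 x * a2 x - b1 x * b2 x) + v * (a1 x * b2 x + b1 x * a2 x))
        + K * e * (tau * normsq a1 b1 x + (u ^ 2 + v ^ 2) / tau * normsq a2 b2 x))); [exact Hy| |].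
    - intros t Ht.
      pose proof (is_derive_flux q lam1 e a1 b1 c1 d1 Hs1 t ltac:(lra)) as D1.
      pose proof (is_derive_flux q lam2 e a2 b2 c2 d2 Hs2 t ltac:(lra)) as D2.
      destruct (Hs1 t ltac:(lra)) as (E1 & E2 & E3 & E4).
      destruct (Hs2 t ltac:(lra)) as (F1 & F2 & F3 & F4).
      unfold V, W. der. field. lra.
    - intros t Ht.
      set (G := u * (a1 t * a2 t - b1 t * b2 t) + v * (a1 t * b2 t + b1 t * a2 t)).
      set (N := tau * normsq a1 b1 t + (u ^ 2 + v ^ 2) / tau * normsq a2 b2 t).
      (* This is [|G| <= |u + i v| |y1| |y2|] followed by AM-GM with weight tau, written as
         completed squares. *)
      assert (HG : 2 * Rabs G <= N).
      { assert (HG1 : 0 <= N - 2 * G).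
        { replace (N - 2 * G) with (((tau * a1 t - (u * a2 t + v * b2 t)) ^ 2
            + (tau * b1 t - (v * a2 t - u * b2 t)) ^ 2) / tau)
            by (unfold N, G, normsq; field; lra).
          apply Rdiv_le_0_compat; [|lra]. apply Rplus_le_le_0_compat; apply pow2_ge_0. }
        assert (HG2 : 0 <= N + 2 * G).
        { replace (N + 2 * G) with (((tau * a1 t + (u * a2 t + v * b2 t)) ^ 2
            + (tau * b1 t + (v * a2 t - u * b2 t)) ^ 2) / tau)
            by (unfold N, G, normsq; field; lra).
          apply Rdiv_le_0_compat; [|lra]. apply Rplus_le_le_0_compat; apply pow2_ge_0. }
        unfold Rabs. destruct (Rcase_abs G); lra. }
      replace (K * e) with (Rabs (lam1 - lam2) / 2) by (unfold K; field; lra).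
      assert (- (Rabs (lam1 - lam2) * Rabs G) <= (lam1 - lam2) * G).
      { rewrite <- Rabs_mult. pose proof (Rle_abs (- ((lam1 - lam2) * G))).
        rewrite Rabs_Ropp in H. lra. }
      pose proof (Rabs_pos (lam1 - lam2)). nra. }
  (* A positive value of [V - K W] at x would persist to infinity, where both solutions decay and
     [V <= 4 S eta]; the extra 1 in the denominator of eta keeps this strictly below that value. *)
  apply Rnot_lt_le. intros Hpos.
  set (S := Rabs u + Rabs v).
  assert (HS : 0 <= S) by (unfold S; pose proof (Rabs_pos u); pose proof (Rabs_pos v); lra).
  set (eta := (V x - K * W x) / (4 * S + 1)).
  assert (Heta : 0 < eta) by (apply Rdiv_lt_0_compat; lra).
  destruct (HU lam1 Hl1) as (HA1 & HP1 & HQ1 & HR1).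
  destruct (HU lam2 Hl2) as (HA2 & HP2 & HQ2 & HR2).
  destruct (normsq_vanishes q lam1 _ _ _ Hl1 HA1 HP1 HQ1 HR1 e a1 b1 c1 d1 Hs1 H1 B1 Hqlim HH1
    HB1 (Rlt_le _ _ He) eta Heta) as (Y1 & HY1 & HY1').
  destruct (normsq_vanishes q lam2 _ _ _ Hl2 HA2 HP2 HQ2 HR2 e a2 b2 c2 d2 Hs2 H2 B2 Hqlim HH2
    HB2 (Rlt_le _ _ He) eta Heta) as (Y2 & HY2 & HY2').
  set (Y := Rmax x (Rmax Y1 Y2)).
  assert (HYY : x <= Y /\ Y1 <= Y /\ Y2 <= Y).
  { unfold Y. pose proof (Rmax_l x (Rmax Y1 Y2)). pose proof (Rmax_r x (Rmax Y1 Y2)).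
    pose proof (Rmax_l Y1 Y2). pose proof (Rmax_r Y1 Y2). lra. }
  specialize (Hm Y ltac:(lra)). specialize (HY1' Y ltac:(lra)). specialize (HY2' Y ltac:(lra)).
  pose proof (flux_nonneg q lam1 e a1 b1 c1 d1 Hs1 H1 B1 Hqlim HH1 HB1 (Rlt_le _ _ He) Y
    ltac:(lra)) as HW1.
  pose proof (flux_nonneg q lam2 e a2 b2 c2 d2 Hs2 H2 B2 Hqlim HH2 HB2 (Rlt_le _ _ He) Y
    ltac:(lra)) as HW2.
  assert (HWY : 0 <= K * W Y).
  { apply Rmult_le_pos; [exact HK|]. unfold W.
    apply Rplus_le_le_0_compat; apply Rmult_le_pos; lra. }
  assert (HVY : V Y <= S * (4 * eta)).
  { unfold V, S. rewrite Rmult_plus_distr_r. unfold normsq in *.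
    assert (Hb : forall s t, Rabs t <= 4 * eta -> s * t <= Rabs s * (4 * eta)).
    { intros s t Ht. apply (Rle_trans _ _ _ (Rle_abs _)). rewrite Rabs_mult.
      apply Rmult_le_compat_l; [apply Rabs_pos | exact Ht]. }
    assert (Hp : forall s t, 2 * Rabs (s * t) <= s ^ 2 + t ^ 2).
    { intros s t. pose proof (pow2_ge_0 (s - t)). pose proof (pow2_ge_0 (s + t)).
      unfold Rabs. destruct (Rcase_abs (s * t)); nra. }
    pose proof (Hp (a1 Y) (c2 Y)). pose proof (Hp (b1 Y) (d2 Y)).
    pose proof (Hp (c1 Y) (a2 Y)). pose proof (Hp (d1 Y) (b2 Y)).
    pose proof (Hp (a1 Y) (d2 Y)). pose proof (Hp (b1 Y) (c2 Y)).
    pose proof (Hp (c1 Y) (b2 Y)). pose proof (Hp (d1 Y) (a2 Y)).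
    apply Rplus_le_compat; apply Hb.
    - unfold Rminus. eapply Rle_trans; [apply Rabs_triang|]. rewrite Rabs_Ropp.
      eapply Rle_trans; [apply Rplus_le_compat; apply Rabs_triang|]. rewrite !Rabs_Ropp. lra.
    - unfold Rminus. eapply Rle_trans; [apply Rabs_triang|]. rewrite Rabs_Ropp.
      eapply Rle_trans; [apply Rplus_le_compat; apply Rabs_triang|]. lra. }
  assert (eta * (4 * S + 1) = V x - K * W x) by (unfold eta; field; lra).
  lra.
Qed.

End Uniform_flux.

(** * Frobenius solutions *)

Definition entire (a : nat -> R) : Prop := forall x, Rbar_lt (Rabs x) (CV_radius a).

(** Outside the disk of convergence the terms of a power series do not tend to 0, so convergence at
    arbitrarily large positive points forces an infinite radius. *)
Lemma entire_of_ex_pseries (a : nat -> R) :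
  (forall x, 0 < x -> ex_pseries a x) -> entire a.
Proof.
  intros Ha x. apply Rbar_not_le_lt. intros Hle.
  pose proof (Rabs_pos x) as Hx.
  apply (CV_disk_outside a (Rabs x + 1)).
  - rewrite (Rabs_pos_eq (Rabs x + 1)) by lra.
    apply (Rbar_le_lt_trans _ (Rabs x)); [exact Hle | simpl; lra].
  - apply ex_series_lim_0.
    destruct (Ha (Rabs x + 1) ltac:(lra)) as [s Hs]. exists s.
    apply (is_series_ext (fun n => scal (pow_n (Rabs x + 1) n) (a n))); [|exact Hs].
    intros n. rewrite pow_n_pow. apply Rmult_comm.
Qed.

Lemma entire_ex_pseries (a : nat -> R) x : entire a -> ex_pseries a x.
Proof. intros Ha. apply CV_radius_inside, Ha. Qed.

Lemma entire_plus a b : entire a -> entire b -> entire (PS_plus a b).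
Proof.
  intros Ha Hb. apply entire_of_ex_pseries. intros x _.
  apply ex_pseries_plus; now apply entire_ex_pseries.
Qed.

Lemma entire_scal c a : entire a -> entire (PS_scal c a).
Proof.
  intros Ha. apply entire_of_ex_pseries. intros x _.
  apply ex_pseries_scal; [apply Rmult_comm | now apply entire_ex_pseries].
Qed.

Lemma entire_incr_n a k : entire a -> entire (PS_incr_n a k).
Proof.
  intros Ha. apply entire_of_ex_pseries. intros x _.
  apply ex_pseries_incr_n. now apply entire_ex_pseries.
Qed.

Lemma entire_derive a : entire a -> entire (PS_derive a).
Proof. intros Ha x. rewrite CV_radius_derive. apply Ha. Qed.

Lemma entire_mult a b : entire a -> entire b -> entire (PS_mult a b).
Proof.
  intros Ha Hb. apply entire_of_ex_pseries. intros x _. now apply ex_pseries_mult.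
Qed.

Lemma entire_ext a b : (forall n, a n = b n) -> entire a -> entire b.
Proof. intros H Ha x. rewrite <- (CV_radius_ext _ _ H). apply Ha. Qed.

Lemma continuous_PSeries a x : entire a -> continuous (PSeries a) x.
Proof. intros Ha. apply continuity_pt_filterlim, PSeries_continuity, Ha. Qed.

Lemma PSeries_0_at_right (a : nat -> R) : entire a ->
  filterlim (PSeries a) (at_right 0) (locally (a 0%nat)).
Proof.
  intros Ha. rewrite <- (PSeries_0 a).
  apply (filterlim_filter_le_1 (F := locally 0)); [now apply filter_le_within|].
  now apply continuous_PSeries.
Qed.

(** Identity theorem from the half-line, where the equation lives: the limit at 0+ gives [a 0], and
    the shifted series vanishes again for x > 0. *)
Lemma PSeries_pos_zero (a : nat -> R) : entire a ->
  (forall x, 0 < x -> PSeries a x = 0) -> forall n, a n = 0.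
Proof.
  intros Ha Hz n. revert a Ha Hz. induction n as [|n IH]; intros a Ha Hz.
  - apply (filterlim_locally_unique (F := at_right 0) (PSeries a)).
    + now apply PSeries_0_at_right.
    + apply (filterlim_ext_loc (fun _ => 0)); [|apply filterlim_const].
      exists (mkposreal 1 Rlt_0_1). intros y _ Hy. symmetry. now apply Hz.
  - assert (H0 : a 0%nat = 0).
    { apply (filterlim_locally_unique (F := at_right 0) (PSeries a)).
      + now apply PSeries_0_at_right.
      + apply (filterlim_ext_loc (fun _ => 0)); [|apply filterlim_const].
        exists (mkposreal 1 Rlt_0_1). intros y _ Hy. symmetry. now apply Hz. }
    apply (IH (PS_decr_1 a)).
    + intros x. rewrite CV_radius_decr_1. apply Ha.
    + intros x Hx. specialize (Hz x Hx).
      rewrite PSeries_decr_1 in Hz by now apply entire_ex_pseries.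
      rewrite H0 in Hz. assert (x * PSeries (PS_decr_1 a) x = 0) by lra.
      apply Rmult_integral in H. destruct H; [lra | exact H].
Qed.

Lemma PSeries_pos_ext (a b : nat -> R) : entire a -> entire b ->
  (forall x, 0 < x -> PSeries a x = PSeries b x) -> forall n, a n = b n.
Proof.
  intros Ha Hb He n.
  assert (H : PS_plus a (PS_scal (-1) b) n = 0).
  { apply PSeries_pos_zero.
    - apply entire_plus; [exact Ha | now apply entire_scal].
    - intros x Hx. rewrite PSeries_plus, PSeries_scal, He; auto.
      + ring.
      + now apply entire_ex_pseries.
      + apply entire_ex_pseries. now apply entire_scal. }
  unfold PS_plus, PS_scal, plus, scal in H. simpl in H. unfold mult in H. simpl in H. lra.
Qed.

Lemma entire_bounded (a : nat -> R) (r : R) : 0 < r -> entire a ->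
  exists M, 0 < M /\ forall n, Rabs (a n) * r ^ n <= M.
Proof.
  intros Hr Ha. pose proof (CV_disk_inside a r (Ha r)) as Hs.
  apply ex_series_lim_0 in Hs. apply is_lim_seq_Reals in Hs.
  destruct (maj_by_pos _ (exist _ 0 Hs)) as (M & HM & HM').
  exists M. split; [exact HM|]. intros n. specialize (HM' n).
  rewrite Rabs_Rabsolu, Rabs_mult in HM'. rewrite (Rabs_pos_eq (r ^ n)) in HM'; [exact HM'|].
  apply pow_le. lra.
Qed.

(** * Derivatives of expansions with a logarithm *)

Lemma is_derive_Rpower (beta x : R) : 0 < x ->
  is_derive (fun t => Rpower t beta) x (beta * Rpower x beta / x).
Proof. intros Hx. unfold Rpower. auto_derive; [exact Hx | field; lra]. Qed.

Section Second_derivative.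

Variables (beta : R) (V V1 V2 G dG ddG y dy ddy : R -> R).
Hypothesis HV : forall x, 0 < x -> is_derive V x (V1 x).
Hypothesis HV1 : forall x, 0 < x -> is_derive V1 x (V2 x).
Hypothesis HG : forall x, 0 < x -> is_derive G x (dG x).
Hypothesis HdG : forall x, 0 < x -> is_derive dG x (ddG x).
Hypothesis Hy : forall x, 0 < x -> y x = G x * ln x + Rpower x beta * V x.
Hypothesis Hdy : forall x, 0 < x -> is_derive y x (dy x).
Hypothesis Hddy : forall x, 0 < x -> is_derive dy x (ddy x).

Lemma is_derive_unique_pos (f g : R -> R) (x df dg : R) :
  (forall t, 0 < t -> f t = g t) -> 0 < x -> is_derive f x df -> is_derive g x dg -> df = dg.
Proof.
  intros Hfg Hx Hf Hg. rewrite <- (is_derive_unique _ _ _ Hg).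
  symmetry. apply is_derive_unique. apply (is_derive_ext_loc f); [|exact Hf].
  exists (mkposreal x Hx). intros t Ht. apply Hfg.
  apply Rabs_def2 in Ht. simpl in Ht. unfold minus, plus, opp in Ht; simpl in Ht. lra.
Qed.

Lemma log_frobenius_derive x : 0 < x ->
  dy x = dG x * ln x + G x / x + Rpower x beta * (beta * V x / x + V1 x).
Proof.
  intros Hx. apply (is_derive_unique_pos _ _ x _ _ Hy Hx (Hdy x Hx)).
  specialize (HV x Hx). specialize (HG x Hx). pose proof (is_derive_Rpower beta x Hx) as HR.
  set (p := fun t => Rpower t beta) in *.
  change (is_derive (fun t => G t * ln t + p t * V t) x
    (dG x * ln x + G x / x + p x * (beta * V x / x + V1 x))).
  change (is_derive p x (beta * p x / x)) in HR. der. field. lra.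
Qed.

(** The factor [x ^ 2] clears all denominators, so that the equation becomes an identity of power
    series once [x ^ beta] is divided out. *)
Lemma log_frobenius_derive2 x : 0 < x ->
  x ^ 2 * ddy x = x ^ 2 * ddG x * ln x + 2 * x * dG x - G x +
    Rpower x beta * (beta * (beta - 1) * V x + 2 * beta * (x * V1 x) + x ^ 2 * V2 x).
Proof.
  intros Hx.
  replace (ddy x) with (ddG x * ln x + 2 * dG x / x - G x / x ^ 2 +
    Rpower x beta * (beta * (beta - 1) * V x / x ^ 2 + 2 * beta * V1 x / x + V2 x))
    by (symmetry; apply (is_derive_unique_pos _ _ x _ _ log_frobenius_derive Hx (Hddy x Hx));
      specialize (HV x Hx); specialize (HG x Hx); specialize (HV1 x Hx); specialize (HdG x Hx);
      pose proof (is_derive_Rpower beta x Hx) as HR;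
      set (p := fun t => Rpower t beta) in *;
      change (is_derive (fun t => dG t * ln t + G t / t + p t * (beta * V t / t + V1 t)) x
        (ddG x * ln x + 2 * dG x / x - G x / x ^ 2 +
         p x * (beta * (beta - 1) * V x / x ^ 2 + 2 * beta * V1 x / x + V2 x)));
      change (is_derive p x (beta * p x / x)) in HR;
      der; [lra | lra | field; lra]).
  field. lra.
Qed.

End Second_derivative.

(** Multiplication by [x ^ 2] turns the two singular terms into the coefficients of index 0 and 1,
    so [qs] itself is the coefficient sequence of an entire function. *)
Lemma entire_potential (qs : nat -> R) :
  (forall x, 0 < x -> ex_series (fun n => qs (n + 2)%nat * x ^ n)) ->
  entire qs /\ forall x, 0 < x -> x ^ 2 * qfun qs x = PSeries qs x.
Proof.
  intros Hc.
  assert (Hs : entire (fun n => qs (n + 2)%nat)).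
  { apply entire_of_ex_pseries. intros x Hx. apply ex_pseries_R. exact (Hc x Hx). }
  assert (He : entire qs).
  { intros x. rewrite <- (CV_radius_decr_1 qs), <- (CV_radius_decr_1 (PS_decr_1 qs)).
    rewrite (CV_radius_ext _ (fun n => qs (n + 2)%nat)); [apply Hs|].
    intros n. unfold PS_decr_1. f_equal. lia. }
  split; [exact He|]. intros x Hx.
  rewrite (PSeries_decr_1 qs), (PSeries_decr_1 (PS_decr_1 qs)).
  - rewrite (PSeries_ext _ (fun n => qs (n + 2)%nat)).
    + unfold qfun, PSeries, PS_decr_1. field. lra.
    + intros n. unfold PS_decr_1. f_equal. lia.
  - apply CV_radius_inside. rewrite CV_radius_decr_1. apply He.
  - apply CV_radius_inside, He.
Qed.

Lemma is_derive_potential (qs : nat -> R) :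
  (forall x, 0 < x -> ex_series (fun n => qs (n + 2)%nat * x ^ n)) ->
  exists dq, forall x, 0 < x -> is_derive (qfun qs) x (dq x) /\ continuous dq x.
Proof.
  intros Hc. destruct (entire_potential qs Hc) as [He Hq].
  exists (fun x => (PSeries (PS_derive qs) x * x ^ 2 - 2 * x * PSeries qs x) / x ^ 4).
  intros x Hx. split.
  - apply (is_derive_ext_loc (fun t => PSeries qs t / t ^ 2)).
    + exists (mkposreal x Hx). intros t Ht.
      apply Rabs_def2 in Ht. simpl in Ht. unfold minus, plus, opp in Ht; simpl in Ht.
      assert (E : PSeries qs t / t ^ 2 = qfun qs t) by (rewrite <- Hq by lra; field; lra).
      exact E.
    + pose proof (is_derive_PSeries qs x (He x)). der; [apply Rgt_not_eq; nra | field; lra].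
  - set (f := PSeries (PS_derive qs)). set (g := PSeries qs).
    assert (Hf : continuous f x) by (apply continuous_PSeries; now apply entire_derive).
    assert (Hg : continuous g x) by (now apply continuous_PSeries).
    assert (Hid : filterlim (fun t : R => t) (locally x) (locally x)) by apply filterlim_id.
    change (filterlim (fun t => (f t * t ^ 2 - 2 * t * g t) / t ^ 4) (locally x)
      (locally ((f x * x ^ 2 - 2 * x * g x) / x ^ 4))).
    assert (Hpow : forall n, filterlim (fun t : R => t ^ n) (locally x) (locally (x ^ n))).
    { induction n as [|n IH]; simpl; [apply filterlim_Rconst | now apply filterlim_Rmult]. }
    apply filterlim_Rmult.
    + apply filterlim_Rminus; apply filterlim_Rmult; auto.
      apply filterlim_Rmult; auto. apply filterlim_Rconst.
    + apply filterlim_Rinv; auto. apply pow_nonzero. lra.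
Qed.

(** * The Frobenius recursion and the bounds it gives on the coefficients *)

Lemma PS_incr_n_ext (a b : nat -> R) (k n : nat) :
  (forall m, a m = b m) -> PS_incr_n a k n = PS_incr_n b k n.
Proof.
  intros H. rewrite !PS_incr_n_simplify. destruct (Compare_dec.le_lt_dec k n); auto.
Qed.

Lemma PS_incr_derive (g : nat -> R) (m : nat) : PS_incr_n (PS_derive g) 1 m = INR m * g m.
Proof. destruct m; [change (@eq R 0 (0 * g 0%nat)); ring | reflexivity]. Qed.

Lemma PS_incr_derive2 (v : nat -> R) (n : nat) :
  PS_incr_n (PS_derive (PS_derive v)) 2 n = INR n * (INR n - 1) * v n.
Proof.
  destruct n as [|[|n]].
  - change (@eq R 0 (0 * (0 - 1) * v 0%nat)). ring.
  - change (@eq R 0 (1 * (1 - 1) * v 1%nat)). ring.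
  - rewrite PS_incr_n_simplify. destruct (Compare_dec.le_lt_dec 2 (S (S n))) as [_|Hc]; [|lia].
    replace (S (S n) - 2)%nat with n by lia. unfold PS_derive.
    match goal with |- ?a = ?b => change (@eq R a b) end. rewrite !S_INR. ring.
Qed.

(** One real component of the equation, with [y2] the other one. The logarithmic terms cancel
    because [G] solves the same equation; the rest, multiplied by [x ^ 2] and divided by [x ^ beta],
    is compared coefficientwise. The indicial equation removes the [qs 0] term, so the sum starts at
    [qs 1]. The recursion serves to bound given coefficients, not to construct them. *)
Lemma frobenius_recursion (qs v w g : nat -> R) (beta l e : R) (k : nat)
  (y dy y2 G dG G2 : R -> R) :
  entire qs -> entire v -> entire w -> entire g ->
  (forall x, 0 < x -> x ^ 2 * qfun qs x = PSeries qs x) ->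
  beta * (beta - 1) = qs 0%nat ->
  (forall x, 0 < x -> is_derive y x (dy x)) ->
  (forall x, 0 < x -> is_derive dy x ((qfun qs x - l) * y x + e * y2 x)) ->
  (forall x, 0 < x -> is_derive G x (dG x)) ->
  (forall x, 0 < x -> is_derive dG x ((qfun qs x - l) * G x + e * G2 x)) ->
  (forall x, 0 < x -> y x = G x * ln x + Rpower x beta * PSeries v x) ->
  (forall x, 0 < x -> y2 x = G2 x * ln x + Rpower x beta * PSeries w x) ->
  (forall x, 0 < x -> G x = Rpower x beta * (x ^ k * PSeries g x)) ->
  forall n, (1 <= n)%nat -> INR n * (INR n - 1 + 2 * beta) * v n =
    sum_f_R0 (fun j => qs (S j) * v (n - S j)%nat) (n - 1)
    + PS_incr_n (fun m => e * w m - l * v m) 2 n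
    - PS_incr_n (fun m => (2 * (beta + INR k) - 1 + 2 * INR m) * g m) k n.
Proof.
  intros Eq Ev Ew Eg Hq Hb Hy Hdy HG HdG Ey Ey2 EG.
  (* [A] is the non-logarithmic part of [x ^ 2 y''] and [B] that of [x ^ 2 ((q - l) y + e y2)], both
     divided by [x ^ beta]. *)
  set (A := PS_plus (PS_plus (PS_scal (beta * (beta - 1)) v)
      (PS_scal (2 * beta) (PS_incr_n (PS_derive v) 1)))
    (PS_plus (PS_incr_n (PS_derive (PS_derive v)) 2)
      (PS_incr_n (PS_plus (PS_scal (2 * (beta + INR k) - 1) g)
        (PS_scal 2 (PS_incr_n (PS_derive g) 1))) k))).
  set (B := PS_plus (PS_mult qs v)
    (PS_incr_n (PS_plus (PS_scal e w) (PS_scal (- l) v)) 2)).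
  assert (EA1 : entire (PS_plus (PS_scal (beta * (beta - 1)) v)
      (PS_scal (2 * beta) (PS_incr_n (PS_derive v) 1)))).
  { apply entire_plus; apply entire_scal; auto. now apply entire_incr_n, entire_derive. }
  assert (EA2 : entire (PS_scal 2 (PS_incr_n (PS_derive g) 1)))
    by now apply entire_scal, entire_incr_n, entire_derive.
  assert (EA3 : entire (PS_incr_n (PS_plus (PS_scal (2 * (beta + INR k) - 1) g)
        (PS_scal 2 (PS_incr_n (PS_derive g) 1))) k)).
  { apply entire_incr_n, entire_plus; auto. now apply entire_scal. }
  assert (EA4 : entire (PS_incr_n (PS_derive (PS_derive v)) 2))
    by now apply entire_incr_n, entire_derive, entire_derive.
  assert (EB1 : entire (PS_incr_n (PS_plus (PS_scal e w) (PS_scal (- l) v)) 2)).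
  { apply entire_incr_n, entire_plus; now apply entire_scal. }
  assert (EA5 : entire (PS_scal (beta * (beta - 1)) v)) by now apply entire_scal.
  assert (EA6 : entire (PS_scal (2 * beta) (PS_incr_n (PS_derive v) 1)))
    by now apply entire_scal, entire_incr_n, entire_derive.
  assert (EB2 : entire (PS_mult qs v)) by now apply entire_mult.
  assert (EA7 := entire_plus _ _ EA4 EA3).
  assert (HAB : forall n, A n = B n).
  { apply PSeries_pos_ext.
    - now apply entire_plus.
    - now apply entire_plus.
    - intros x Hx.
      pose proof (log_frobenius_derive2 beta (PSeries v) (PSeries (PS_derive v))
        (PSeries (PS_derive (PS_derive v))) G dG _ y dy _
        (fun t _ => is_derive_PSeries v t (Ev t))
        (fun t _ => is_derive_PSeries _ t (entire_derive v Ev t)) HG HdG Ey Hy Hdy x Hx) as H2.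
      assert (HdGx : x * dG x = Rpower x beta * (x ^ k *
        ((beta + INR k) * PSeries g x + x * PSeries (PS_derive g) x))).
      { rewrite (is_derive_unique_pos _ _ x _
          (Rpower x beta * (x ^ k * ((beta + INR k) * PSeries g x + x * PSeries (PS_derive g) x)) / x)
          EG Hx (HG x Hx)).
        - field. lra.
        - pose proof (is_derive_Rpower beta x Hx) as D1.
          pose proof (is_derive_PSeries g x (Eg x)) as D2.
          set (p := fun t => Rpower t beta) in *. set (gg := PSeries g) in *.
          change (is_derive (fun t => p t * (t ^ k * gg t)) x
            (p x * (x ^ k * ((beta + INR k) * gg x + x * PSeries (PS_derive g) x)) / x)).
          change (is_derive p x (beta * p x / x)) in D1. der.
          destruct k as [|k'].
          + simpl. field. lra.
          + change (Init.Nat.pred (S k')) with k'. rewrite <- tech_pow_Rmult. field. lra. }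
      unfold A, B.
      rewrite !PSeries_plus by (apply entire_ex_pseries; assumption).
      rewrite PSeries_mult by auto.
      rewrite !PSeries_incr_n, !PSeries_plus by
        (apply entire_ex_pseries; auto; now apply entire_scal).
      rewrite !PSeries_scal, !PSeries_incr_n, <- Hq by exact Hx.
      cbv beta in H2. rewrite (Ey x Hx), (Ey2 x Hx) in H2.
      assert (Hp : 0 < Rpower x beta) by apply exp_pos.
      replace (2 * x * dG x) with (2 * (x * dG x)) in H2 by ring.
      rewrite HdGx in H2. pose proof (EG x Hx) as HGx.
      apply (Rmult_eq_reg_l (Rpower x beta)); [|lra].
      rewrite pow_1. apply Rminus_diag_uniq.
      match type of H2 with ?a = ?b => match type of HGx with ?c = ?d =>
        match goal with |- ?t = 0 => replace t with (b - a + (c - d)) by ring end end end.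
      rewrite H2, HGx. ring. }
  intros n Hn. specialize (HAB n). unfold A, B in HAB.
  unfold PS_plus at 1 2 3, PS_scal at 1 2 in HAB.
  rewrite PS_incr_derive, PS_incr_derive2 in HAB.
  rewrite (PS_incr_n_ext _ (fun m => (2 * (beta + INR k) - 1 + 2 * INR m) * g m)) in HAB;
    [|intros m; unfold PS_plus, PS_scal; rewrite PS_incr_derive;
      unfold plus, scal; simpl; unfold mult; simpl; ring].
  unfold PS_plus at 1 in HAB.
  rewrite (PS_incr_n_ext _ (fun m => e * w m - l * v m) 2) in HAB;
    [|intros m; unfold PS_plus, PS_scal;
      unfold plus, scal; simpl; unfold mult; simpl; ring].
  unfold PS_mult in HAB. rewrite decomp_sum in HAB by lia.
  replace (Init.Nat.pred n) with (n - 1)%nat in HAB by lia.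
  unfold plus, scal in HAB; simpl in HAB; unfold mult in HAB; simpl in HAB.
  rewrite Nat.sub_0_r, <- Hb in HAB.
  set (S1 := sum_f_R0 (fun j => qs (S j) * v (n - S j)%nat) (n - 1)) in *.
  set (S2 := PS_incr_n (fun m => (2 * (beta + INR k) - 1 + 2 * INR m) * g m) k n) in *.
  set (S3 := PS_incr_n (fun m => e * w m - l * v m) 2 n).
  change (beta * (beta - 1) * v n + 2 * beta * (INR n * v n) +
    (INR n * (INR n - 1) * v n + S2) = beta * (beta - 1) * v n + S1 + S3) in HAB.
  lra.
Qed.

(** The left factor is at least [n ^ 2 / 2] once [n >= 2 + 4 |beta|], while the convolution with
    [qs] and the logarithmic source cost at most a factor n: one power of n is gained. The 16 is
    [4 ^ 2], from the shift by two. *)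
Lemma recursion_bound (qs v w g : nat -> R) (beta l e M B Ga T : R) (k n : nat) :
  INR n * (INR n - 1 + 2 * beta) * v n =
    sum_f_R0 (fun j => qs (S j) * v (n - S j)%nat) (n - 1)
    + PS_incr_n (fun m => e * w m - l * v m) 2 n
    - PS_incr_n (fun m => (2 * (beta + INR k) - 1 + 2 * INR m) * g m) k n ->
  (2 <= n)%nat -> 2 + 4 * Rabs beta <= INR n ->
  0 <= M -> (forall j, Rabs (qs j) * 4 ^ j <= M) ->
  Rabs l <= B -> Rabs e <= B ->
  0 <= Ga -> (forall j, Rabs (g j) * 4 ^ j <= Ga) ->
  1 <= T -> (forall j, (j < n)%nat -> (Rabs (v j) + Rabs (w j)) * 4 ^ j <= T) ->
  INR n * (Rabs (v n) * 4 ^ n) <=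
    2 * (M + 16 * B + (Rabs (2 * (beta + INR k) - 1) + 2) * (Ga * 4 ^ k)) * T.
Proof.
  intros Hrec Hn Hbeta HM HqM Hl He HGa Hg HT Hvw.
  set (c0 := Rabs (2 * (beta + INR k) - 1)).
  assert (Hc0 : 0 <= c0) by apply Rabs_pos.
  assert (HB : 0 <= B) by (pose proof (Rabs_pos l); lra).
  assert (Hn2 : 2 <= INR n) by (apply (le_INR 2); exact Hn).
  assert (H4 : forall j, 0 < 4 ^ j) by (intros j; apply pow_lt; lra).
  assert (HGk : 0 <= Ga * 4 ^ k) by (apply Rmult_le_pos; [lra | apply Rlt_le, H4]).
  assert (Hv : forall j, (j < n)%nat -> Rabs (v j) * 4 ^ j <= T).
  { intros j Hj. specialize (Hvw j Hj). pose proof (Rabs_pos (w j)). specialize (H4 j). nra. }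
  assert (H1 : Rabs (sum_f_R0 (fun j => qs (S j) * v (n - S j)%nat) (n - 1)) * 4 ^ n
    <= INR n * (M * T)).
  { apply (Rle_trans _ (sum_f_R0 (fun j => M * T) (n - 1))).
    - apply (Rle_trans _ (sum_f_R0 (fun j => Rabs (qs (S j) * v (n - S j)%nat)) (n - 1) * 4 ^ n)).
      + apply Rmult_le_compat_r; [apply Rlt_le, H4 | apply Rsum_abs].
      + rewrite Rmult_comm, scal_sum. apply sum_Rle. intros j Hj.
        rewrite Rabs_mult.
        replace (4 ^ n) with (4 ^ S j * 4 ^ (n - S j)) by (rewrite <- pow_add; f_equal; lia).
        replace (_ * _) with ((Rabs (qs (S j)) * 4 ^ S j) *
          (Rabs (v (n - S j)%nat) * 4 ^ (n - S j))) by ring.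
        apply Rmult_le_compat; try (apply Rmult_le_pos; [apply Rabs_pos | apply Rlt_le, H4]).
        * apply HqM.
        * apply Hv. lia.
    - rewrite sum_cte. replace (S (n - 1)) with n by lia. lra. }
  assert (H3 : Rabs (PS_incr_n (fun m => e * w m - l * v m) 2 n) * 4 ^ n <= 16 * B * T).
  { rewrite PS_incr_n_simplify. destruct (Compare_dec.le_lt_dec 2 n) as [_|Hc]; [|lia].
    specialize (Hvw (n - 2)%nat ltac:(lia)).
    replace (4 ^ n) with (16 * 4 ^ (n - 2))
      by (replace n with (2 + (n - 2))%nat at 2 by lia; rewrite pow_add; simpl; ring).
    assert (Rabs (e * w (n - 2)%nat - l * v (n - 2)%nat)
      <= B * (Rabs (v (n - 2)%nat) + Rabs (w (n - 2)%nat))).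
    { unfold Rminus. eapply Rle_trans; [apply Rabs_triang|].
      rewrite Rabs_Ropp, !Rabs_mult.
      pose proof (Rabs_pos (v (n - 2)%nat)). pose proof (Rabs_pos (w (n - 2)%nat)).
      rewrite Rmult_plus_distr_l, Rplus_comm.
      apply Rplus_le_compat; apply Rmult_le_compat_r; lra. }
    specialize (H4 (n - 2)%nat).
    apply (Rle_trans _ (B * (Rabs (v (n - 2)%nat) + Rabs (w (n - 2)%nat)) * (16 * 4 ^ (n - 2)))).
    - apply Rmult_le_compat_r; lra.
    - replace (_ * _) with
        (16 * B * ((Rabs (v (n - 2)%nat) + Rabs (w (n - 2)%nat)) * 4 ^ (n - 2))) by ring.
      apply Rmult_le_compat_l; lra. }
  assert (H2 : Rabs (PS_incr_n (fun m => (2 * (beta + INR k) - 1 + 2 * INR m) * g m) k n) * 4 ^ n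
    <= INR n * ((c0 + 2) * (Ga * 4 ^ k))).
  { rewrite PS_incr_n_simplify. destruct (Compare_dec.le_lt_dec k n) as [Hk|Hk].
    - replace (4 ^ n) with (4 ^ k * 4 ^ (n - k)) by (rewrite <- pow_add; f_equal; lia).
      rewrite Rabs_mult.
      replace (_ * _) with (Rabs (2 * (beta + INR k) - 1 + 2 * INR (n - k)) *
        (Rabs (g (n - k)%nat) * 4 ^ (n - k) * 4 ^ k)) by ring.
      rewrite <- (Rmult_assoc (INR n)).
      apply Rmult_le_compat.
      + apply Rabs_pos.
      + repeat apply Rmult_le_pos; try apply Rabs_pos; apply Rlt_le, H4.
      + eapply Rle_trans; [apply Rabs_triang|]. fold c0.
        assert (INR (n - k) <= INR n) by (apply le_INR; lia).
        pose proof (pos_INR (n - k)). rewrite (Rabs_pos_eq (2 * INR (n - k))) by lra. nra.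
      + apply Rmult_le_compat_r; [apply Rlt_le, H4 | apply Hg].
    - unfold zero; simpl. rewrite Rabs_R0, Rmult_0_l.
      repeat apply Rmult_le_pos; try lra. apply Rlt_le, H4. }
  apply (f_equal (fun t => Rabs t * 4 ^ n)) in Hrec.
  set (S1 := sum_f_R0 _ _) in *. set (S2 := PS_incr_n _ k n) in *.
  set (S3 := PS_incr_n _ 2 n) in *.
  assert (Hle : Rabs (S1 + S3 - S2) * 4 ^ n
    <= INR n * (M * T) + 16 * B * T + INR n * ((c0 + 2) * (Ga * 4 ^ k))).
  { apply (Rle_trans _ ((Rabs S1 + Rabs S3 + Rabs S2) * 4 ^ n)); [|lra].
    apply Rmult_le_compat_r; [apply Rlt_le, H4|].
    unfold Rminus. eapply Rle_trans; [apply Rabs_triang|]. rewrite Rabs_Ropp.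
    apply Rplus_le_compat_r, Rabs_triang. }
  rewrite <- Hrec, !Rabs_mult in Hle.
  rewrite (Rabs_pos_eq (INR n)) in Hle by lra.
  assert (Hfac : INR n / 2 <= Rabs (INR n - 1 + 2 * beta)).
  { pose proof (Rle_abs (- beta)). rewrite Rabs_Ropp in H. pose proof (Rle_abs (INR n - 1 + 2 * beta)).
    lra. }
  set (t := Rabs (v n) * 4 ^ n).
  assert (Ht : 0 <= t) by (apply Rmult_le_pos; [apply Rabs_pos | apply Rlt_le, H4]).
  assert (Hle2 : INR n * (INR n / 2 * t)
    <= INR n * ((M + 16 * B + (c0 + 2) * (Ga * 4 ^ k)) * T)).
  { apply (Rle_trans _ (INR n * Rabs (INR n - 1 + 2 * beta) * Rabs (v n) * 4 ^ n)).
    - replace (_ * _ * _ * _) with (INR n * (Rabs (INR n - 1 + 2 * beta) * t)) by (unfold t; ring).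
      apply Rmult_le_compat_l; [lra|]. now apply Rmult_le_compat_r.
    - apply (Rle_trans _ _ _ Hle).
      assert (16 * B * T <= INR n * (16 * B * T)).
      { rewrite <- (Rmult_1_l (16 * B * T)) at 1. apply Rmult_le_compat_r; [|lra].
        repeat apply Rmult_le_pos; lra. }
      assert ((c0 + 2) * (Ga * 4 ^ k) <= (c0 + 2) * (Ga * 4 ^ k) * T).
      { rewrite <- (Rmult_1_r ((c0 + 2) * (Ga * 4 ^ k))) at 1. apply Rmult_le_compat_l; [|lra].
        apply Rmult_le_pos; lra. }
      assert (INR n * ((c0 + 2) * (Ga * 4 ^ k)) <= INR n * ((c0 + 2) * (Ga * 4 ^ k) * T))
        by (apply Rmult_le_compat_l; lra).
      lra. }
  apply Rmult_le_reg_l in Hle2; lra.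
Qed.

(** Once n exceeds both N and c, the recursive estimate cannot raise the bound T; the finitely many
    earlier terms have bounds of their own. T is uniform in z. *)
Lemma sequence_bound {Z : Type} (D : Z -> Prop) (s : nat -> Z -> R) (c : R) (N : nat) :
  (forall n, exists M, forall z, D z -> s n z <= M) ->
  (forall n, (N <= n)%nat -> forall z, D z -> forall T, 1 <= T ->
    (forall j, (j < n)%nat -> s j z <= T) -> INR n * s n z <= c * T) ->
  exists T, 1 <= T /\ forall n z, D z -> s n z <= T.
Proof.
  intros Hb Hr.
  destruct (INR_unbounded c) as [N1 HN1].
  set (N' := S (Nat.max N N1)).
  assert (H0 : exists T, 1 <= T /\ forall n, (n < N')%nat -> forall z, D z -> s n z <= T).
  { clearbody N'. induction N' as [|m (T & HT & IH)].
    - exists 1. split; [lra|]. intros n Hn. lia.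
    - destruct (Hb m) as [M HM]. exists (Rmax T M).
      split; [pose proof (Rmax_l T M); lra|]. intros n Hn z Hz.
      destruct (PeanoNat.Nat.eq_dec n m) as [->|Hne].
      + apply (Rle_trans _ M); [now apply HM | apply Rmax_r].
      + apply (Rle_trans _ T); [apply IH; [lia | exact Hz] | apply Rmax_l]. }
  destruct H0 as (T & HT & H0). exists T. split; [exact HT|].
  intros n. induction n as [n IH] using (well_founded_induction Wf_nat.lt_wf). intros z Hz.
  destruct (Compare_dec.le_lt_dec N' n) as [Hn|Hn]; [|now apply H0].
  assert (Hn' : INR N1 <= INR n) by (apply le_INR; lia).
  assert (0 < INR n) by (apply (lt_INR 0); lia).
  specialize (Hr n ltac:(lia) z Hz T HT (fun j Hj => IH j Hj z Hz)). nra.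
Qed.

(** * Continuity of Frobenius expansions in the spectral parameter *)

Definition re_seq (f : nat -> C -> C) (z : C) (n : nat) : R := Re (f n z).
Definition im_seq (f : nat -> C -> C) (z : C) (n : nat) : R := Im (f n z).
Definition box (B : R) (z : C) : Prop := Rabs (Re z) <= B /\ Rabs (Im z) <= B.

Lemma peval_bound (p : list R) (B : R) :
  exists M, 0 <= M /\ forall z, box B z -> Rabs (Re (peval p z)) <= M /\ Rabs (Im (peval p z)) <= M.
Proof.
  induction p as [|c p (M & HM & IH)].
  - exists 0. split; [lra|]. intros z _. simpl. rewrite Rabs_R0. lra.
  - exists (Rabs c + 2 * (Rabs B * M)). pose proof (Rabs_pos c). pose proof (Rabs_pos B).
    assert (0 <= Rabs B * M) by (now apply Rmult_le_pos).
    split; [lra|]. intros z Hz. destruct (IH z Hz) as [I1 I2]. destruct Hz as [Hz1 Hz2].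
    pose proof (Rle_abs B).
    assert (Hm : forall s t, Rabs s <= B -> Rabs t <= M -> Rabs (s * t) <= Rabs B * M).
    { intros s t Hs Ht. rewrite Rabs_mult. apply Rmult_le_compat; try apply Rabs_pos; lra. }
    destruct z as [zr zi]. set (w := peval p (zr, zi)) in *.
    pose proof (Hm _ _ Hz1 I1). pose proof (Hm _ _ Hz1 I2).
    pose proof (Hm _ _ Hz2 I1). pose proof (Hm _ _ Hz2 I2).
    change (peval (c :: p) (zr, zi)) with (RtoC c + (zr, zi) * w)%C. clearbody w.
    destruct w as [wr wi]. simpl in *.
    split.
    + eapply Rle_trans; [apply Rabs_triang|]. unfold Rminus.
      pose proof (Rabs_triang (zr * wr) (- (zi * wi))) as Ht. rewrite Rabs_Ropp in Ht. lra.
    + rewrite Rplus_0_l. pose proof (Rabs_triang (zr * wi) (zi * wr)). lra.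
Qed.

Lemma filterlim_peval {T : Type} {F : (T -> Prop) -> Prop} {FF : Filter F} (p : list R)
  (z : T -> C) (z0 : C) :
  filterlim (fun t => Re (z t)) F (locally (Re z0)) ->
  filterlim (fun t => Im (z t)) F (locally (Im z0)) ->
  filterlim (fun t => Re (peval p (z t))) F (locally (Re (peval p z0))) /\
  filterlim (fun t => Im (peval p (z t))) F (locally (Im (peval p z0))).
Proof.
  intros Hr Hi. induction p as [|c p [IH1 IH2]].
  - split; apply filterlim_Rconst.
  - split.
    + apply filterlim_Rplus; [apply filterlim_Rconst|].
      apply filterlim_Rminus; now apply filterlim_Rmult.
    + apply filterlim_Rplus; [apply filterlim_Rconst|].
      apply filterlim_Rplus; now apply filterlim_Rmult.
Qed.

Lemma peval_real (p : list R) (x : R) : Im (peval p (RtoC x)) = 0.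
Proof.
  induction p as [|c p IH]; [reflexivity|].
  change (0 + (x * Im (peval p (RtoC x)) + 0 * Re (peval p (RtoC x))) = 0). rewrite IH. ring.
Qed.

Lemma eventually_box {T : Type} {F : (T -> Prop) -> Prop} {FF : Filter F} (z : T -> C) (z0 : C) :
  filterlim (fun t => Re (z t)) F (locally (Re z0)) ->
  filterlim (fun t => Im (z t)) F (locally (Im z0)) ->
  F (fun t => box (Rabs (Re z0) + Rabs (Im z0) + 1) (z t)).
Proof.
  intros Hr Hi.
  assert (Hr1 : F (fun t => Rabs (Re (z t) - Re z0) < 1))
    by exact (Hr _ (locally_ball (Re z0) (mkposreal 1 Rlt_0_1))).
  assert (Hi1 : F (fun t => Rabs (Im (z t) - Im z0) < 1))
    by exact (Hi _ (locally_ball (Im z0) (mkposreal 1 Rlt_0_1))).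
  generalize (filter_and _ _ Hr1 Hi1). apply filter_imp. intros t [H1 H2].
  pose proof (Rabs_triang_inv (Re (z t)) (Re z0)).
  pose proof (Rabs_triang_inv (Im (z t)) (Im z0)).
  pose proof (Rabs_pos (Re z0)). pose proof (Rabs_pos (Im z0)). split; lra.
Qed.

(** Tannery's theorem (dominated convergence for series) along a filter: with this geometric
    majorant, the tail after index N is at most [M * (/ 2) ^ N]. *)
Lemma filterlim_Series {T : Type} {F : (T -> Prop) -> Prop} {PF : ProperFilter F}
  (f : nat -> T -> R) (l : nat -> R) (M : R) :
  (forall n, filterlim (f n) F (locally (l n))) ->
  F (fun t => forall n, Rabs (f n t) <= M * (/ 2) ^ n) ->
  filterlim (fun t => Series (fun n => f n t)) F (locally (Series l)).
Proof.
  intros Hf HM.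
  assert (Hgeom : ex_series (fun n => M * (/ 2) ^ n)).
  { apply (ex_series_scal_l M (fun n => (/ 2) ^ n)). apply ex_series_geom.
    rewrite Rabs_pos_eq; lra. }
  assert (HlM : forall n, Rabs (l n) <= M * (/ 2) ^ n).
  { intros n. apply (filterlim_le (F := F) (fun t => Rabs (f n t)) (fun _ => M * (/ 2) ^ n)
      (Rabs (l n)) (M * (/ 2) ^ n)).
    - generalize HM. apply filter_imp. intros t Ht. apply Ht.
    - apply (filterlim_continuous Rabs); [apply continuous_Rabs | apply Hf].
    - apply filterlim_Rconst. }
  assert (Htail : forall a : nat -> R, (forall n, Rabs (a n) <= M * (/ 2) ^ n) ->
    forall N, Rabs (Series a - sum_n a N) <= M * (/ 2) ^ N).
  { intros a Ha N.
    assert (Hea : ex_series a) by (exact (ex_series_le (V := R_CompleteNormedModule) a _ Ha Hgeom)).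
    rewrite (Series_incr_n a (S N)) by (auto; lia). rewrite sum_n_Reals. simpl Init.Nat.pred.
    replace (_ + _ - _) with (Series (fun k => a (S N + k)%nat)) by ring.
    assert (Hg2 : forall k, Rabs (a (S N + k)%nat) <= M * (/ 2) ^ S N * (/ 2) ^ k).
    { intros k. rewrite Rmult_assoc, <- pow_add. apply Ha. }
    assert (Hex : ex_series (fun k => M * (/ 2) ^ S N * (/ 2) ^ k)).
    { apply (ex_series_scal_l (M * (/ 2) ^ S N) (fun n => (/ 2) ^ n)). apply ex_series_geom.
      rewrite Rabs_pos_eq; lra. }
    eapply Rle_trans; [apply Series_Rabs|].
    - apply (ex_series_le (V := R_CompleteNormedModule) _
        (fun k => M * (/ 2) ^ S N * (/ 2) ^ k)); [|exact Hex].
      intros k. change (Rabs (Rabs (a (S N + k)%nat)) <= M * (/ 2) ^ S N * (/ 2) ^ k).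
      rewrite Rabs_Rabsolu. apply Hg2.
    - eapply Rle_trans; [apply Series_le; [|exact Hex]|].
      + intros k. split; [apply Rabs_pos | apply Hg2].
      + rewrite Series_scal_l, Series_geom by (rewrite Rabs_pos_eq; lra). simpl. lra. }
  assert (HM0 : 0 <= M).
  { specialize (HlM 0%nat). pose proof (Rabs_pos (l 0%nat)). simpl in HlM. lra. }
  apply filterlim_locally. intros eps.
  destruct (pow_lt_1_zero (/ 2) ltac:(rewrite Rabs_pos_eq; lra) (eps / (3 * (M + 1)))
    ltac:(apply Rdiv_lt_0_compat; [apply eps | lra])) as [N HN].
  specialize (HN N (le_n N)). rewrite Rabs_pos_eq in HN by (apply pow_le; lra).
  assert (Hsm : M * (/ 2) ^ N < eps / 3).
  { apply Rlt_div_r in HN; [|lra]. assert (0 < (/ 2) ^ N) by (apply pow_lt; lra). nra. }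
  assert (Hsum : filterlim (fun t => sum_n (fun n => f n t) N) F (locally (sum_n l N))).
  { clear - Hf PF. induction N as [|N IH].
    - rewrite sum_O. apply (filterlim_ext (f 0%nat)); [intros t; now rewrite sum_O | apply Hf].
    - rewrite sum_Sn. apply (filterlim_ext (fun t => sum_n (fun n => f n t) N + f (S N) t)).
      + intros t. now rewrite sum_Sn.
      + now apply filterlim_Rplus. }
  assert (He3 : 0 < eps / 3) by (apply Rdiv_lt_0_compat; [apply eps | lra]).
  assert (Hs1 : F (fun t => Rabs (sum_n (fun n => f n t) N - sum_n l N) < eps / 3))
    by exact (Hsum _ (locally_ball _ (mkposreal _ He3))).
  generalize (filter_and _ _ HM Hs1). apply filter_imp. intros t [H1 H2].
  change (Rabs (Series (fun n => f n t) - Series l) < eps).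
  pose proof (Htail _ H1 N) as T1. pose proof (Htail _ HlM N) as T2.
  apply Rabs_def2 in H2. apply Rabs_le_between in T1. apply Rabs_le_between in T2.
  apply Rabs_def1; lra.
Qed.

Lemma rsol_scal q l e a b c d kr ki : rsol q l e a b c d ->
  rsol q l e (fun x => kr * a x - ki * b x) (fun x => kr * b x + ki * a x)
    (fun x => kr * c x - ki * d x) (fun x => kr * d x + ki * c x).
Proof.
  intros H x Hx. destruct (H x Hx) as (H1 & H2 & H3 & H4).
  refine (conj _ (conj _ (conj _ _))); der; ring.
Qed.

Lemma rsol_plus q l e a b c d a' b' c' d' : rsol q l e a b c d -> rsol q l e a' b' c' d' ->
  rsol q l e (fun x => a x + a' x) (fun x => b x + b' x)
    (fun x => c x + c' x) (fun x => d x + d' x).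
Proof.
  intros H H' x Hx. destruct (H x Hx) as (H1 & H2 & H3 & H4).
  destruct (H' x Hx) as (H5 & H6 & H7 & H8).
  refine (conj _ (conj _ (conj _ _))); der; ring.
Qed.

(* [G] is the coefficient [K y1] of the logarithm in the second Frobenius solution; [G = 0] covers
   [y1] itself and the non-logarithmic case. *)
Record frobenius_family (qs : nat -> R) (beta : R) (k : nat) (v g : nat -> C -> C)
  (yr yi dyr dyi Gr Gi dGr dGi : R -> C -> R) : Prop := {
  ff_sol : forall z, rsol (qfun qs) (Re z) (Im z)
    (fun x => yr x z) (fun x => yi x z) (fun x => dyr x z) (fun x => dyi x z);
  ff_log : forall z, rsol (qfun qs) (Re z) (Im z)
    (fun x => Gr x z) (fun x => Gi x z) (fun x => dGr x z) (fun x => dGi x z);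
  ff_ent : forall z, entire (re_seq v z) /\ entire (im_seq v z) /\
    entire (re_seq g z) /\ entire (im_seq g z);
  ff_re : forall z x, 0 < x ->
    yr x z = Gr x z * ln x + Rpower x beta * PSeries (re_seq v z) x;
  ff_im : forall z x, 0 < x ->
    yi x z = Gi x z * ln x + Rpower x beta * PSeries (im_seq v z) x;
  ff_logre : forall z x, 0 < x -> Gr x z = Rpower x beta * (x ^ k * PSeries (re_seq g z) x);
  ff_logim : forall z x, 0 < x -> Gi x z = Rpower x beta * (x ^ k * PSeries (im_seq g z) x)
}.

(** The base 4 leaves room at x = 1: since [n <= 2 ^ n], the differentiated series is still
    dominated by a geometric series of ratio 1/2. *)
Definition locally_geometric (v : nat -> C -> C) : Prop :=
  forall B, exists T, 1 <= T /\ forall n z, box B z ->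
    (Rabs (re_seq v z n) + Rabs (im_seq v z n)) * 4 ^ n <= T.

Lemma family_bound qs beta k v g yr yi dyr dyi Gr Gi dGr dGi :
  (forall x, 0 < x -> ex_series (fun n => qs (n + 2)%nat * x ^ n)) ->
  beta * (beta - 1) = qs 0%nat ->
  frobenius_family qs beta k v g yr yi dyr dyi Gr Gi dGr dGi ->
  (exists p : nat -> list R, forall n z, v n z = peval (p n) z) ->
  locally_geometric g -> locally_geometric v.
Proof.
  intros Hc Hb HF [p Hp] Hg B.
  destruct (entire_potential qs Hc) as [Eq Hq].
  destruct (entire_bounded qs 4 ltac:(lra) Eq) as (M & HM & HqM).
  destruct (Hg (Rabs B)) as (Ga & HGa & HgG).
  destruct (INR_unbounded (2 + 4 * Rabs beta)) as [N0 HN0].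
  assert (H4 : forall j, 0 < 4 ^ j) by (intros j; apply pow_lt; lra).
  set (c := 2 * (M + 16 * Rabs B + (Rabs (2 * (beta + INR k) - 1) + 2) * (Ga * 4 ^ k))).
  (* The constant is [2 * c], one c for each of the real and imaginary parts. *)
  destruct (sequence_bound (box B)
    (fun n z => (Rabs (re_seq v z n) + Rabs (im_seq v z n)) * 4 ^ n) (2 * c) (Nat.max 2 N0))
    as (T & HT & HvT); [| |exists T; split; [exact HT | exact HvT]].
  - intros n. destruct (peval_bound (p n) B) as (Mn & HMn & Hpn).
    exists ((Mn + Mn) * 4 ^ n). intros z Hz. destruct (Hpn z Hz).
    apply Rmult_le_compat_r; [apply Rlt_le, H4|].
    unfold re_seq, im_seq. rewrite Hp. lra.
  - intros n Hn z Hz T HT Hj. destruct HF as [Hs HG He Hre Him HGre HGim].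
    destruct (He z) as (E1 & E2 & E3 & E4).
    assert (Hzb : Rabs (Re z) <= Rabs B /\ Rabs (Im z) <= Rabs B).
    { destruct Hz. pose proof (Rle_abs B). lra. }
    assert (Hgz : forall j, Rabs (re_seq g z j) * 4 ^ j <= Ga /\ Rabs (im_seq g z j) * 4 ^ j <= Ga).
    { intros j. specialize (HgG j z Hzb). specialize (H4 j).
      pose proof (Rabs_pos (re_seq g z j)). pose proof (Rabs_pos (im_seq g z j)).
      rewrite Rmult_plus_distr_r in HgG.
      assert (0 <= Rabs (re_seq g z j) * 4 ^ j) by (apply Rmult_le_pos; lra).
      assert (0 <= Rabs (im_seq g z j) * 4 ^ j) by (apply Rmult_le_pos; lra). lra. }
    assert (HnN : 2 + 4 * Rabs beta <= INR n).
    { apply Rlt_le, (Rlt_le_trans _ _ _ HN0). apply le_INR. lia. }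
    assert (R1 := frobenius_recursion qs (re_seq v z) (im_seq v z) (re_seq g z) beta
      (Re z) (Im z) k _ _ _ _ _ _ Eq E1 E2 E3 Hq Hb
      (fun x Hx => proj1 (Hs z x Hx)) (fun x Hx => proj1 (proj2 (proj2 (Hs z x Hx))))
      (fun x Hx => proj1 (HG z x Hx)) (fun x Hx => proj1 (proj2 (proj2 (HG z x Hx))))
      (Hre z) (Him z) (HGre z) n ltac:(lia)).
    (* Exchanging the two components reverses the sign of [Im z]. *)
    assert (R2 := frobenius_recursion qs (im_seq v z) (re_seq v z) (im_seq g z) beta
      (Re z) (- Im z) k (fun x => yi x z) (fun x => dyi x z) (fun x => yr x z)
      (fun x => Gi x z) (fun x => dGi x z) (fun x => Gr x z) Eq E2 E1 E4 Hq Hb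
      (fun x Hx => proj1 (proj2 (Hs z x Hx)))
      ltac:(intros x Hx; rewrite Ropp_mult_distr_l_reverse;
            exact (proj2 (proj2 (proj2 (Hs z x Hx)))))
      (fun x Hx => proj1 (proj2 (HG z x Hx)))
      ltac:(intros x Hx; rewrite Ropp_mult_distr_l_reverse;
            exact (proj2 (proj2 (proj2 (HG z x Hx)))))
      (Him z) (Hre z) (HGim z) n ltac:(lia)).
    assert (B1 := recursion_bound qs _ _ _ _ _ _ M (Rabs B) Ga T k n R1 ltac:(lia) HnN
      ltac:(lra) HqM (proj1 Hzb) (proj2 Hzb) ltac:(lra) (fun j => proj1 (Hgz j)) HT Hj).
    assert (B2 := recursion_bound qs _ _ _ _ _ _ M (Rabs B) Ga T k n R2 ltac:(lia) HnN
      ltac:(lra) HqM (proj1 Hzb) ltac:(rewrite Rabs_Ropp; exact (proj2 Hzb)) ltac:(lra)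
      (fun j => proj2 (Hgz j)) HT
      (fun j Hlt => eq_rect _ (fun t => t * 4 ^ j <= T) (Hj j Hlt) _ (Rplus_comm _ _))).
    fold c in B1, B2. lra.
Qed.

Section Limits_at_one.

Context {T : Type} {F : (T -> Prop) -> Prop} {PF : ProperFilter F}.
Variables (z : T -> C) (z0 : C).
Hypothesis Hzr : filterlim (fun t => Re (z t)) F (locally (Re z0)).
Hypothesis Hzi : filterlim (fun t => Im (z t)) F (locally (Im z0)).

Lemma PSeries_one_limits (s : C -> nat -> R) (M : R) :
  (forall n, filterlim (fun t => s (z t) n) F (locally (s z0 n))) ->
  F (fun t => forall n, Rabs (s (z t) n) * 4 ^ n <= M) ->
  filterlim (fun t => PSeries (s (z t)) 1) F (locally (PSeries (s z0) 1)) /\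
  filterlim (fun t => PSeries (PS_derive (s (z t))) 1) F (locally (PSeries (PS_derive (s z0)) 1)).
Proof.
  intros Hl HM.
  assert (H4 : forall j, 0 < 4 ^ j) by (intros j; apply pow_lt; lra).
  assert (H2 : forall j, 0 < 2 ^ j) by (intros j; apply pow_lt; lra).
  assert (Hs : forall n a, Rabs a * 4 ^ n <= M -> 2 ^ n * Rabs a <= M * (/ 2) ^ n).
  { intros n a Ha. rewrite pow_inv.
    replace (4 ^ n) with (2 ^ n * 2 ^ n) in Ha
      by (rewrite <- Rpow_mult_distr; f_equal; lra).
    apply (Rmult_le_reg_r (2 ^ n)); [apply H2|]. specialize (H2 n). field_simplify; lra. }
  assert (Hn2 : forall n, 1 <= 2 ^ n /\ INR n <= 2 ^ n).
  { induction n as [|n [I1 I2]]; [simpl; lra|]. rewrite S_INR. simpl pow. split; lra. }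
  split; apply (filterlim_Series _ _ M).
  - intros n. apply filterlim_Rmult; [apply Hl | apply filterlim_Rconst].
  - generalize HM. apply filter_imp. intros t Ht n. rewrite pow1, Rmult_1_r.
    eapply Rle_trans; [|apply Hs, Ht].
    rewrite <- (Rmult_1_l (Rabs _)) at 1. apply Rmult_le_compat_r; [apply Rabs_pos|].
    apply Hn2.
  - intros n. apply filterlim_Rmult; [|apply filterlim_Rconst].
    apply filterlim_Rmult; [apply filterlim_Rconst | apply Hl].
  - generalize HM. apply filter_imp. intros t Ht n.
    rewrite pow1, Rmult_1_r. unfold PS_derive. rewrite Rabs_mult, (Rabs_pos_eq (INR _)) by apply pos_INR.
    specialize (Hs (S n) _ (Ht (S n))). specialize (Hn2 (S n)).
    pose proof (Rabs_pos (s (z t) (S n))).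
    apply (Rle_trans _ (2 ^ S n * Rabs (s (z t) (S n)))).
    + apply Rmult_le_compat_r; [lra | apply Hn2].
    + apply (Rle_trans _ _ _ Hs).
      specialize (Ht 0%nat). pose proof (Rabs_pos (s (z t) 0%nat)). simpl in Ht.
      apply Rmult_le_compat_l; [lra|].
      simpl. pose proof (pow_lt (/ 2) n ltac:(lra)). lra.
Qed.

(** At x = 1, y is the sum of the coefficients, and y' is [G] plus beta times that sum plus the
    differentiated series; a logarithm contributes nothing else. *)
Lemma family_limits qs beta k v g yr yi dyr dyi Gr Gi dGr dGi :
  frobenius_family qs beta k v g yr yi dyr dyi Gr Gi dGr dGi ->
  (exists p : nat -> list R, forall n z, v n z = peval (p n) z) ->
  locally_geometric v ->
  filterlim (fun t => Gr 1 (z t)) F (locally (Gr 1 z0)) ->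
  filterlim (fun t => Gi 1 (z t)) F (locally (Gi 1 z0)) ->
  filterlim (fun t => yr 1 (z t)) F (locally (yr 1 z0)) /\
  filterlim (fun t => yi 1 (z t)) F (locally (yi 1 z0)) /\
  filterlim (fun t => dyr 1 (z t)) F (locally (dyr 1 z0)) /\
  filterlim (fun t => dyi 1 (z t)) F (locally (dyi 1 z0)).
Proof.
  intros [Hs HG He Hre Him HGre HGim] [p Hp] Hgeo HGr HGi.
  destruct (Hgeo (Rabs (Re z0) + Rabs (Im z0) + 1)) as (M & HM & HvM).
  pose proof (eventually_box z z0 Hzr Hzi) as Hbox.
  assert (H4 : forall j, 0 < 4 ^ j) by (intros j; apply pow_lt; lra).
  assert (Hv : F (fun t => forall n, Rabs (re_seq v (z t) n) * 4 ^ n <= M /\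
    Rabs (im_seq v (z t) n) * 4 ^ n <= M)).
  { generalize Hbox. apply filter_imp. intros t Ht n. specialize (HvM n _ Ht).
    specialize (H4 n). pose proof (Rabs_pos (re_seq v (z t) n)).
    pose proof (Rabs_pos (im_seq v (z t) n)). rewrite Rmult_plus_distr_r in HvM.
    assert (0 <= Rabs (re_seq v (z t) n) * 4 ^ n) by (apply Rmult_le_pos; lra).
    assert (0 <= Rabs (im_seq v (z t) n) * 4 ^ n) by (apply Rmult_le_pos; lra). lra. }
  assert (Hlim : forall n, filterlim (fun t => re_seq v (z t) n) F (locally (re_seq v z0 n)) /\
    filterlim (fun t => im_seq v (z t) n) F (locally (im_seq v z0 n))).
  { intros n. unfold re_seq, im_seq. rewrite Hp.
    destruct (filterlim_peval (p n) z z0 Hzr Hzi) as [L1 L2].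
    split; [apply (filterlim_ext (fun t => Re (peval (p n) (z t)))) |
            apply (filterlim_ext (fun t => Im (peval (p n) (z t))))];
      auto; intros t; now rewrite Hp. }
  destruct (PSeries_one_limits (re_seq v) M (fun n => proj1 (Hlim n))) as [A1 A2].
  { generalize Hv. apply filter_imp. intros t Ht n. apply Ht. }
  destruct (PSeries_one_limits (im_seq v) M (fun n => proj2 (Hlim n))) as [B1 B2].
  { generalize Hv. apply filter_imp. intros t Ht n. apply Ht. }
  assert (Hone : Rpower 1 beta = 1) by (unfold Rpower; rewrite ln_1, Rmult_0_r; apply exp_0).
  assert (Ey : forall w, yr 1 w = PSeries (re_seq v w) 1 /\ yi 1 w = PSeries (im_seq v w) 1).
  { intros w. rewrite (Hre w 1), (Him w 1), ln_1, Hone by lra. lra. }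
  assert (Ed : forall w,
    dyr 1 w = Gr 1 w + (beta * PSeries (re_seq v w) 1 + PSeries (PS_derive (re_seq v w)) 1) /\
    dyi 1 w = Gi 1 w + (beta * PSeries (im_seq v w) 1 + PSeries (PS_derive (im_seq v w)) 1)).
  { intros w. destruct (He w) as (E1 & E2 & _).
    pose proof (log_frobenius_derive beta (PSeries (re_seq v w)) _ (fun x => Gr x w) _
      (fun x => yr x w) (fun x => dyr x w)
      (fun t _ => is_derive_PSeries _ t (E1 t)) (fun x Hx => proj1 (HG w x Hx))
      (Hre w) (fun x Hx => proj1 (Hs w x Hx)) 1 ltac:(lra)) as D1.
    pose proof (log_frobenius_derive beta (PSeries (im_seq v w)) _ (fun x => Gi x w) _
      (fun x => yi x w) (fun x => dyi x w)
      (fun t _ => is_derive_PSeries _ t (E2 t)) (fun x Hx => proj1 (proj2 (HG w x Hx)))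
      (Him w) (fun x Hx => proj1 (proj2 (Hs w x Hx))) 1 ltac:(lra)) as D2.
    rewrite ln_1, Hone in D1, D2. lra. }
  refine (conj _ (conj _ (conj _ _))).
  - rewrite (proj1 (Ey z0)). eapply filterlim_ext; [|exact A1]. intros t. symmetry. apply Ey.
  - rewrite (proj2 (Ey z0)). eapply filterlim_ext; [|exact B1]. intros t. symmetry. apply Ey.
  - rewrite (proj1 (Ed z0)). eapply filterlim_ext; [intros t; symmetry; apply Ed|].
    apply filterlim_Rplus; auto. apply filterlim_Rplus; auto.
    apply filterlim_Rmult; auto. apply filterlim_Rconst.
  - rewrite (proj2 (Ed z0)). eapply filterlim_ext; [intros t; symmetry; apply Ed|].
    apply filterlim_Rplus; auto. apply filterlim_Rplus; auto.
    apply filterlim_Rmult; auto. apply filterlim_Rconst.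
Qed.

End Limits_at_one.

(** * The given phi and theta as Frobenius families *)

Lemma is_series_Re_Im (f : nat -> C) (s : C) :
  is_series (K := C_AbsRing) (V := C_NormedModule) f s ->
  is_series (fun n => Re (f n)) (Re s) /\ is_series (fun n => Im (f n)) (Im s).
Proof.
  intros H.
  assert (Hsum : forall n, Re (sum_n f n) = sum_n (fun n => Re (f n)) n /\
    Im (sum_n f n) = sum_n (fun n => Im (f n)) n).
  { induction n as [|n [I1 I2]]; [now rewrite !sum_O|].
    rewrite !sum_Sn. rewrite <- I1, <- I2. split; reflexivity. }
  split.
  - apply (filterlim_ext (fun n => Re (sum_n f n))); [intros n; apply Hsum|].
    apply (filterlim_comp _ _ _ (fun n => sum_n f n) Re _ _ _ H).
    destruct s as [sr si]. exact (continuous_fst (U := R_UniformSpace) (V := R_UniformSpace) sr si).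
  - apply (filterlim_ext (fun n => Im (sum_n f n))); [intros n; apply Hsum|].
    apply (filterlim_comp _ _ _ (fun n => sum_n f n) Im _ _ _ H).
    destruct s as [sr si]. exact (continuous_snd (U := R_UniformSpace) (V := R_UniformSpace) sr si).
Qed.

(** The Frobenius hypotheses split off the constant term and index the rest by [x ^ (n + 1)]; this
    restores the usual indexing. The head is [1 :: nil] for 1 and [nil] for 0. *)
Definition with_head (c : list R) (a : nat -> list R) (n : nat) (z : C) : C :=
  match n with O => peval c z | S m => peval (a m) z end.

Lemma with_head_peval c a :
  exists p : nat -> list R, forall n z, with_head c a n z = peval (p n) z.
Proof.
  exists (fun n => match n with O => c | S m => a m end). now intros [|n] z.
Qed.

Lemma with_head_sum (c : list R) (a : nat -> list R) (z : C) (x : R) (s : C) :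
  is_series (K := C_AbsRing) (V := C_NormedModule)
    (fun n => (peval (a n) z * RtoC (x ^ (n + 1)))%C) s ->
  is_pseries (re_seq (with_head c a) z) x (Re (peval c z) + Re s) /\
  is_pseries (im_seq (with_head c a) z) x (Im (peval c z) + Im s).
Proof.
  intros H. apply is_series_Re_Im in H. destruct H as [H1 H2].
  split; apply is_pseries_R; apply is_series_decr_1.
  - replace (plus _ _) with (Re s) by
      (unfold plus, opp, re_seq; simpl; ring).
    eapply is_series_ext; [|exact H1]. intros n. cbv beta.
    replace (n + 1)%nat with (S n) by lia. unfold re_seq, with_head.
    destruct (peval (a n) z) as [r i]. simpl. ring.
  - replace (plus _ _) with (Im s) by
      (unfold plus, opp, im_seq; simpl; ring).
    eapply is_series_ext; [|exact H2]. intros n. cbv beta.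
    replace (n + 1)%nat with (S n) by lia. unfold im_seq, with_head.
    destruct (peval (a n) z) as [r i]. simpl. ring.
Qed.

Lemma with_head_entire (c : list R) (a : nat -> list R) (z : C) :
  (forall x, 0 < x -> exists s, is_series (K := C_AbsRing) (V := C_NormedModule)
    (fun n => (peval (a n) z * RtoC (x ^ (n + 1)))%C) s) ->
  entire (re_seq (with_head c a) z) /\ entire (im_seq (with_head c a) z).
Proof.
  intros H.
  split; apply entire_of_ex_pseries; intros x Hx; destruct (H x Hx) as [s Hs];
    destruct (with_head_sum c a z x s Hs); eexists; eassumption.
Qed.

Lemma entire_zero : entire (fun _ => 0).
Proof. intros x. rewrite CV_radius_const_0. exact I. Qed.

Section Frobenius.

Variables (qs : nat -> R) (phi dphi theta dtheta : R -> C -> C).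
Hypothesis Hconv : forall x, 0 < x -> ex_series (fun n => qs (n + 2)%nat * x ^ n).
Hypothesis Hq0 : - / 4 <= qs 0%nat.
Hypothesis Hphi : frobenius_phi qs phi dphi.
Hypothesis Htheta : frobenius_theta qs phi theta dtheta.

Let w := wronski_const qs.

Lemma nu_sq : nu qs * nu qs = qs 0%nat + / 4.
Proof. unfold nu. apply sqrt_sqrt. lra. Qed.

Lemma phi_family : exists a, frobenius_family qs (/ 2 + nu qs) 0 (with_head (1 :: nil) a)
  (fun _ _ => RtoC 0) (fun x z => Re (phi x z)) (fun x z => Im (phi x z))
  (fun x z => Re (dphi x z)) (fun x z => Im (dphi x z))
  (fun _ _ => 0) (fun _ _ => 0) (fun _ _ => 0) (fun _ _ => 0).
Proof.
  destruct Hphi as [a Ha]. exists a.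
  assert (Hp : forall z x, 0 < x ->
    Re (phi x z) = Rpower x (/ 2 + nu qs) * PSeries (re_seq (with_head (1 :: nil) a) z) x /\
    Im (phi x z) = Rpower x (/ 2 + nu qs) * PSeries (im_seq (with_head (1 :: nil) a) z) x).
  { intros z x Hx. destruct (Ha z) as [_ Hs]. destruct (Hs x Hx) as (s & Hs1 & Hs2).
    destruct (with_head_sum (1 :: nil) a z x s Hs1) as [P1 P2].
    apply is_pseries_unique in P1. apply is_pseries_unique in P2.
    rewrite P1, P2, Hs2. destruct s as [sr si], z as [zr zi]. simpl. split; ring. }
  assert (Hz0 : PSeries (fun _ => 0) = fun _ => 0).
  { apply FunctionalExtensionality.functional_extensionality. intros x. apply PSeries_const_0. }
  constructor.
  - intros z. exact (solves_rsol _ _ _ _ (proj1 (Ha z))).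
  - intros z x Hx. refine (conj _ (conj _ (conj _ _)));
      (evar_last; [apply @is_derive_const|]; unfold zero; simpl; ring).
  - intros z. destruct (with_head_entire (1 :: nil) a z) as [E1 E2].
    + intros x Hx. destruct (Ha z) as [_ Hs]. destruct (Hs x Hx) as (s & Hs1 & _). now exists s.
    + repeat split; auto; exact entire_zero.
  - intros z x Hx. rewrite Rmult_0_l, Rplus_0_l. now apply Hp.
  - intros z x Hx. rewrite Rmult_0_l, Rplus_0_l. now apply Hp.
  - intros z x Hx. change (re_seq (fun _ _ => RtoC 0) z) with (fun _ : nat => 0).
    rewrite Hz0. ring.
  - intros z x Hx. change (im_seq (fun _ _ => RtoC 0) z) with (fun _ : nat => 0).
    rewrite Hz0. ring.
Qed.

Lemma wronski_const_ne : w <> 0.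
Proof.
  unfold w, wronski_const. destruct (Req_EM_T (nu qs) 0); lra.
Qed.

Lemma Cdiv_parts (A t : C) : t = (A / RtoC w)%C -> w * Re t = Re A /\ w * Im t = Im A.
Proof.
  intros E. assert (HA : A = (RtoC w * t)%C).
  { rewrite E. field. intros H. apply wronski_const_ne. now injection H. }
  rewrite HA. destruct t as [tr ti]. simpl. split; ring.
Qed.

(** Merges the three clauses of [frobenius_theta]: the head c is 0 for nu = 0 and 1 otherwise, [K]
    is [nil] without a logarithm, and k is the difference [2 nu] of the exponents when a logarithm
    may occur. *)
Lemma theta_expansion : exists (K c : list R) (k : nat) (d : nat -> list R),
  (nu qs = 0 -> c = nil /\ K = 1 :: nil /\ k = 0%nat) /\
  (nu qs <> 0 -> c = 1 :: nil) /\
  (K = nil \/ 2 * nu qs = INR k) /\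
  forall z, (entire (re_seq (with_head c d) z) /\ entire (im_seq (with_head c d) z)) /\
  forall x, 0 < x ->
    w * Re (theta x z) = Re (peval K z * phi x z) * ln x +
      Rpower x (/ 2 - nu qs) * PSeries (re_seq (with_head c d) z) x /\
    w * Im (theta x z) = Im (peval K z * phi x z) * ln x +
      Rpower x (/ 2 - nu qs) * PSeries (im_seq (with_head c d) z) x.
Proof.
  destruct Htheta as [_ (K & d & Hd)].
  assert (He : forall c z, entire (re_seq (with_head c d) z) /\ entire (im_seq (with_head c d) z)).
  { intros c z. apply with_head_entire. intros x Hx.
    destruct (Hd z x Hx) as (s & Hs & _). now exists s. }
  assert (Hsum : forall c z x s, is_series (K := C_AbsRing) (V := C_NormedModule)
    (fun n => (peval (d n) z * RtoC (x ^ (n + 1)))%C) s ->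
    PSeries (re_seq (with_head c d) z) x = Re (peval c z) + Re s /\
    PSeries (im_seq (with_head c d) z) x = Im (peval c z) + Im s).
  { intros c z x s Hs. destruct (with_head_sum c d z x s Hs) as [P1 P2].
    split; now apply is_pseries_unique. }
  destruct (Req_EM_T (nu qs) 0) as [Hn|Hn];
    [|destruct (classic (exists k : nat, 2 * nu qs = INR k)) as [[k Hk]|Hk]].
  - exists (1 :: nil), nil, 0%nat, d.
    refine (conj _ (conj _ (conj _ _))); [auto | lra | right; simpl; lra |].
    intros z. split; [apply He|]. intros x Hx.
    destruct (Hd z x Hx) as (s & Hs & H0 & _ & _). destruct (Hsum nil z x s Hs) as [P1 P2].
    rewrite P1, P2, Hn, Rminus_0_r. destruct (Cdiv_parts _ _ (H0 Hn)) as [Q1 Q2].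
    rewrite Q1, Q2. destruct (phi x z) as [pr pi], s as [sr si], z as [zr zi].
    simpl. split; ring.
  - exists K, (1 :: nil), k, d.
    refine (conj _ (conj _ (conj _ _))); [intros; lra | auto | auto |].
    intros z. split; [apply He|]. intros x Hx.
    destruct (Hd z x Hx) as (s & Hs & _ & H1 & _).
    destruct (Hsum (1 :: nil) z x s Hs) as [P1 P2]. rewrite P1, P2.
    destruct (Cdiv_parts _ _ (H1 Hn (ex_intro _ k Hk))) as [Q1 Q2]. rewrite Q1, Q2.
    destruct (phi x z) as [pr pi], s as [sr si], (peval K z) as [kr ki], z as [zr zi].
    simpl. split; ring.
  - exists nil, (1 :: nil), 0%nat, d.
    refine (conj _ (conj _ (conj _ _))); [intros; lra | auto | auto |].
    intros z. split; [apply He|]. intros x Hx.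
    destruct (Hd z x Hx) as (s & Hs & _ & _ & H2).
    destruct (Hsum (1 :: nil) z x s Hs) as [P1 P2]. rewrite P1, P2.
    destruct (Cdiv_parts _ _ (H2 Hk)) as [Q1 Q2]. rewrite Q1, Q2.
    destruct (phi x z) as [pr pi], s as [sr si], z as [zr zi].
    simpl. split; ring.
Qed.

(** The logarithm multiplies [K phi], whose exponent [1/2 + nu] lies k steps above the exponent
    [1/2 - nu] of theta; hence the factor [x ^ k] in the family. *)
Lemma theta_family : exists (K c : list R) (k : nat) (a d : nat -> list R),
  (nu qs = 0 -> c = nil /\ K = 1 :: nil /\ k = 0%nat) /\
  (nu qs <> 0 -> c = 1 :: nil) /\
  (K = nil \/ 2 * nu qs = INR k) /\
  frobenius_family qs (/ 2 + nu qs) 0 (with_head (1 :: nil) a)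
    (fun _ _ => RtoC 0) (fun x z => Re (phi x z)) (fun x z => Im (phi x z))
    (fun x z => Re (dphi x z)) (fun x z => Im (dphi x z))
    (fun _ _ => 0) (fun _ _ => 0) (fun _ _ => 0) (fun _ _ => 0) /\
  frobenius_family qs (/ 2 - nu qs) k (with_head c d)
    (fun n z => (peval K z * with_head (1 :: nil) a n z)%C)
    (fun x z => w * Re (theta x z)) (fun x z => w * Im (theta x z))
    (fun x z => w * Re (dtheta x z)) (fun x z => w * Im (dtheta x z))
    (fun x z => Re (peval K z) * Re (phi x z) - Im (peval K z) * Im (phi x z))
    (fun x z => Re (peval K z) * Im (phi x z) + Im (peval K z) * Re (phi x z))
    (fun x z => Re (peval K z) * Re (dphi x z) - Im (peval K z) * Im (dphi x z))
    (fun x z => Re (peval K z) * Im (dphi x z) + Im (peval K z) * Re (dphi x z)).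
Proof.
  destruct phi_family as [a Ha]. destruct theta_expansion as (K & c & k & d & H1 & H2 & H3 & H4).
  exists K, c, k, a, d. split; [exact H1|]. split; [exact H2|]. split; [exact H3|].
  split; [exact Ha|].
  assert (Hpow : forall x, 0 < x -> K <> nil ->
    Rpower x (/ 2 + nu qs) = Rpower x (/ 2 - nu qs) * x ^ k).
  { intros x Hx HKn. destruct H3 as [H3|H3]; [contradiction|].
    rewrite <- Rpower_pow by exact Hx. rewrite <- Rpower_plus. f_equal. lra. }
  pose proof Ha as [As Al Ae Are Aim _ _].
  set (u := with_head (1 :: nil) a) in *.
  assert (Hlin : forall z, entire (re_seq (fun n z => (peval K z * u n z)%C) z) /\
    entire (im_seq (fun n z => (peval K z * u n z)%C) z) /\ forall x,
    PSeries (re_seq (fun n z => (peval K z * u n z)%C) z) x =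
      Re (peval K z) * PSeries (re_seq u z) x - Im (peval K z) * PSeries (im_seq u z) x /\
    PSeries (im_seq (fun n z => (peval K z * u n z)%C) z) x =
      Re (peval K z) * PSeries (im_seq u z) x + Im (peval K z) * PSeries (re_seq u z) x).
  { intros z. destruct (Ae z) as (E1 & E2 & _).
    set (kr := Re (peval K z)). set (ki := Im (peval K z)).
    assert (X1 : forall n, PS_plus (PS_scal kr (re_seq u z)) (PS_scal (- ki) (im_seq u z)) n
      = re_seq (fun n z => (peval K z * u n z)%C) z n).
    { intros n. change (kr * re_seq u z n + - ki * im_seq u z n = kr * re_seq u z n - ki * im_seq u z n).
      ring. }
    assert (X2 : forall n, PS_plus (PS_scal kr (im_seq u z)) (PS_scal ki (re_seq u z)) n
      = im_seq (fun n z => (peval K z * u n z)%C) z n) by reflexivity.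
    split; [|split].
    - apply (entire_ext _ _ X1). apply entire_plus; now apply entire_scal.
    - apply (entire_ext _ _ X2). apply entire_plus; now apply entire_scal.
    - intros x. rewrite <- (PSeries_ext _ _ x X1), <- (PSeries_ext _ _ x X2).
      rewrite !PSeries_plus, !PSeries_scal
        by (apply entire_ex_pseries; now apply entire_scal). split; ring. }
  constructor.
  - intros z. pose proof (solves_rsol _ _ _ _ (proj1 Htheta z)) as Hs.
    apply (rsol_scal _ _ _ _ _ _ _ w 0) in Hs. intros x Hx.
    destruct (Hs x Hx) as (S1 & S2 & S3 & S4).
    refine (conj _ (conj _ (conj _ _))).
    + eapply is_derive_ext; [|evar_last; [exact S1|]]; [intros t|]; simpl; ring.
    + eapply is_derive_ext; [|evar_last; [exact S2|]]; [intros t|]; simpl; ring.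
    + eapply is_derive_ext; [|evar_last; [exact S3|]]; [intros t|]; simpl; ring.
    + eapply is_derive_ext; [|evar_last; [exact S4|]]; [intros t|]; simpl; ring.
  - intros z. apply (rsol_scal _ _ _ _ _ _ _ (Re (peval K z)) (Im (peval K z)) (As z)).
  - intros z. destruct (H4 z) as [[E1 E2] _]. destruct (Hlin z) as (E3 & E4 & _). auto.
  - intros z x Hx. exact (proj1 (proj2 (H4 z) x Hx)).
  - intros z x Hx. exact (proj2 (proj2 (H4 z) x Hx)).
  - intros z x Hx. destruct (Hlin z) as (_ & _ & L). rewrite (proj1 (L x)).
    rewrite (Are z x Hx), (Aim z x Hx).
    destruct (list_eq_dec Req_EM_T K nil) as [->|HKn]; [simpl; ring|].
    rewrite (Hpow x Hx HKn). ring.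
  - intros z x Hx. destruct (Hlin z) as (_ & _ & L). rewrite (proj2 (L x)).
    rewrite (Are z x Hx), (Aim z x Hx).
    destruct (list_eq_dec Req_EM_T K nil) as [->|HKn]; [simpl; ring|].
    rewrite (Hpow x Hx HKn). ring.
Qed.

End Frobenius.

(** * Continuity, reality and Wronskian of phi and theta *)

Lemma rsol_wronskian q l e a b c d a' b' c' d' x :
  rsol q l e a b c d -> rsol q l e a' b' c' d' -> 0 < x ->
  is_derive (fun x => a x * c' x - b x * d' x - (c x * a' x - d x * b' x)) x 0 /\
  is_derive (fun x => a x * d' x + b x * c' x - (c x * b' x + d x * a' x)) x 0.
Proof.
  intros H H' Hx. destruct (H x Hx) as (H1 & H2 & H3 & H4).
  destruct (H' x Hx) as (H5 & H6 & H7 & H8). split; der; ring.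
Qed.

Section Frobenius_values.

Variables (qs : nat -> R) (phi dphi theta dtheta : R -> C -> C).
Hypothesis Hconv : forall x, 0 < x -> ex_series (fun n => qs (n + 2)%nat * x ^ n).
Hypothesis Hq0 : - / 4 <= qs 0%nat.
Hypothesis Hphi : frobenius_phi qs phi dphi.
Hypothesis Htheta : frobenius_theta qs phi theta dtheta.

Let w := wronski_const qs.

Lemma frobenius_limits {T : Type} {F : (T -> Prop) -> Prop} {PF : ProperFilter F}
  (z : T -> C) (z0 : C) :
  filterlim (fun t => Re (z t)) F (locally (Re z0)) ->
  filterlim (fun t => Im (z t)) F (locally (Im z0)) ->
  forall f, f = phi \/ f = dphi \/ f = theta \/ f = dtheta ->
  filterlim (fun t => Re (f 1 (z t))) F (locally (Re (f 1 z0))) /\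
  filterlim (fun t => Im (f 1 (z t))) F (locally (Im (f 1 z0))).
Proof.
  intros Hzr Hzi.
  destruct (theta_family qs phi dphi theta dtheta Hphi Htheta)
    as (K & c & k & a & d & _ & _ & _ & Fp & Ft).
  pose proof (nu_sq qs Hq0) as Hnu.
  assert (G0 : locally_geometric (fun _ _ => RtoC 0)).
  { intros B. exists 1. split; [lra|]. intros n z' _. unfold re_seq, im_seq. simpl.
    rewrite Rabs_R0. lra. }
  assert (Gp : locally_geometric (with_head (1 :: nil) a)).
  { apply (family_bound _ _ _ _ _ _ _ _ _ _ _ _ _ Hconv) with (2 := Fp).
    - lra.
    - apply with_head_peval.
    - exact G0. }
  assert (Gt : locally_geometric (with_head c d)).
  { apply (family_bound _ _ _ _ _ _ _ _ _ _ _ _ _ Hconv) with (2 := Ft).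
    - lra.
    - apply with_head_peval.
    - intros B. destruct (Gp B) as (M & HM & HpM). destruct (peval_bound K B) as (N & HN & HKN).
      exists (1 + 2 * N * M). split; [nra|]. intros n z' Hz'.
      specialize (HpM n z' Hz'). destruct (HKN z' Hz') as [N1 N2].
      unfold re_seq, im_seq in *. destruct (peval K z') as [kr ki].
      destruct (with_head (1 :: nil) a n z') as [ur ui]. simpl in *.
      assert (H4 : 0 < 4 ^ n) by (apply pow_lt; lra).
      apply (Rle_trans _ (2 * N * ((Rabs ur + Rabs ui) * 4 ^ n))); [|nra].
      rewrite <- Rmult_assoc. apply Rmult_le_compat_r; [lra|].
      assert (Hm : forall s t, Rabs s <= N -> Rabs (s * t) <= N * Rabs t).
      { intros s t Hs. rewrite Rabs_mult. apply Rmult_le_compat_r; [apply Rabs_pos | exact Hs]. }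
      pose proof (Hm kr ur N1). pose proof (Hm kr ui N1).
      pose proof (Hm ki ur N2). pose proof (Hm ki ui N2).
      pose proof (Rabs_triang (kr * ur) (- (ki * ui))) as T1. rewrite Rabs_Ropp in T1.
      pose proof (Rabs_triang (kr * ui) (ki * ur)). unfold Rminus. lra. }
  destruct (family_limits z z0 Hzr Hzi _ _ _ _ _ _ _ _ _ _ _ _ _ Fp (with_head_peval _ _) Gp
    (filterlim_Rconst 0) (filterlim_Rconst 0)) as (P1 & P2 & P3 & P4).
  destruct (filterlim_peval K z z0 Hzr Hzi) as [K1 K2].
  destruct (family_limits z z0 Hzr Hzi _ _ _ _ _ _ _ _ _ _ _ _ _ Ft (with_head_peval _ _) Gt)
    as (T1 & T2 & T3 & T4).
  { apply filterlim_Rminus; now apply filterlim_Rmult. }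
  { apply filterlim_Rplus; now apply filterlim_Rmult. }
  assert (Hdiv : forall (f : C -> R), filterlim (fun t => w * f (z t)) F (locally (w * f z0)) ->
    filterlim (fun t => f (z t)) F (locally (f z0))).
  { intros f Hf. pose proof (wronski_const_ne qs) as Hw. fold w in Hw.
    replace (f z0) with (/ w * (w * f z0)) by (field; exact Hw).
    apply (filterlim_ext (fun t => / w * (w * f (z t)))); [intros t; field; exact Hw|].
    apply filterlim_Rmult; [apply filterlim_Rconst | exact Hf]. }
  intros f [-> | [-> | [-> | ->]]]; split; auto.
  - exact (Hdiv (fun z => Re (theta 1 z)) T1).
  - exact (Hdiv (fun z => Im (theta 1 z)) T2).
  - exact (Hdiv (fun z => Re (dtheta 1 z)) T3).
  - exact (Hdiv (fun z => Im (dtheta 1 z)) T4).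
Qed.

Lemma derive_zero_pos (f : R -> R) (x l : R) :
  (forall t, 0 < t -> f t = 0) -> 0 < x -> is_derive f x l -> l = 0.
Proof.
  intros Hf Hx Hd. apply (is_derive_unique_pos f (fun _ => 0) x l 0 Hf Hx Hd).
  apply @is_derive_const.
Qed.

(** The polynomials have real coefficients, so their values at a real parameter are real; the
    derivatives inherit this, the imaginary parts vanishing identically on x > 0. *)
Lemma frobenius_real (lam x : R) : 0 < x ->
  Im (phi x (RtoC lam)) = 0 /\ Im (dphi x (RtoC lam)) = 0 /\
  Im (theta x (RtoC lam)) = 0 /\ Im (dtheta x (RtoC lam)) = 0.
Proof.
  intros Hx0.
  destruct (theta_family qs phi dphi theta dtheta Hphi Htheta)
    as (K & c & k & a & d & _ & _ & _ & Fp & Ft).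
  assert (Hz : forall c a x, PSeries (im_seq (with_head c a) (RtoC lam)) x = 0).
  { intros c' a' y. rewrite <- (PSeries_const_0 y). apply PSeries_ext. intros n.
    unfold im_seq, with_head. destruct n; apply peval_real. }
  assert (Hp : forall t, 0 < t -> Im (phi t (RtoC lam)) = 0).
  { intros t Ht. rewrite (ff_im _ _ _ _ _ _ _ _ _ _ _ _ _ Fp _ t Ht), Hz. ring. }
  pose proof (wronski_const_ne qs) as Hw. fold w in Hw.
  assert (Ht : forall t, 0 < t -> Im (theta t (RtoC lam)) = 0).
  { intros t Ht. pose proof (ff_im _ _ _ _ _ _ _ _ _ _ _ _ _ Ft (RtoC lam) t Ht) as E.
    cbv beta in E. rewrite Hz, peval_real, (Hp t Ht) in E.
    apply (Rmult_eq_reg_l w); [|exact Hw]. fold w in E. rewrite E. ring. }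
  refine (conj (Hp x Hx0) (conj _ (conj (Ht x Hx0) _))).
  - apply (derive_zero_pos _ x _ Hp Hx0).
    apply (ff_sol _ _ _ _ _ _ _ _ _ _ _ _ _ Fp (RtoC lam) x Hx0).
  - assert (w * Im (dtheta x (RtoC lam)) = 0).
    { apply (derive_zero_pos (fun t => w * Im (theta t (RtoC lam))) x).
      - intros t Ht'. rewrite (Ht t Ht'). ring.
      - exact Hx0.
      - apply (ff_sol _ _ _ _ _ _ _ _ _ _ _ _ _ Ft (RtoC lam) x Hx0). }
    apply Rmult_integral in H. destruct H; [contradiction | assumption].
Qed.

Definition wronskian_re (f df g dg : R -> C -> C) (z : C) (x : R) : R :=
  Re (f x z) * Re (dg x z) - Im (f x z) * Im (dg x z)
  - (Re (df x z) * Re (g x z) - Im (df x z) * Im (g x z)).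

Definition wronskian_im (f df g dg : R -> C -> C) (z : C) (x : R) : R :=
  Re (f x z) * Im (dg x z) + Im (f x z) * Re (dg x z)
  - (Re (df x z) * Im (g x z) + Im (df x z) * Re (g x z)).

(** The Wronskian does not depend on x, so it equals its limit at 0+, where only leading
    coefficients survive. The terms in [ln x] cancel, as phi has zero Wronskian with [K phi];
    differentiating [ln x] leaves [K phi ^ 2 / x]. *)
Lemma frobenius_wronskian (z : C) (x : R) : 0 < x ->
  wronskian_re phi dphi theta dtheta z x = 1 /\ wronskian_im phi dphi theta dtheta z x = 0.
Proof.
  intros Hx0.
  destruct (theta_family qs phi dphi theta dtheta Hphi Htheta)
    as (K & c & k & a & d & Hc1 & Hc2 & HK & Fp & Ft).
  pose proof (wronski_const_ne qs) as Hw. fold w in Hw.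
  destruct (ff_ent _ _ _ _ _ _ _ _ _ _ _ _ _ Fp z) as (E1 & E2 & _).
  destruct (ff_ent _ _ _ _ _ _ _ _ _ _ _ _ _ Ft z) as (E3 & E4 & _).
  pose proof (ff_sol _ _ _ _ _ _ _ _ _ _ _ _ _ Fp z) as Sp.
  pose proof (ff_sol _ _ _ _ _ _ _ _ _ _ _ _ _ Ft z) as St.
  pose proof (ff_log _ _ _ _ _ _ _ _ _ _ _ _ _ Ft z) as Lt.
  pose proof (ff_re _ _ _ _ _ _ _ _ _ _ _ _ _ Fp z) as Pr.
  pose proof (ff_im _ _ _ _ _ _ _ _ _ _ _ _ _ Fp z) as Pi.
  pose proof (ff_re _ _ _ _ _ _ _ _ _ _ _ _ _ Ft z) as Tr.
  pose proof (ff_im _ _ _ _ _ _ _ _ _ _ _ _ _ Ft z) as Ti.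
  fold w in St, Tr, Ti.
  set (ur := re_seq (with_head (1 :: nil) a) z) in *.
  set (ui := im_seq (with_head (1 :: nil) a) z) in *.
  set (vr := re_seq (with_head c d) z) in *. set (vi := im_seq (with_head c d) z) in *.
  set (kr := Re (peval K z)) in *. set (ki := Im (peval K z)) in *.
  set (al := / 2 + nu qs) in *. set (be := / 2 - nu qs) in *.
  assert (Hconst : forall f, f = wronskian_re phi dphi theta dtheta z \/
      f = wronskian_im phi dphi theta dtheta z ->
    forall t, 0 < t -> f t = f x).
  { intros f Hf t Ht. apply constant_of_derive; [|exact Ht | exact Hx0].
    intros s Hs.
    pose proof (rsol_wronskian _ _ _ _ _ _ _ _ _ _ _ s Sp (solves_rsol _ _ _ _ (proj1 Htheta z))
      Hs) as [W1 W2].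
    destruct Hf as [-> | ->]; assumption. }
  (* [x^k K u^2 + (be - al) u v + x (u v' - u' v)] *)
  set (U := PSeries ur). set (U' := PSeries ui). set (V := PSeries vr). set (V' := PSeries vi).
  set (dU := PSeries (PS_derive ur)). set (dU' := PSeries (PS_derive ui)).
  set (dV := PSeries (PS_derive vr)). set (dV' := PSeries (PS_derive vi)).
  assert (Hform : forall t, 0 < t ->
    w * wronskian_re phi dphi theta dtheta z t =
      t ^ k * (kr * (U t * U t - U' t * U' t) - ki * (U t * U' t + U' t * U t))
      + (be - al) * (U t * V t - U' t * V' t)
      + t * (U t * dV t - U' t * dV' t - (dU t * V t - dU' t * V' t)) /\
    w * wronskian_im phi dphi theta dtheta z t =
      t ^ k * (kr * (U t * U' t + U' t * U t) + ki * (U t * U t - U' t * U' t))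
      + (be - al) * (U t * V' t + U' t * V t)
      + t * (U t * dV' t + U' t * dV t - (dU t * V' t + dU' t * V t))).
  { intros t Ht.
    pose proof (log_frobenius_derive al U dU (fun _ => 0) (fun _ => 0) _ _
      (fun s _ => is_derive_PSeries ur s (E1 s)) (fun s _ => @is_derive_const R_AbsRing R_NormedModule 0 s)
      Pr (fun s Hs => proj1 (Sp s Hs)) t Ht) as D1.
    pose proof (log_frobenius_derive al U' dU' (fun _ => 0) (fun _ => 0) _ _
      (fun s _ => is_derive_PSeries ui s (E2 s)) (fun s _ => @is_derive_const R_AbsRing R_NormedModule 0 s)
      Pi (fun s Hs => proj1 (proj2 (Sp s Hs))) t Ht) as D2.
    pose proof (log_frobenius_derive be V dV _ _ _ _
      (fun s _ => is_derive_PSeries vr s (E3 s)) (fun s Hs => proj1 (Lt s Hs))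
      Tr (fun s Hs => proj1 (St s Hs)) t Ht) as D3.
    pose proof (log_frobenius_derive be V' dV' _ _ _ _
      (fun s _ => is_derive_PSeries vi s (E4 s)) (fun s Hs => proj1 (proj2 (Lt s Hs)))
      Ti (fun s Hs => proj1 (proj2 (St s Hs))) t Ht) as D4.
    specialize (Pr t Ht). specialize (Pi t Ht). specialize (Tr t Ht). specialize (Ti t Ht).
    cbv beta in *. fold kr ki in D3, D4, Tr, Ti. fold U in Pr. fold U' in Pi. fold V in Tr. fold V' in Ti.
    set (p := Rpower t al) in *. set (r := Rpower t be) in *.
    assert (Hpr : p * r = t).
    { unfold p, r. rewrite <- Rpower_plus. unfold al, be.
      replace (/ 2 + nu qs + (/ 2 - nu qs)) with 1 by lra. now apply Rpower_1. }
    assert (Hpp : K = nil \/ p = r * t ^ k).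
    { destruct HK as [HK|HK]; [now left | right]. unfold p, r, al, be.
      rewrite <- Rpower_pow by exact Ht. rewrite <- Rpower_plus. f_equal. lra. }
    (* [p * p] is replaced by [t * t ^ k] only under the factor K, since the exponents need not
       differ by k when [K = nil]. *)
    assert (Hpk : kr * (p * p) = kr * (t * t ^ k) /\ ki * (p * p) = ki * (t * t ^ k)).
    { destruct Hpp as [->|Hpp].
      - unfold kr, ki. simpl. split; ring.
      - rewrite Hpp at 2 4. rewrite <- !Hpr. split; ring. }
    rewrite Rmult_0_l, Rplus_0_l in Pr, Pi.
    replace (0 * ln t + 0 / t) with 0 in D1, D2 by (field; lra).
    rewrite Rplus_0_l in D1, D2.
    unfold wronskian_re, wronskian_im.
    assert (Hnt : t <> 0) by lra.
    destruct Hpk as [Hk1 Hk2].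
    split.
    - transitivity (Re (phi t z) * (w * Re (dtheta t z)) - Im (phi t z) * (w * Im (dtheta t z))
        - (Re (dphi t z) * (w * Re (theta t z)) - Im (dphi t z) * (w * Im (theta t z)))); [ring|].
      rewrite D3, D4, Tr, Ti, D1, D2, Pr, Pi.
      transitivity (kr * (p * p) / t * (U t * U t - U' t * U' t)
        - ki * (p * p) / t * (U t * U' t + U' t * U t)
        + p * r / t * ((be - al) * (U t * V t - U' t * V' t)
        + t * (U t * dV t - U' t * dV' t - (dU t * V t - dU' t * V' t)))); [field; exact Hnt|].
      rewrite Hk1, Hk2, Hpr. field. exact Hnt.
    - transitivity (Re (phi t z) * (w * Im (dtheta t z)) + Im (phi t z) * (w * Re (dtheta t z))
        - (Re (dphi t z) * (w * Im (theta t z)) + Im (dphi t z) * (w * Re (theta t z)))); [ring|].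
      rewrite D3, D4, Tr, Ti, D1, D2, Pr, Pi.
      transitivity (kr * (p * p) / t * (U t * U' t + U' t * U t)
        + ki * (p * p) / t * (U t * U t - U' t * U' t)
        + p * r / t * ((be - al) * (U t * V' t + U' t * V t)
        + t * (U t * dV' t + U' t * dV t - (dU t * V' t + dU' t * V t)))); [field; exact Hnt|].
      rewrite Hk1, Hk2, Hpr. field. exact Hnt. }
  assert (Hu0 : ur 0%nat = 1 /\ ui 0%nat = 0).
  { unfold ur, ui, re_seq, im_seq, with_head. destruct z as [zr zi]. simpl. split; ring. }
  assert (Hv0 : vi 0%nat = 0).
  { unfold vi, im_seq, with_head. destruct (Req_EM_T (nu qs) 0) as [Hn|Hn].
    - destruct (Hc1 Hn) as (-> & _). reflexivity.
    - rewrite (Hc2 Hn). destruct z as [zr zi]. simpl. ring. }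
  (* [0 ^ k] is 1 only for k = 0. For nu = 0 the exponents agree and K = 1 supplies w = 1; for nu <>
     0 the K term vanishes (K = nil or k > 0) and the exponents supply [- 2 nu]. *)
  assert (Hfin : 0 ^ k * kr + (be - al) * vr 0%nat = w /\ 0 ^ k * ki = 0).
  { unfold kr, ki, vr, re_seq, with_head, w, wronski_const, al, be.
    destruct (Req_EM_T (nu qs) 0) as [Hn|Hn].
    - destruct (Hc1 Hn) as (-> & -> & ->). rewrite Hn. destruct z as [zr zi]. simpl. split; ring.
    - rewrite (Hc2 Hn).
      assert (H0 : 0 ^ k * Re (peval K z) = 0 /\ 0 ^ k * Im (peval K z) = 0).
      { destruct HK as [-> | HK]; [simpl; split; ring|].
        destruct k as [|k]; [simpl in HK; lra|]. simpl. split; ring. }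
      destruct H0 as [-> ->]. destruct z as [zr zi]. simpl. split; ring. }
  assert (Hlim : forall s, entire s -> filterlim (PSeries s) (at_right 0) (locally (s 0%nat)))
    by exact PSeries_0_at_right.
  assert (Hid : filterlim (fun t : R => t) (at_right 0) (locally 0)) by now apply filter_le_within.
  assert (Hpow : filterlim (fun t : R => t ^ k) (at_right 0) (locally (0 ^ k))).
  { clear - Hid. induction k as [|k IH]; simpl; [apply filterlim_Rconst | now apply filterlim_Rmult]. }
  pose proof (Hlim _ E1) as L1. pose proof (Hlim _ E2) as L2.
  pose proof (Hlim _ E3) as L3. pose proof (Hlim _ E4) as L4.
  pose proof (Hlim _ (entire_derive _ E1)) as M1. pose proof (Hlim _ (entire_derive _ E2)) as M2.
  pose proof (Hlim _ (entire_derive _ E3)) as M3. pose proof (Hlim _ (entire_derive _ E4)) as M4.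
  destruct Hu0 as [Hu1 Hu2]. rewrite Hu1 in L1. rewrite Hu2 in L2. rewrite Hv0 in L4.
  fold U in L1. fold U' in L2. fold V in L3. fold V' in L4.
  fold dU in M1. fold dU' in M2. fold dV in M3. fold dV' in M4.
  assert (Hloc : forall P : R -> Prop, (forall t, 0 < t -> P t) -> at_right 0 P).
  { intros P HP. exists (mkposreal 1 Rlt_0_1). intros t _ Ht. now apply HP. }
  split.
  - apply (Rmult_eq_reg_l w); [|exact Hw]. rewrite Rmult_1_r.
    apply (filterlim_locally_unique (F := at_right 0)
      (fun t => w * wronskian_re phi dphi theta dtheta z t)).
    + apply (filterlim_ext_loc (fun _ => w * wronskian_re phi dphi theta dtheta z x)).
      * apply Hloc. intros t Ht. f_equal. symmetry. apply Hconst; auto.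
      * apply filterlim_const.
    + apply (filterlim_ext_loc (fun t =>
        t ^ k * (kr * (U t * U t - U' t * U' t) - ki * (U t * U' t + U' t * U t))
        + (be - al) * (U t * V t - U' t * V' t)
        + t * (U t * dV t - U' t * dV' t - (dU t * V t - dU' t * V' t)))).
      * apply Hloc. intros t Ht. symmetry. now apply Hform.
      * evar_last;
          [repeat (apply filterlim_Rminus || apply filterlim_Rplus || apply filterlim_Rmult ||
            apply filterlim_Rconst || eassumption)|].
        destruct Hfin as [Hf1 Hf2]. apply f_equal.
        match goal with |- ?s = ?t => change (@eq R s t) end.
        transitivity (0 ^ k * kr + (be - al) * vr 0%nat); [unfold al, be; ring | exact Hf1].
  - apply (Rmult_eq_reg_l w); [|exact Hw]. rewrite Rmult_0_r.
    apply (filterlim_locally_unique (F := at_right 0)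
      (fun t => w * wronskian_im phi dphi theta dtheta z t)).
    + apply (filterlim_ext_loc (fun _ => w * wronskian_im phi dphi theta dtheta z x)).
      * apply Hloc. intros t Ht. f_equal. symmetry. apply Hconst; auto.
      * apply filterlim_const.
    + apply (filterlim_ext_loc (fun t =>
        t ^ k * (kr * (U t * U' t + U' t * U t) + ki * (U t * U t - U' t * U' t))
        + (be - al) * (U t * V' t + U' t * V t)
        + t * (U t * dV' t + U' t * dV t - (dU t * V' t + dU' t * V t)))).
      * apply Hloc. intros t Ht. symmetry. now apply Hform.
      * evar_last;
          [repeat (apply filterlim_Rminus || apply filterlim_Rplus || apply filterlim_Rmult ||
            apply filterlim_Rconst || eassumption)|].
        destruct Hfin as [Hf1 Hf2]. apply f_equal.
        match goal with |- ?s = ?t => change (@eq R s t) end.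
        transitivity (0 ^ k * ki); [unfold al, be; ring | exact Hf2].
Qed.

End Frobenius_values.

(** * The spectral density *)

Lemma Cmod_sq (z : C) : Cmod z ^ 2 = Re z ^ 2 + Im z ^ 2.
Proof.
  unfold Cmod. apply pow2_sqrt.
  apply Rplus_le_le_0_compat; apply pow2_ge_0.
Qed.

Lemma L2_solution_of_rsol (q : R -> R) (l e : R) (y dy : R -> C) (Fa : (R -> Prop) -> Prop) :
  ProperFilter Fa -> Fa (fun u => 0 < u <= 1) ->
  rsol q l e (fun x => Re (y x)) (fun x => Im (y x)) (fun x => Re (dy x)) (fun x => Im (dy x)) ->
  ex_RInt_gen (fun x => Cmod (y x) ^ 2) Fa (Rbar_locally p_infty) ->
  L2_solution q l e (fun x => Re (y x)) (fun x => Im (y x))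
    (fun x => Re (dy x)) (fun x => Im (dy x)).
Proof.
  intros PF HF Hs HI. split; [exact Hs|].
  destruct (RInt_gen_bounded_antiderivative _ Fa PF HF HI) as (H & B & HH & HB).
  - intros x Hx.
    apply (continuous_ext (normsq (fun x => Re (y x)) (fun x => Im (y x)))).
    + intros t. unfold normsq. symmetry. apply Cmod_sq.
    + apply (ex_derive_continuous (K := R_AbsRing) (V := R_NormedModule)).
      eexists. exact (is_derive_normsq _ _ _ _ _ _ _ Hs x Hx).
  - intros x. apply pow2_ge_0.
  - exists H, B. split; [|exact HB]. intros x Hx. unfold normsq.
    rewrite <- Cmod_sq. now apply HH.
Qed.

(* Real and imaginary part of the half-line Weyl function [y'/y]. *)
Definition weyl_re (a b c d : R -> R) (x : R) : R := cross a b c d x / normsq a b x.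
Definition weyl_im (a b c d : R -> R) (x : R) : R := flux a b c d x / normsq a b x.

Lemma normsq_pos_of_flux a b c d x : 0 < flux a b c d x -> 0 < normsq a b x.
Proof.
  intros Hf. destruct (Rle_lt_or_eq_dec _ _ (normsq_nonneg a b x)) as [H|H]; [exact H|].
  pose proof (cross_flux_sq a b c d x) as E. rewrite <- H in E.
  pose proof (pow2_ge_0 (cross a b c d x)). nra.
Qed.

Section Main.

Variables (qs : nat -> R) (phi dphi theta dtheta : R -> C -> C) (m : C -> C) (rho : R -> R)
  (P1 Q1 R1 : R -> R -> R) (astar bstar cstar : R -> R).
Hypothesis Hconv : forall x, 0 < x -> ex_series (fun n => qs (n + 2)%nat * x ^ n).
Hypothesis Hq0 : - / 4 <= qs 0%nat.
Hypothesis Hlim : is_lim (qfun qs) p_infty 0.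
Hypothesis Hab : exists x0, 0 < x0 /\
  (L1_at_infty (qfun qs) x0 \/
   (L1_at_infty (Derive (qfun qs)) x0 /\ AC_loc_from (qfun qs) x0)).
Hypothesis Hphi : frobenius_phi qs phi dphi.
Hypothesis Htheta : frobenius_theta qs phi theta dtheta.
Hypothesis Hm : forall lam : C, Im lam <> 0 -> forall x0, 0 < x0 ->
  L2_at_infty (fun x => (theta x lam - m lam * phi x lam)%C) x0.
Hypothesis HU : forall lam, 0 < lam ->
  appell_solution (qfun qs) lam (fun x => P1 x lam) (fun x => Q1 x lam) (fun x => R1 x lam) /\
  is_lim (fun x => P1 x lam) p_infty (sqrt lam) /\
  is_lim (fun x => Q1 x lam) p_infty 0 /\
  is_lim (fun x => R1 x lam) p_infty (/ sqrt lam).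

(** The alternative on q selects the scale: [kap = 0] with [w = q], or [kap = 1] with [w = q'],
    which is continuous because q is an entire series divided by [x ^ 2]. *)
Lemma U1_uniform_of_hypotheses l1 l2 dl : 0 < l1 -> 0 < dl <= 1 ->
  exists X C, 1 <= X /\ 0 < C /\ forall lam, l1 <= lam <= l2 ->
    (forall x, X <= x -> lam * R1 x lam ^ 2 <= 1 + dl /\ - (dl * lam) <= qfun qs x) /\
    (forall x, 1 <= x <= X -> P1 x lam + R1 x lam <= C).
Proof.
  intros Hl1 Hdl. destruct (is_derive_potential qs Hconv) as [dq Hdq].
  assert (Hqd : forall x, 0 < x -> is_derive (qfun qs) x (dq x)) by (intros x Hx; now apply Hdq).
  destruct Hab as (x0 & Hx0 & [HL | [HL _]]).
  - destruct (RInt_gen_lim (fun x => Rabs (qfun qs x)) x0 HL) as [L HL']. clear HL.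
    apply (U1_uniform (qfun qs) dq P1 Q1 R1 Hlim Hqd HU 0 (qfun qs)) with (x0 := x0) (L := L); auto.
    intros x Hx. apply (ex_derive_continuous (K := R_AbsRing) (V := R_NormedModule)).
    exists (dq x). now apply Hqd.
  - destruct (RInt_gen_lim (fun x => Rabs (Derive (qfun qs) x)) x0 HL) as [L HL']. clear HL.
    apply (U1_uniform (qfun qs) dq P1 Q1 R1 Hlim Hqd HU 1 (Derive (qfun qs)))
      with (x0 := x0) (L := L); auto.
    + right. split; [reflexivity|]. intros x Hx. apply is_derive_unique. now apply Hqd.
    + intros x Hx. eapply (continuous_ext_loc _ dq); [|now apply Hdq].
      exists (mkposreal x Hx). intros t Ht. symmetry. apply is_derive_unique, Hqd.
      apply Rabs_def2 in Ht. simpl in Ht. unfold minus, plus, opp in Ht; simpl in Ht. lra.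
Qed.

(** * The Weyl solution and its logarithmic derivative at 1 *)

Definition psi (z : C) (x : R) : C := (theta x z - m z * phi x z)%C.
Definition dpsi (z : C) (x : R) : C := (dtheta x z - m z * dphi x z)%C.
Definition psi_a (z : C) (x : R) : R := Re (psi z x).
Definition psi_b (z : C) (x : R) : R := Im (psi z x).
Definition psi_c (z : C) (x : R) : R := Re (dpsi z x).
Definition psi_d (z : C) (x : R) : R := Im (dpsi z x).

Lemma psi_L2 (z : C) : Im z <> 0 ->
  L2_solution (qfun qs) (Re z) (Im z) (psi_a z) (psi_b z) (psi_c z) (psi_d z).
Proof.
  intros Hz.
  assert (Hr : rsol (qfun qs) (Re z) (Im z) (psi_a z) (psi_b z) (psi_c z) (psi_d z)).
  { destruct Hphi as [a Ha]. pose proof (solves_rsol _ _ _ _ (proj1 (Ha z))) as Sp.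
    pose proof (solves_rsol _ _ _ _ (proj1 Htheta z)) as St.
    apply (rsol_scal _ _ _ _ _ _ _ (- Re (m z)) (- Im (m z))) in Sp.
    pose proof (rsol_plus _ _ _ _ _ _ _ _ _ _ _ St Sp) as S. intros x Hx.
    destruct (S x Hx) as (S1 & S2 & S3 & S4).
    unfold psi_a, psi_b, psi_c, psi_d, psi, dpsi.
    refine (conj _ (conj _ (conj _ _))).
    + eapply is_derive_ext; [|evar_last; [exact S1|]]; [intros t|]; unfold Re, Im; simpl; ring.
    + eapply is_derive_ext; [|evar_last; [exact S2|]]; [intros t|]; unfold Re, Im; simpl; ring.
    + eapply is_derive_ext; [|evar_last; [exact S3|]]; [intros t|]; unfold Re, Im; simpl; ring.
    + eapply is_derive_ext; [|evar_last; [exact S4|]]; [intros t|]; unfold Re, Im; simpl; ring. }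
  apply (L2_solution_of_rsol _ _ _ (psi z) (dpsi z) (at_point 1)); [exact _ | | exact Hr |].
  - unfold at_point. lra.
  - exact (Hm z Hz 1 Rlt_0_1).
Qed.

Lemma psi_wronskian (z : C) (x : R) : 0 < x ->
  Re (phi x z) * psi_c z x - Im (phi x z) * psi_d z x
    - (Re (dphi x z) * psi_a z x - Im (dphi x z) * psi_b z x) = 1 /\
  Re (phi x z) * psi_d z x + Im (phi x z) * psi_c z x
    - (Re (dphi x z) * psi_b z x + Im (dphi x z) * psi_a z x) = 0.
Proof.
  intros Hx.
  destruct (frobenius_wronskian qs phi dphi theta dtheta Hphi Htheta z x Hx) as [W1 W2].
  rewrite <- W1, <- W2. unfold wronskian_re, wronskian_im, psi_a, psi_b, psi_c, psi_d, psi, dpsi.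
  unfold Re, Im. simpl. split; ring.
Qed.

Lemma psi_nontrivial (z : C) (x : R) : 0 < x ->
  0 < normsq (psi_a z) (psi_b z) x + normsq (psi_c z) (psi_d z) x.
Proof.
  intros Hx. destruct (psi_wronskian z x Hx) as [W1 _].
  pose proof (normsq_nonneg (psi_a z) (psi_b z) x) as N1.
  pose proof (normsq_nonneg (psi_c z) (psi_d z) x) as N2.
  apply Rnot_le_lt. intros Hle. unfold normsq in *.
  pose proof (pow2_ge_0 (psi_a z x)). pose proof (pow2_ge_0 (psi_b z x)).
  pose proof (pow2_ge_0 (psi_c z x)). pose proof (pow2_ge_0 (psi_d z x)).
  assert (E1 : psi_a z x = 0) by (apply Rsqr_0_uniq; unfold Rsqr; lra).
  assert (E2 : psi_b z x = 0) by (apply Rsqr_0_uniq; unfold Rsqr; lra).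
  assert (E3 : psi_c z x = 0) by (apply Rsqr_0_uniq; unfold Rsqr; lra).
  assert (E4 : psi_d z x = 0) by (apply Rsqr_0_uniq; unfold Rsqr; lra).
  rewrite E1, E2, E3, E4 in W1. lra.
Qed.

Definition Mre (z : C) : R := weyl_re (psi_a z) (psi_b z) (psi_c z) (psi_d z) 1.
Definition Mim (z : C) : R := weyl_im (psi_a z) (psi_b z) (psi_c z) (psi_d z) 1.

Lemma psi_flux_pos (z : C) : 0 < Im z ->
  0 < flux (psi_a z) (psi_b z) (psi_c z) (psi_d z) 1 /\ 0 < normsq (psi_a z) (psi_b z) 1 /\
  0 < Mim z.
Proof.
  intros Hz.
  assert (Hf : 0 < flux (psi_a z) (psi_b z) (psi_c z) (psi_d z) 1).
  { apply (flux_pos (qfun qs) Hlim (Re z) (Im z)); auto.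
    - apply psi_L2. lra.
    - intros y Hy. now apply psi_nontrivial.
    - lra. }
  pose proof (normsq_pos_of_flux _ _ _ _ _ Hf).
  split; [exact Hf|]. split; [assumption|]. now apply Rdiv_lt_0_compat.
Qed.

(* [m = N / D] with [N = theta' - M theta], [D = phi' - M phi] at the point 1. *)
Definition mob_re (f df : R -> C -> C) (z : C) (Mr Mi : R) : R :=
  Re (df 1 z) - (Mr * Re (f 1 z) - Mi * Im (f 1 z)).
Definition mob_im (f df : R -> C -> C) (z : C) (Mr Mi : R) : R :=
  Im (df 1 z) - (Mr * Im (f 1 z) + Mi * Re (f 1 z)).
Definition mob (z : C) (Mr Mi : R) : R :=
  (mob_im theta dtheta z Mr Mi * mob_re phi dphi z Mr Mi
   - mob_re theta dtheta z Mr Mi * mob_im phi dphi z Mr Mi)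
  * / (mob_re phi dphi z Mr Mi * mob_re phi dphi z Mr Mi
       + mob_im phi dphi z Mr Mi * mob_im phi dphi z Mr Mi).

(** Solving [psi' = M psi] at 1 for m gives the quotient; its denominator cannot vanish since
    [(phi' - M phi) psi = - 1], minus the Wronskian. *)
Lemma Im_m (z : C) : 0 < Im z ->
  mob_re phi dphi z (Mre z) (Mim z) * mob_re phi dphi z (Mre z) (Mim z)
    + mob_im phi dphi z (Mre z) (Mim z) * mob_im phi dphi z (Mre z) (Mim z) <> 0 /\
  Im (m z) = mob z (Mre z) (Mim z).
Proof.
  intros Hz. destruct (psi_flux_pos z Hz) as (_ & Hn & _).
  destruct (psi_wronskian z 1 Rlt_0_1) as [W1 W2].
  assert (E1 : psi_c z 1 = Mre z * psi_a z 1 - Mim z * psi_b z 1).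
  { unfold Mre, Mim, weyl_re, weyl_im, cross, flux. unfold normsq in *. field. lra. }
  assert (E2 : psi_d z 1 = Mre z * psi_b z 1 + Mim z * psi_a z 1).
  { unfold Mre, Mim, weyl_re, weyl_im, cross, flux. unfold normsq in *. field. lra. }
  unfold mob.
  assert (F1 : mob_re theta dtheta z (Mre z) (Mim z) =
    Re (m z) * mob_re phi dphi z (Mre z) (Mim z) - Im (m z) * mob_im phi dphi z (Mre z) (Mim z)).
  { unfold mob_re, mob_im.
    unfold psi_a, psi_b, psi_c, psi_d, psi, dpsi in E1.
    unfold Re, Im in *. simpl in E1. lra. }
  assert (F2 : mob_im theta dtheta z (Mre z) (Mim z) =
    Re (m z) * mob_im phi dphi z (Mre z) (Mim z) + Im (m z) * mob_re phi dphi z (Mre z) (Mim z)).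
  { unfold mob_re, mob_im.
    unfold psi_a, psi_b, psi_c, psi_d, psi, dpsi in E2.
    unfold Re, Im in *. simpl in E2. lra. }
  assert (D1 : mob_re phi dphi z (Mre z) (Mim z) * psi_a z 1
    - mob_im phi dphi z (Mre z) (Mim z) * psi_b z 1 = - 1).
  { rewrite E1, E2 in W1. unfold mob_re, mob_im. lra. }
  set (Dr := mob_re phi dphi z (Mre z) (Mim z)) in *.
  set (Di := mob_im phi dphi z (Mre z) (Mim z)) in *.
  assert (HD : Dr * Dr + Di * Di <> 0).
  { intros H0. assert (H1 : Dr = 0) by nra. assert (H2 : Di = 0) by nra.
    rewrite H1, H2 in D1. lra. }
  split; [exact HD|]. rewrite F1, F2. field. exact HD.
Qed.

(** The Wronskian of two Weyl solutions is [psi1 psi2 (M2 - M1)]. The weight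
    [u + i v = (s + i t) psi1 psi2] extracts the component of [M2 - M1] along the unit vector (s,
    t), and [tau = |psi2| ^ 2] turns both flux terms into [|psi1| ^ 2 |psi2| ^ 2] times [Mim]. *)
Lemma weyl_lipschitz (z1 z2 : C) (s t : R) :
  0 < Re z1 -> 0 < Re z2 -> 0 < Im z1 -> Im z2 = Im z1 -> s ^ 2 + t ^ 2 = 1 ->
  s * (Mre z2 - Mre z1) + t * (Mim z2 - Mim z1)
    <= Rabs (Re z1 - Re z2) / (2 * Im z1) * (Mim z1 + Mim z2).
Proof.
  intros Hr1 Hr2 He He2 Hst.
  destruct (psi_flux_pos z1 He) as (_ & Hn1 & _).
  destruct (psi_flux_pos z2 ltac:(lra)) as (_ & Hn2 & _).
  pose proof (psi_L2 z1 ltac:(lra)) as L1. pose proof (psi_L2 z2 ltac:(lra)) as L2.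
  rewrite He2 in L2.
  set (A := psi_a z1 1 * psi_a z2 1 - psi_b z1 1 * psi_b z2 1).
  set (B := psi_a z1 1 * psi_b z2 1 + psi_b z1 1 * psi_a z2 1).
  pose proof (wronskian_flux_bound (qfun qs) P1 Q1 R1 Hlim HU (Re z1) (Re z2) (Im z1)
    _ _ _ _ _ _ _ _ (s * A - t * B) (s * B + t * A) (normsq (psi_a z2) (psi_b z2) 1) 1
    Hr1 Hr2 He Hn2 Rlt_0_1 L1 L2) as Hb.
  replace ((s * A - t * B) ^ 2 + (s * B + t * A) ^ 2) with
    (normsq (psi_a z1) (psi_b z1) 1 * normsq (psi_a z2) (psi_b z2) 1) in Hb.
  - apply (Rmult_le_reg_l (normsq (psi_a z1) (psi_b z1) 1 * normsq (psi_a z2) (psi_b z2) 1));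
      [now apply Rmult_lt_0_compat|].
    set (K := Rabs (Re z1 - Re z2) / (2 * Im z1)) in *.
    match type of Hb with ?l <= ?r =>
      replace (_ * (s * (Mre z2 - Mre z1) + t * (Mim z2 - Mim z1))) with l;
      [replace (_ * (K * (Mim z1 + Mim z2))) with r; [exact Hb|]|] end.
    + unfold Mim, weyl_im. field. split; lra.
    + unfold A, B, Mre, Mim, weyl_re, weyl_im, cross, flux. unfold normsq in *.
      field. split; lra.
  - transitivity ((s ^ 2 + t ^ 2) * (normsq (psi_a z1) (psi_b z1) 1 * normsq (psi_a z2) (psi_b z2) 1));
      [rewrite Hst; ring|]. unfold A, B, normsq. ring.
Qed.

Lemma weyl_continuous (mu0 e : R) : 0 < mu0 -> 0 < e ->
  filterlim (fun mu => Mre (cpt mu e)) (locally mu0) (locally (Mre (cpt mu0 e))) /\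
  filterlim (fun mu => Mim (cpt mu e)) (locally mu0) (locally (Mim (cpt mu0 e))).
Proof.
  intros Hmu He.
  destruct (psi_flux_pos (cpt mu0 e) He) as (_ & _ & Hi0).
  set (I0 := Mim (cpt mu0 e)) in *.
  assert (Hb : forall eps : posreal, locally mu0 (fun mu =>
    Rabs (Mre (cpt mu e) - Mre (cpt mu0 e)) < eps /\ Rabs (Mim (cpt mu e) - I0) < eps)).
  { intros eps. set (del := Rmin mu0 (Rmin e (e * eps / (4 * I0)))).
    assert (Hdel : 0 < del).
    { unfold del. repeat apply Rmin_glb_lt; auto. apply Rdiv_lt_0_compat; [|lra].
      apply Rmult_lt_0_compat; [lra | apply eps]. }
    exists (mkposreal del Hdel). intros mu Hball.
    change (Rabs (mu - mu0) < del) in Hball.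
    assert (B1 : Rabs (mu - mu0) < mu0) by (eapply Rlt_le_trans; [exact Hball | apply Rmin_l]).
    assert (B2 : Rabs (mu - mu0) < e)
      by (eapply Rlt_le_trans; [exact Hball | eapply Rle_trans; [apply Rmin_r | apply Rmin_l]]).
    assert (B3 : Rabs (mu - mu0) < e * eps / (4 * I0))
      by (eapply Rlt_le_trans; [exact Hball | eapply Rle_trans; [apply Rmin_r | apply Rmin_r]]).
    assert (Hmupos : 0 < mu) by (apply Rabs_def2 in B1; lra).
    assert (Hl : forall s t, s ^ 2 + t ^ 2 = 1 ->
      s * (Mre (cpt mu e) - Mre (cpt mu0 e)) + t * (Mim (cpt mu e) - I0)
        <= Rabs (mu - mu0) / (2 * e) * (I0 + Mim (cpt mu e))).
    { intros s t Hst. rewrite (Rabs_minus_sym mu mu0).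
      exact (weyl_lipschitz (cpt mu0 e) (cpt mu e) s t Hmu Hmupos He eq_refl Hst). }
    set (K := Rabs (mu - mu0) / (2 * e)) in *.
    assert (HK0 : 0 <= K) by (apply Rdiv_le_0_compat; [apply Rabs_pos | lra]).
    assert (HK1 : K < 1 / 2).
    { unfold K. apply Rlt_div_l; lra. }
    assert (HK2 : 4 * K * I0 < eps).
    { unfold K. apply Rlt_div_r in B3; [|lra].
      replace (4 * (Rabs (mu - mu0) / (2 * e)) * I0) with (Rabs (mu - mu0) * (4 * I0) / (2 * e))
        by (field; lra).
      apply Rlt_div_l; [lra|]. pose proof (cond_pos eps). nra. }
    pose proof (Hl 1 0 ltac:(ring)). pose proof (Hl (-1) 0 ltac:(ring)).
    pose proof (Hl 0 1 ltac:(ring)). pose proof (Hl 0 (-1) ltac:(ring)).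
    set (I1 := Mim (cpt mu e)) in *. set (J1 := Mre (cpt mu e)) in *.
    set (J0 := Mre (cpt mu0 e)) in *.
    (* The right side of the estimate contains [I1] itself; K < 1/2 allows it to be absorbed. *)
    assert (HI1 : I1 <= 3 * I0).
    { assert ((1 - K) * I1 <= (1 + K) * I0) by lra. nra. }
    assert (K * (I0 + I1) <= 4 * K * I0) by nra.
    split; apply Rabs_def1; lra. }
  split; apply filterlim_locally; intros eps; generalize (Hb eps); apply filter_imp;
    intros mu [H1 H2]; assumption.
Qed.

Definition Mre_star (lam : R) : R := - Q1 1 lam / (2 * R1 1 lam).
Definition Mim_star (lam : R) : R := / R1 1 lam.

(** With [h = |psi| ^ 2], [E - 2 W = r h |M - M_star| ^ 2] and [W = h Im M], so the relative bound
    on [E - 2 W] controls the squared distance to [M_star] by eta times [Im M]. The latter is at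
    most [/ r] plus the distance: a square bounded by a small multiple of an affine function of its
    root is small. *)
Lemma weyl_uniform_limit (l1 l2 del : R) : 0 < l1 -> 0 < del ->
  exists e0, 0 < e0 /\ forall lam e, l1 <= lam <= l2 -> 0 < e < e0 ->
    Rabs (Mre (cpt lam e) - Mre_star lam) <= del /\ Rabs (Mim (cpt lam e) - Mim_star lam) <= del.
Proof.
  intros Hl1 Hdel.
  (* This first use, with tolerance 1, only provides a bound C0 for [P + R] at 1: eta depends on C0,
     and the second use depends on eta. *)
  destruct (U1_uniform_of_hypotheses l1 l2 1 Hl1 ltac:(lra)) as (X0 & C0 & HX0 & HC0 & HCb0).
  (* [eta <= 1/2] gives [E <= 4 W]. The other bound gives [4 eta C0 (C0 / del + 1) < del], which
     makes [D > del] incompatible with [D ^ 2 <= 4 eta C0 (C0 + D)]. *)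
  set (eta := Rmin (1 / 2) (del / (C0 / del + 1) / (8 * C0))).
  assert (HCd : 0 < C0 / del) by (apply Rdiv_lt_0_compat; lra).
  assert (Heta : 0 < eta).
  { apply Rmin_glb_lt; [lra|]. repeat apply Rdiv_lt_0_compat; lra. }
  assert (Heta1 : eta <= 1 / 2) by apply Rmin_l.
  assert (Heta2 : 4 * eta * C0 * (C0 / del + 1) < del).
  { apply (Rle_lt_trans _ (del / 2)); [|lra].
    assert (H : eta <= del / (C0 / del + 1) / (8 * C0)) by apply Rmin_r.
    apply Rle_div_r in H; [|lra]. apply Rle_div_r in H; [|lra]. lra. }
  destruct (U1_uniform_of_hypotheses l1 l2 (eta / 2) Hl1 ltac:(lra)) as (X & C & HX & HC & HXC).
  destruct (energy_flux_uniform (qfun qs) P1 Q1 R1 Hlim HU l1 l2 eta X C (eta / 2) Hl1 Heta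
    ltac:(lra) HX HC HXC) as (e0 & He0 & HE).
  exists e0. split; [exact He0|]. intros lam e Hlam He.
  set (z := cpt lam e). assert (Hz : 0 < Im z) by (simpl; lra).
  destruct (psi_flux_pos z Hz) as (Hf & Hn & Hi).
  specialize (HE lam Hlam e He _ _ _ _ (psi_L2 z ltac:(simpl; lra))).
  destruct (HCb0 lam Hlam) as [_ Hnear]. specialize (Hnear 1 ltac:(lra)).
  assert (Hl : 0 < lam) by lra. destruct (HU lam Hl) as (HA & HP & HQ & HR).
  destruct (appell_pos _ _ _ _ _ Hl HA HP HQ HR 1 Rlt_0_1) as [Hpp Hrp].
  pose proof (appell_det _ _ _ _ _ Hl HA HP HQ HR 1 Rlt_0_1) as Hdet.
  pose proof (energy_flux _ _ _ _ _ Hl HA HP HQ HR (psi_a z) (psi_b z) (psi_c z) (psi_d z)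
    1 Rlt_0_1) as Hid.
  fold (U1_energy P1 Q1 R1 lam) in Hid. cbv beta in *.
  set (E := U1_energy P1 Q1 R1 lam (psi_a z) (psi_b z) (psi_c z) (psi_d z) 1) in *.
  set (Wf := flux (psi_a z) (psi_b z) (psi_c z) (psi_d z) 1) in *.
  set (h := normsq (psi_a z) (psi_b z) 1) in *.
  set (r := R1 1 lam) in *. set (p := P1 1 lam) in *.
  set (x := Mre z - Mre_star lam). set (y := Mim z - Mim_star lam).
  assert (Hdist : E - 2 * Wf = r * h * (x ^ 2 + y ^ 2)).
  { apply (Rmult_eq_reg_l r); [|lra]. rewrite Hid.
    unfold x, y, Mre, Mim, weyl_re, weyl_im, Mre_star, Mim_star. fold r.
    unfold h, cross, flux. unfold h in Hn. unfold normsq in *. field. split; lra. }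
  assert (HW : Wf = (y + / r) * h).
  { unfold y, Mim, weyl_im, Mim_star. fold r h Wf. field. split; lra. }
  assert (HE4 : E <= 4 * Wf) by nra.
  assert (Hkey : r * (x ^ 2 + y ^ 2) <= 4 * eta * (y + / r)).
  { apply (Rmult_le_reg_r h); [exact Hn|].
    replace (r * (x ^ 2 + y ^ 2) * h) with (E - 2 * Wf) by (rewrite Hdist; ring).
    replace (4 * eta * (y + / r) * h) with (eta * (4 * Wf)) by (rewrite HW; ring).
    apply (Rle_trans _ _ _ HE). apply Rmult_le_compat_l; lra. }
  assert (Hri : / r <= C0).
  { apply (Rmult_le_reg_l r); [exact Hrp|]. rewrite Rinv_r by lra.
    pose proof (pow2_ge_0 (Q1 1 lam)). nra. }
  assert (Hk2 : x ^ 2 + y ^ 2 <= 4 * eta * C0 * (C0 + Rabs y)).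
  { pose proof (Rle_abs y). pose proof (Rabs_pos y).
    assert (Hrip : 0 < / r) by (now apply Rinv_0_lt_compat).
    replace (x ^ 2 + y ^ 2) with (/ r * (r * (x ^ 2 + y ^ 2))) by (field; lra).
    apply (Rle_trans _ (/ r * (4 * eta * (y + / r)))); [apply Rmult_le_compat_l; lra|].
    apply (Rle_trans _ (/ r * (4 * eta * (C0 + Rabs y)))).
    - apply Rmult_le_compat_l; [lra|]. apply Rmult_le_compat_l; lra.
    - replace (4 * eta * C0 * (C0 + Rabs y)) with (C0 * (4 * eta * (C0 + Rabs y))) by ring.
      apply Rmult_le_compat_r; [|exact Hri].
      repeat apply Rmult_le_pos; lra. }
  assert (Hx2 : Rabs x ^ 2 = x ^ 2) by apply pow2_abs.
  assert (Hy2 : Rabs y ^ 2 = y ^ 2) by apply pow2_abs.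
  set (D := Rmax (Rabs x) (Rabs y)).
  assert (HDx : Rabs x <= D) by apply Rmax_l. assert (HDy : Rabs y <= D) by apply Rmax_r.
  assert (HD2 : D ^ 2 <= x ^ 2 + y ^ 2).
  { pose proof (pow2_ge_0 x). pose proof (pow2_ge_0 y).
    unfold D. destruct (Rmax_case_strong (Rabs x) (Rabs y) (fun t => t = Rabs x \/ t = Rabs y));
      auto; rewrite H1; lra. }
  assert (HDd : D <= del).
  { apply Rnot_lt_le. intros Hlt.
    assert (H1 : D * D <= 4 * eta * C0 * (C0 + D)).
    { apply (Rle_trans _ (4 * eta * C0 * (C0 + Rabs y))); [nra|].
      apply Rmult_le_compat_l; [repeat apply Rmult_le_pos; lra | lra]. }
    assert (H2 : C0 <= C0 / del * D).
    { replace C0 with (C0 / del * del) at 1 by (field; lra). apply Rmult_le_compat_l; lra. }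
    assert (H3 : 4 * eta * C0 * (C0 + D) <= 4 * eta * C0 * ((C0 / del + 1) * D)).
    { apply Rmult_le_compat_l; [repeat apply Rmult_le_pos; lra | lra]. }
    assert (H4 : 4 * eta * C0 * ((C0 / del + 1) * D) < del * D) by nra.
    nra. }
  split; lra.
Qed.

(** Interchange of limits: [M (mu, e)] is linked to [M_star lam0] through [M_star mu],
    [M (mu, e0 / 2)] and [M (lam0, e0 / 2)]. Uniformity pays for three of the four steps and
    continuity at height [e0 / 2] for the other, each costing at most eps / 5. *)
Lemma weyl_joint_limit (lam0 : R) : 0 < lam0 ->
  filterlim (fun t : R * R => Mre (cpt (fst t) (snd t)))
    (filter_prod (locally lam0) (at_right 0)) (locally (Mre_star lam0)) /\
  filterlim (fun t : R * R => Mim (cpt (fst t) (snd t)))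
    (filter_prod (locally lam0) (at_right 0)) (locally (Mim_star lam0)).
Proof.
  intros Hl0.
  assert (Hb : forall eps : posreal, filter_prod (locally lam0) (at_right 0) (fun t : R * R =>
    Rabs (Mre (cpt (fst t) (snd t)) - Mre_star lam0) < eps /\
    Rabs (Mim (cpt (fst t) (snd t)) - Mim_star lam0) < eps)).
  { intros eps. pose proof (cond_pos eps) as Heps.
    destruct (weyl_uniform_limit (lam0 / 2) (2 * lam0) (eps / 5)) as (e0 & He0 & Hu); try lra.
    assert (He1 : 0 < e0 / 2) by lra.
    destruct (weyl_continuous lam0 (e0 / 2) Hl0 He1) as [C1 C2].
    assert (He5 : 0 < eps / 5) by lra.
    assert (N1 : locally lam0 (fun mu =>
      Rabs (Mre (cpt mu (e0 / 2)) - Mre (cpt lam0 (e0 / 2))) < eps / 5))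
      by exact (C1 _ (locally_ball _ (mkposreal _ He5))).
    assert (N2 : locally lam0 (fun mu =>
      Rabs (Mim (cpt mu (e0 / 2)) - Mim (cpt lam0 (e0 / 2))) < eps / 5))
      by exact (C2 _ (locally_ball _ (mkposreal _ He5))).
    assert (N3 : locally lam0 (fun mu => lam0 / 2 <= mu <= 2 * lam0)).
    { exists (mkposreal (lam0 / 2) ltac:(lra)). intros mu Hmu.
      change (Rabs (mu - lam0) < lam0 / 2) in Hmu. apply Rabs_def2 in Hmu. lra. }
    assert (N4 : at_right 0 (fun e => 0 < e < e0)).
    { exists (mkposreal e0 He0). intros e Hball Hpos.
      change (Rabs (e - 0) < e0) in Hball. apply Rabs_def2 in Hball. lra. }
    refine (Filter_prod _ _ _ _ _ (filter_and _ _ N3 (filter_and _ _ N1 N2)) N4 _).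
    intros mu e (M3 & M1 & M2) M4. simpl fst. simpl snd.
    destruct (Hu mu e M3 M4) as [U1 U2]. destruct (Hu mu (e0 / 2) M3 ltac:(lra)) as [U3 U4].
    destruct (Hu lam0 (e0 / 2) ltac:(lra) ltac:(lra)) as [U5 U6].
    apply Rabs_le_between in U1. apply Rabs_le_between in U2. apply Rabs_le_between in U3.
    apply Rabs_le_between in U4. apply Rabs_le_between in U5. apply Rabs_le_between in U6.
    apply Rabs_def2 in M1. apply Rabs_def2 in M2.
    split; apply Rabs_def1; lra. }
  split; apply filterlim_locally; intros eps; generalize (Hb eps); apply filter_imp;
    intros t [H1 H2]; assumption.
Qed.

Lemma mob_limit {T : Type} {F : (T -> Prop) -> Prop} {PF : ProperFilter F}
  (z : T -> C) (Mr Mi : T -> R) (z0 : C) (Mr0 Mi0 : R) :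
  filterlim (fun t => Re (z t)) F (locally (Re z0)) ->
  filterlim (fun t => Im (z t)) F (locally (Im z0)) ->
  filterlim Mr F (locally Mr0) -> filterlim Mi F (locally Mi0) ->
  mob_re phi dphi z0 Mr0 Mi0 * mob_re phi dphi z0 Mr0 Mi0
    + mob_im phi dphi z0 Mr0 Mi0 * mob_im phi dphi z0 Mr0 Mi0 <> 0 ->
  filterlim (fun t => mob (z t) (Mr t) (Mi t)) F (locally (mob z0 Mr0 Mi0)).
Proof.
  intros Hzr Hzi HMr HMi HD.
  pose proof (frobenius_limits qs phi dphi theta dtheta Hconv Hq0 Hphi Htheta z z0 Hzr Hzi) as HL.
  destruct (HL phi ltac:(auto)) as [A1 A2]. destruct (HL dphi ltac:(auto)) as [A3 A4].
  destruct (HL theta ltac:(auto)) as [A5 A6]. destruct (HL dtheta ltac:(auto)) as [A7 A8].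
  assert (B : forall f df, filterlim (fun t => Re (f 1 (z t))) F (locally (Re (f 1 z0))) ->
    filterlim (fun t => Im (f 1 (z t))) F (locally (Im (f 1 z0))) ->
    filterlim (fun t => Re (df 1 (z t))) F (locally (Re (df 1 z0))) ->
    filterlim (fun t => Im (df 1 (z t))) F (locally (Im (df 1 z0))) ->
    filterlim (fun t => mob_re f df (z t) (Mr t) (Mi t)) F (locally (mob_re f df z0 Mr0 Mi0)) /\
    filterlim (fun t => mob_im f df (z t) (Mr t) (Mi t)) F (locally (mob_im f df z0 Mr0 Mi0))).
  { intros f df F1 F2 F3 F4. unfold mob_re, mob_im. split.
    - apply filterlim_Rminus; [exact F3|]. apply filterlim_Rminus; now apply filterlim_Rmult.
    - apply filterlim_Rminus; [exact F4|]. apply filterlim_Rplus; now apply filterlim_Rmult. }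
  destruct (B phi dphi A1 A2 A3 A4) as [B1 B2].
  destruct (B theta dtheta A5 A6 A7 A8) as [B3 B4].
  unfold mob. apply filterlim_Rmult.
  - apply filterlim_Rminus; now apply filterlim_Rmult.
  - apply filterlim_Rinv; [|exact HD]. apply filterlim_Rplus; now apply filterlim_Rmult.
Qed.

(** * Identification of the limit with [1 / astar] *)

Hypothesis Hcoef : forall lam, 0 < lam -> forall x, 0 < x ->
  let th := theta x (RtoC lam) in let dth := dtheta x (RtoC lam) in
  let ph := phi x (RtoC lam) in let dph := dphi x (RtoC lam) in
  RtoC (P1 x lam)
    = (RtoC (astar lam) * (dth * dth) + RtoC (bstar lam) * (dth * dph)
       + RtoC (cstar lam) * (dph * dph))%C /\
  RtoC (Q1 x lam)
    = (RtoC (astar lam) * (- (2 * th * dth))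
       + RtoC (bstar lam) * (- (th * dph + dth * ph))
       + RtoC (cstar lam) * (- (2 * ph * dph)))%C /\
  RtoC (R1 x lam)
    = (RtoC (astar lam) * (th * th) + RtoC (bstar lam) * (th * ph)
       + RtoC (cstar lam) * (ph * ph))%C.

(** Substituting the three expansions leaves [astar] times the squared Wronskian; the terms in
    [bstar] and [cstar] cancel. *)
Lemma astar_eq (lam x : R) : 0 < lam -> 0 < x ->
  (RtoC (P1 x lam) * phi x (RtoC lam) * phi x (RtoC lam)
   + RtoC (Q1 x lam) * phi x (RtoC lam) * dphi x (RtoC lam)
   + RtoC (R1 x lam) * dphi x (RtoC lam) * dphi x (RtoC lam))%C = RtoC (astar lam).
Proof.
  intros Hl Hx. destruct (Hcoef lam Hl x Hx) as (E1 & E2 & E3).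
  rewrite E1, E2, E3.
  destruct (frobenius_wronskian qs phi dphi theta dtheta Hphi Htheta (RtoC lam) x Hx) as [W1 W2].
  assert (W : (phi x (RtoC lam) * dtheta x (RtoC lam) - dphi x (RtoC lam) * theta x (RtoC lam))%C
    = RtoC 1).
  { unfold wronskian_re, wronskian_im in W1, W2. apply injective_projections.
    - unfold Re, Im in *. simpl. lra.
    - unfold Re, Im in *. simpl. lra. }
  set (ph := phi x (RtoC lam)) in *. set (dph := dphi x (RtoC lam)) in *.
  set (th := theta x (RtoC lam)) in *. set (dth := dtheta x (RtoC lam)) in *.
  transitivity (RtoC (astar lam) * ((ph * dth - dph * th) * (ph * dth - dph * th)))%C; [ring|].
  rewrite W. ring.
Qed.

Lemma astar_real (lam : R) : 0 < lam ->
  P1 1 lam * Re (phi 1 (RtoC lam)) ^ 2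
  + Q1 1 lam * Re (phi 1 (RtoC lam)) * Re (dphi 1 (RtoC lam))
  + R1 1 lam * Re (dphi 1 (RtoC lam)) ^ 2 = astar lam.
Proof.
  intros Hl. pose proof (astar_eq lam 1 Hl Rlt_0_1) as E.
  destruct (frobenius_real qs phi dphi theta dtheta Hphi Htheta lam 1 Rlt_0_1)
    as (I1 & I2 & _ & _).
  apply (f_equal Re) in E.
  destruct (phi 1 (RtoC lam)) as [pr pi], (dphi 1 (RtoC lam)) as [dr di].
  unfold Re, Im in *. simpl in *. rewrite I1, I2 in E. lra.
Qed.

(** At real lam, [|phi' - M_star phi| ^ 2 = astar / r], and the numerator is the Wronskian times
    [Im M_star = / r]. Positivity comes from [4 r astar = (2 r phi' + Q phi) ^ 2 + 4 phi ^ 2], as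
    phi and phi' do not vanish together. *)
Lemma mob_star (lam : R) : 0 < lam ->
  0 < astar lam /\
  mob_re phi dphi (RtoC lam) (Mre_star lam) (Mim_star lam)
    * mob_re phi dphi (RtoC lam) (Mre_star lam) (Mim_star lam)
  + mob_im phi dphi (RtoC lam) (Mre_star lam) (Mim_star lam)
    * mob_im phi dphi (RtoC lam) (Mre_star lam) (Mim_star lam) <> 0 /\
  mob (RtoC lam) (Mre_star lam) (Mim_star lam) = / astar lam.
Proof.
  intros Hl. pose proof (astar_real lam Hl) as HA.
  destruct (frobenius_real qs phi dphi theta dtheta Hphi Htheta lam 1 Rlt_0_1)
    as (I1 & I2 & I3 & I4).
  destruct (frobenius_wronskian qs phi dphi theta dtheta Hphi Htheta (RtoC lam) 1 Rlt_0_1)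
    as [W _].
  unfold wronskian_re in W. rewrite I1, I2, I3, I4 in W.
  destruct (U1_pos (qfun qs) P1 Q1 R1 HU lam 1 Hl Rlt_0_1) as [Hp Hr].
  pose proof (U1_det (qfun qs) P1 Q1 R1 HU lam 1 Hl Rlt_0_1) as Hd.
  set (f := Re (phi 1 (RtoC lam))) in *. set (df := Re (dphi 1 (RtoC lam))) in *.
  set (g := Re (theta 1 (RtoC lam))) in *. set (dg := Re (dtheta 1 (RtoC lam))) in *.
  set (P := P1 1 lam) in *. set (Q := Q1 1 lam) in *. set (r := R1 1 lam) in *.
  assert (HD : mob_re phi dphi (RtoC lam) (Mre_star lam) (Mim_star lam)
      * mob_re phi dphi (RtoC lam) (Mre_star lam) (Mim_star lam)
    + mob_im phi dphi (RtoC lam) (Mre_star lam) (Mim_star lam)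
      * mob_im phi dphi (RtoC lam) (Mre_star lam) (Mim_star lam) = astar lam / r).
  { unfold mob_re, mob_im, Mre_star, Mim_star. rewrite I1, I2. fold f df Q r.
    rewrite <- HA. replace P with ((4 + Q ^ 2) / (4 * r)); [field; lra|].
    replace (4 + Q ^ 2) with (4 * P * r) by lra. field. lra. }
  assert (Ha : 0 < astar lam).
  { assert (4 * r * astar lam = (2 * r * df + Q * f) ^ 2 + 4 * f ^ 2).
    { rewrite <- HA. replace (4 * f ^ 2) with ((4 * P * r - Q ^ 2) * f ^ 2) by (rewrite Hd; ring).
      ring. }
    pose proof (pow2_ge_0 (2 * r * df + Q * f)). pose proof (pow2_ge_0 f).
    destruct (Req_dec f 0) as [Hf|Hf].
    - rewrite Hf in *. assert (Hdf : df <> 0) by (intros Hdf; rewrite Hdf in W; lra).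
      assert (0 < df ^ 2) by (apply pow2_gt_0; exact Hdf).
      rewrite <- HA. nra.
    - assert (0 < f ^ 2) by (apply pow2_gt_0; exact Hf). nra. }
  split; [exact Ha|]. split.
  - rewrite HD. apply Rgt_not_eq. now apply Rdiv_lt_0_compat.
  - unfold mob. rewrite HD.
    unfold mob_re, mob_im, Mre_star, Mim_star. rewrite I1, I2, I3, I4. fold f df g dg Q r.
    transitivity (((f * dg - df * g) / r) * / (astar lam / r)).
    + f_equal. field. lra.
    + replace (f * dg - df * g) with 1 by lra. field. split; lra.
Qed.

Lemma Im_m_joint_limit (lam0 : R) : 0 < lam0 ->
  filterlim (fun t : R * R => Im (m (cpt (fst t) (snd t))))
    (filter_prod (locally lam0) (at_right 0)) (locally (/ astar lam0)).
Proof.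
  intros Hl0. destruct (mob_star lam0 Hl0) as (_ & HD & <-).
  destruct (weyl_joint_limit lam0 Hl0) as [L1 L2].
  apply (filterlim_ext_loc (fun t : R * R =>
    mob (cpt (fst t) (snd t)) (Mre (cpt (fst t) (snd t))) (Mim (cpt (fst t) (snd t))))).
  - apply (Filter_prod _ _ _ (fun _ => True) (fun e => 0 < e)); [apply filter_true| |].
    + exists (mkposreal 1 Rlt_0_1). intros e _ He. exact He.
    + intros mu e _ He. symmetry. now apply Im_m.
  - apply mob_limit; auto.
    + apply filterlim_fst.
    + apply (filterlim_filter_le_2 (G := at_right 0)); [now apply filter_le_within|].
      apply filterlim_snd.
Qed.

Lemma Im_m_limit (lam0 : R) : 0 < lam0 ->
  filterlim (fun e => Im (m (cpt lam0 e))) (at_right 0) (locally (/ astar lam0)).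
Proof.
  intros Hl0.
  apply (filterlim_comp _ _ _ (fun e => (lam0, e)) (fun t : R * R => Im (m (cpt (fst t) (snd t))))
    _ (filter_prod (locally lam0) (at_right 0))); [|now apply Im_m_joint_limit].
  intros S [A B HA HB HS]. change (at_right 0 (fun e => S (lam0, e))). generalize HB. apply filter_imp. intros e He.
  apply HS; [now apply locally_singleton | exact He].
Qed.

(** Makes the integrand in the formula for [rho] Riemann integrable at each height e; without it
    nothing could be read off from [RInt]. *)
Lemma Im_m_continuous (mu0 e : R) : 0 < mu0 -> 0 < e ->
  continuous (fun mu => Im (m (cpt mu e))) mu0.
Proof.
  intros Hmu He. destruct (weyl_continuous mu0 e Hmu He) as [C1 C2].
  destruct (Im_m (cpt mu0 e) He) as [HD HE]. unfold continuous. rewrite HE.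
  apply (filterlim_ext (fun mu => mob (cpt mu e) (Mre (cpt mu e)) (Mim (cpt mu e)))).
  - intros mu. symmetry. now apply Im_m.
  - apply mob_limit; auto.
    + exact (filterlim_id R (locally mu0)).
    + exact (filterlim_Rconst e).
Qed.

(** A square integrable solution at lam > 0 vanishes by [L2_solution_real_zero]. Hence the formula
    for [rho] applies between any two positive points. *)
Lemma not_eigenvalue (lam : R) : 0 < lam -> ~ eigenvalue qs phi dphi lam.
Proof.
  intros Hl (y & dy & Hs & (x & Hx & Hyx) & HI & _).
  assert (Hau : at_right 0 (fun u => 0 < u <= 1)).
  { exists (mkposreal 1 Rlt_0_1). intros u Hu Hpos.
    change (Rabs (u - 0) < 1) in Hu. apply Rabs_def2 in Hu. lra. }
  destruct (L2_solution_of_rsol _ _ _ _ _ _ _ Hau (solves_rsol _ _ _ _ Hs) HI) as [Hr (H & B & HH & HB)].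
  destruct (HU lam Hl) as (HA & HP & HQ & HR).
  pose proof (L2_solution_real_zero _ _ _ _ _ Hl HA HP HQ HR _ _ _ _ _ Hr H B Hlim HH HB
    (Rle_refl 0) eq_refl x Hx) as Hz.
  unfold normsq in Hz. rewrite <- Cmod_sq in Hz. apply Hyx, Cmod_eq_0.
  apply Rsqr_0_uniq. unfold Rsqr. lra.
Qed.

Lemma RInt_near_const (f : R -> R) (a b L eta : R) :
  (forall t, Rmin a b <= t <= Rmax a b -> continuous f t /\ Rabs (f t - L) <= eta) ->
  Rabs (RInt f a b - L * (b - a)) <= eta * Rabs (b - a).
Proof.
  assert (Hle : forall a b, a <= b ->
    (forall t, a <= t <= b -> continuous f t /\ Rabs (f t - L) <= eta) ->
    Rabs (RInt f a b - L * (b - a)) <= eta * (b - a)).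
  { clear a b. intros a b Hab' Hf.
    assert (Hex : ex_RInt f a b).
    { apply (ex_RInt_continuous (V := R_CompleteNormedModule)). intros t Ht.
      rewrite Rmin_left, Rmax_right in Ht by lra. now apply Hf. }
    replace (RInt f a b - L * (b - a)) with (RInt (fun t => f t - L) a b).
    - rewrite Rmult_comm. apply abs_RInt_le_const; [exact Hab'| |].
      + apply (ex_RInt_minus (V := R_NormedModule)); [exact Hex | apply ex_RInt_const].
      + intros t Ht. now apply Hf.
    - rewrite (RInt_minus (V := R_CompleteNormedModule) f (fun _ => L)); [|exact Hex | apply ex_RInt_const].
      rewrite RInt_const. unfold minus, plus, opp, scal; simpl; unfold mult; simpl. ring. }
  intros Hf. destruct (Rle_dec a b) as [H|H].
  - rewrite Rmin_left, Rmax_right in Hf by lra. rewrite (Rabs_pos_eq (b - a)) by lra.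
    now apply Hle.
  - rewrite Rmin_right, Rmax_left in Hf by lra.
    rewrite <- (opp_RInt_swap (V := R_CompleteNormedModule)).
    + unfold opp; simpl. replace (- RInt f b a - L * (b - a)) with (- (RInt f b a - L * (a - b))) by ring.
      rewrite Rabs_Ropp, (Rabs_minus_sym b a), (Rabs_pos_eq (a - b)) by lra.
      apply Hle; [lra | exact Hf].
    + apply (ex_RInt_continuous (V := R_CompleteNormedModule)). intros t Ht.
      rewrite Rmin_left, Rmax_right in Ht by lra. now apply Hf.
Qed.

(** * From the boundary values of [Im m] to the spectral function *)

Hypothesis Hrho : forall lam0 lam,
  ~ eigenvalue qs phi dphi lam0 -> ~ eigenvalue qs phi dphi lam ->
  filterlim
    (fun eps => / PI * RInt (fun mu => Im (m (cpt mu eps))) lam0 lam)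
    (at_right 0) (locally (rho lam - rho lam0)).

Lemma joint_nbhd (lam0 eta : R) : 0 < lam0 -> 0 < eta ->
  exists del, 0 < del /\ del <= lam0 / 2 /\ forall mu e, Rabs (mu - lam0) < del -> 0 < e < del ->
    Rabs (Im (m (cpt mu e)) - / astar lam0) < eta.
Proof.
  intros Hl0 Heta.
  destruct (Im_m_joint_limit lam0 Hl0 _ (locally_ball _ (mkposreal eta Heta)))
    as [A B [dA HA] [dB HB] HS].
  exists (Rmin (lam0 / 2) (Rmin dA dB)).
  pose proof (cond_pos dA). pose proof (cond_pos dB).
  pose proof (Rmin_l (lam0 / 2) (Rmin dA dB)). pose proof (Rmin_r (lam0 / 2) (Rmin dA dB)).
  pose proof (Rmin_l dA dB). pose proof (Rmin_r dA dB).
  split; [repeat apply Rmin_glb_lt; lra|]. split; [lra|].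
  intros mu e Hmu He. apply (HS mu e).
  - apply HA. change (Rabs (mu - lam0) < dA). lra.
  - apply HB; [|lra]. change (Rabs (e - 0) < dB). rewrite Rabs_pos_eq; lra.
Qed.

(** For every small e the mean of [Im m] between lam0 and lam0 + h is close to [1 / astar], by the
    joint limit; this non-strict inequality survives the limit e -> 0 and bounds the difference
    quotient of [rho]. *)
Lemma rho_derive (lam0 : R) : 0 < lam0 -> is_derive rho lam0 (/ (PI * astar lam0)).
Proof.
  intros Hl0. pose proof PI_RGT_0 as HPI. destruct (mob_star lam0 Hl0) as (Ha & _ & _).
  apply is_derive_Reals. intros eps Heps.
  (* The factor PI compensates [/ PI] in the formula for [rho]; the half restores a strict
     inequality after the limit. *)
  assert (Heta : 0 < eps * PI / 2) by (apply Rdiv_lt_0_compat; [now apply Rmult_lt_0_compat | lra]).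
  destruct (joint_nbhd lam0 _ Hl0 Heta) as (del & Hdel & Hdl & Hn).
  exists (mkposreal del Hdel). intros h Hh0 Hh. simpl in Hh.
  assert (Hlam : 0 < lam0 + h) by (apply Rabs_def2 in Hh; lra).
  pose proof (Hrho lam0 (lam0 + h) (not_eigenvalue _ Hl0) (not_eigenvalue _ Hlam)) as HL.
  assert (Hb : Rabs (rho (lam0 + h) - rho lam0 - / (PI * astar lam0) * h) <= eps / 2 * Rabs h).
  { apply (filterlim_le (F := at_right 0)
      (fun e => Rabs (/ PI * RInt (fun mu => Im (m (cpt mu e))) lam0 (lam0 + h)
        - / (PI * astar lam0) * h)) (fun _ => eps / 2 * Rabs h)
      (Rabs (rho (lam0 + h) - rho lam0 - / (PI * astar lam0) * h)) (eps / 2 * Rabs h)).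
    - exists (mkposreal del Hdel). intros e Hball Hpos.
      change (Rabs (e - 0) < del) in Hball. apply Rabs_def2 in Hball.
      assert (HI : Rabs (RInt (fun mu => Im (m (cpt mu e))) lam0 (lam0 + h)
        - / astar lam0 * (lam0 + h - lam0)) <= eps * PI / 2 * Rabs (lam0 + h - lam0)).
      { apply RInt_near_const. intros t Ht.
        assert (Htd : Rabs (t - lam0) < del).
        { apply Rabs_def2 in Hh. unfold Rmin, Rmax in Ht.
          apply Rabs_def1; destruct (Rle_dec lam0 (lam0 + h)); lra. }
        split.
        - apply Im_m_continuous; [apply Rabs_def2 in Htd; lra | lra].
        - apply Rlt_le, Hn; [exact Htd | lra]. }
      replace (lam0 + h - lam0) with h in HI by ring.
      replace (/ PI * RInt (fun mu => Im (m (cpt mu e))) lam0 (lam0 + h) - / (PI * astar lam0) * h)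
        with (/ PI * (RInt (fun mu => Im (m (cpt mu e))) lam0 (lam0 + h) - / astar lam0 * h))
        by (field; split; lra).
      rewrite Rabs_mult, (Rabs_pos_eq (/ PI)) by (apply Rlt_le, Rinv_0_lt_compat; lra).
      replace (eps / 2 * Rabs h) with (/ PI * (eps * PI / 2 * Rabs h)) by (field; lra).
      apply Rmult_le_compat_l; [apply Rlt_le, Rinv_0_lt_compat; lra | exact HI].
    - apply (filterlim_continuous Rabs); [apply continuous_Rabs|].
      apply filterlim_Rminus; [exact HL | apply filterlim_Rconst].
    - apply filterlim_Rconst. }
  replace ((rho (lam0 + h) - rho lam0) / h - / (PI * astar lam0)) with
    ((rho (lam0 + h) - rho lam0 - / (PI * astar lam0) * h) / h) by (field; repeat split; lra).
  unfold Rdiv. rewrite Rabs_mult, Rabs_inv.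
  pose proof (Rabs_pos_lt h Hh0).
  apply (Rmult_lt_reg_r (Rabs h)); [assumption|].
  rewrite Rmult_assoc, Rinv_l by lra. nra.
Qed.

(** Letting e -> 0 at fixed lam in the joint estimate leaves [1 / astar lam] within eps / 2 of
    [1 / astar lam0]. *)
Lemma density_continuous (lam0 : R) : 0 < lam0 -> continuity_pt (fun lam => / astar lam) lam0.
Proof.
  intros Hl0. apply continuity_pt_filterlim, filterlim_locally. intros eps.
  destruct (joint_nbhd lam0 (eps / 2) Hl0 ltac:(pose proof (cond_pos eps); lra))
    as (del & Hdel & Hdl & Hn).
  exists (mkposreal del Hdel). intros lam Hlam. change (Rabs (lam - lam0) < del) in Hlam.
  change (Rabs (/ astar lam - / astar lam0) < eps).
  assert (Hl : 0 < lam) by (apply Rabs_def2 in Hlam; lra).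
  apply (Rle_lt_trans _ (eps / 2)); [|pose proof (cond_pos eps); lra].
  apply (filterlim_le (F := at_right 0) (fun e => Rabs (Im (m (cpt lam e)) - / astar lam0))
    (fun _ => eps / 2) (Rabs (/ astar lam - / astar lam0)) (eps / 2)).
  - exists (mkposreal del Hdel). intros e Hball Hpos.
    change (Rabs (e - 0) < del) in Hball. apply Rabs_def2 in Hball.
    apply Rlt_le, Hn; [exact Hlam | lra].
  - apply (filterlim_continuous Rabs); [apply continuous_Rabs|].
    apply filterlim_Rminus; [now apply Im_m_limit | apply filterlim_Rconst].
  - apply filterlim_Rconst.
Qed.

(** The density is continuous, hence bounded on [a, b], and the mean value theorem makes [rho]
    Lipschitz there with the maximum L of the density. *)
Lemma rho_AC : AC_on_pos rho.
Proof.
  intros a b Ha Hab'.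
  destruct (continuity_ab_maj (fun lam => / astar lam) a b Hab') as [x1 [Hx1 Hx1ab]].
  { intros c Hc. apply density_continuous. lra. }
  pose proof PI_RGT_0 as HPI.
  set (L := / PI * / astar x1).
  assert (HL : 0 < L).
  { destruct (mob_star x1 ltac:(lra)) as (Hax & _ & _).
    apply Rmult_lt_0_compat; now apply Rinv_0_lt_compat. }
  assert (Hlip : forall c d, a <= c -> c <= d -> d <= b -> Rabs (rho d - rho c) <= L * (d - c)).
  { intros c d Hac Hcd Hdb.
    destruct (MVT_gen rho c d (fun lam => / (PI * astar lam))) as (t & Ht & E).
    - rewrite Rmin_left, Rmax_right by lra. intros t Ht. apply rho_derive. lra.
    - rewrite Rmin_left, Rmax_right by lra. intros t Ht.
      apply derivable_continuous_pt. exists (/ (PI * astar t)). apply is_derive_Reals, rho_derive. lra.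
    - rewrite Rmin_left, Rmax_right in Ht by lra. rewrite E, Rabs_mult, (Rabs_pos_eq (d - c)) by lra.
      apply Rmult_le_compat_r; [lra|]. destruct (mob_star t ltac:(lra)) as (Hat & _ & _).
      rewrite Rinv_mult, Rabs_pos_eq.
      + apply Rmult_le_compat_l; [apply Rlt_le, Rinv_0_lt_compat; lra | apply Hx1; lra].
      + apply Rmult_le_pos; apply Rlt_le, Rinv_0_lt_compat; lra. }
  intros eps Heps. exists (eps / L). split; [now apply Rdiv_lt_0_compat|].
  intros l Hl Hlen. apply (Rle_lt_trans _ (L * total_length l)).
  (* The induction needs a moving left endpoint: [intervals_in] restarts at the right end of each
     interval, while the Lipschitz bound stays attached to a. *)
  - clear Hlen. assert (Haa : a <= a) by lra. revert Hl Haa. generalize a at 1 3 as a'.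
    induction l as [|[c d] l IH]; intros a' Hl Haa.
    + simpl. lra.
    + simpl in Hl. destruct Hl as (H1 & H2 & H3 & H4). simpl.
      specialize (IH d H4 ltac:(lra)). specialize (Hlip c d ltac:(lra) H2 H3).
      fold (total_length l). fold (total_variation rho l). lra.
  - apply Rlt_div_r in Hlen; lra.
Qed.

End Main.

Theorem theorem3
  (qs : nat -> R)
  (phi dphi theta dtheta : R -> C -> C)
  (m : C -> C)
  (rho : R -> R)
  (P1 Q1 R1 : R -> R -> R)
  (astar bstar cstar : R -> R)
  (* the series sum_{n>=0} q_{n+2} x^n converges on (0,oo) *)
  (Hconv : forall x, 0 < x -> ex_series (fun n => qs (n + 2)%nat * x ^ n))
  (Hq0 : - / 4 <= qs 0%nat)
  (Hq01 : ~ (qs 0%nat = 0 /\ qs 1%nat = 0))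
  (Hlim : is_lim (qfun qs) p_infty 0)
  (Hab : exists x0, 0 < x0 /\
           (L1_at_infty (qfun qs) x0 \/
            (L1_at_infty (Derive (qfun qs)) x0 /\ AC_loc_from (qfun qs) x0)))
  (* normalized Frobenius solutions phi = y1, theta = y2 / C *)
  (Hphi : frobenius_phi qs phi dphi)
  (Htheta : frobenius_theta qs phi theta dtheta)
  (* Titchmarsh-Weyl function *)
  (Hm : forall lam : C, Im lam <> 0 -> forall x0, 0 < x0 ->
          L2_at_infty (fun x => (theta x lam - m lam * phi x lam)%C) x0)
  (* spectral function *)
  (Hrho : forall lam0 lam,
          ~ eigenvalue qs phi dphi lam0 -> ~ eigenvalue qs phi dphi lam ->
          filterlim
            (fun eps => / PI * RInt (fun mu => Im (m (cpt mu eps))) lam0 lam)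
            (at_right 0) (locally (rho lam - rho lam0)))
  (* U1 = (P1,Q1,R1): solution of the Appell system with the limit at oo *)
  (HU : forall lam, 0 < lam ->
          appell_solution (qfun qs) lam
            (fun x => P1 x lam) (fun x => Q1 x lam) (fun x => R1 x lam) /\
          is_lim (fun x => P1 x lam) p_infty (sqrt lam) /\
          is_lim (fun x => Q1 x lam) p_infty 0 /\
          is_lim (fun x => R1 x lam) p_infty (/ sqrt lam))
  (* the coefficients a*, b*, c* *)
  (Hcoef : forall lam, 0 < lam -> forall x, 0 < x ->
     let th := theta x (RtoC lam) in let dth := dtheta x (RtoC lam) in
     let ph := phi x (RtoC lam) in let dph := dphi x (RtoC lam) in
     RtoC (P1 x lam)
       = (RtoC (astar lam) * (dth * dth) + RtoC (bstar lam) * (dth * dph)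
          + RtoC (cstar lam) * (dph * dph))%C /\
     RtoC (Q1 x lam)
       = (RtoC (astar lam) * (- (2 * th * dth))
          + RtoC (bstar lam) * (- (th * dph + dth * ph))
          + RtoC (cstar lam) * (- (2 * ph * dph)))%C /\
     RtoC (R1 x lam)
       = (RtoC (astar lam) * (th * th) + RtoC (bstar lam) * (th * ph)
          + RtoC (cstar lam) * (ph * ph))%C) :
  AC_on_pos rho /\
  forall lam, 0 < lam ->
    ex_derive rho lam /\
    filterlim (fun eps => / PI * Im (m (cpt lam eps)))
      (at_right 0) (locally (Derive rho lam)) /\
    Derive rho lam = xi2 astar lam / PI /\
    xi2 astar lam / PI = / (PI * astar lam) /\
    forall x, 0 < x ->
      RtoC (/ (PI * astar lam))
      = (/ (RtoC PI *
            (RtoC (P1 x lam) * phi x (RtoC lam) * phi x (RtoC lam)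
             + RtoC (Q1 x lam) * phi x (RtoC lam) * dphi x (RtoC lam)
             + RtoC (R1 x lam) * dphi x (RtoC lam) * dphi x (RtoC lam))))%C.
Proof.
  pose proof PI_RGT_0 as HPI. split.
  - exact (rho_AC qs phi dphi theta dtheta m rho P1 Q1 R1 astar bstar cstar Hconv Hq0 Hlim Hab
      Hphi Htheta Hm HU Hcoef Hrho).
  - intros lam Hl.
    pose proof (rho_derive qs phi dphi theta dtheta m rho P1 Q1 R1 astar bstar cstar Hconv Hq0
      Hlim Hab Hphi Htheta Hm HU Hcoef Hrho lam Hl) as Hd.
    destruct (mob_star qs phi dphi theta dtheta P1 Q1 R1 astar bstar cstar Hphi Htheta
      HU Hcoef lam Hl) as (Ha & _).
    rewrite (is_derive_unique _ _ _ Hd). unfold xi2. split; [eexists; exact Hd|]. split.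
    + rewrite Rinv_mult. apply filterlim_Rmult; [apply filterlim_Rconst|].
      exact (Im_m_limit qs phi dphi theta dtheta m P1 Q1 R1 astar bstar cstar Hconv Hq0 Hlim Hab
        Hphi Htheta Hm HU Hcoef lam Hl).
    + split; [field; split; lra|]. split; [field; split; lra|].
      intros x Hx.
      rewrite (astar_eq qs phi dphi theta dtheta P1 Q1 R1 astar bstar cstar Hphi Htheta Hcoef
        lam x Hl Hx).
      rewrite <- RtoC_mult. apply RtoC_inv. apply Rmult_integral_contrapositive_currified; lra.
Qed.
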